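(* Suppose that: (a) $U\in C^2(\mathbb R)$, $e^{-U}\in L^1(\mathbb R)$, and there are $\delta\in(0,1)$, $a\in\mathbb R$, $A>0$ with $a\le U''(x)\le \delta|U'(x)|^2+A$ for all $x\in\mathbb R$; (b) $\lim_{x\to\infty}U'(x)=+\infty$ and $\lim_{x\to-\infty}U'(x)=-\infty$; (c) $U(0)=0$, $U'(x)\le 0$ for $x\le 0$ and $U'(x)\ge 0$ for $x\ge 0$; (d) $\lambda_{\mathrm{refr}}(x)=0$ for all $x$. Let $L$ be the zigzag generator on $L^2(\mu)$, and let $\psi^{\pm}$, $Z$ and $\Sigma=\{\gamma\in\mathbb C: Z(\gamma)=0\}$ be as in the context. Then $\sigma(L)=\sigma_p(L)=\Sigma$. If $\gamma\in\rho(L)$ and $h\in L^2(\mu)$, then $f=(\gamma-L)^{-1}h$ is given by $$f^+(x)=\begin{cases} e^{\gamma x}\left(k^++\int_x^0 e^{-\gamma\xi}h^+(\xi)\,d\xi\right), & x\le 0,\\ e^{\gamma x+U(x)}\left(k^+-\int_0^x e^{-\gamma\xi-U(\xi)}\left[h^+(\xi)+U'(\xi)e^{-\gamma\xi}\left(k^-+\int_0^{\xi}e^{\gamma\eta}h^-(\eta)\,d\eta\right)\right]d\xi\right), & x>0,\end{cases}$$ $$f^-(x)=\begin{cases} e^{-\gamma x+U(x)}\left(k^--\int_x^0 e^{\gamma\xi-U(\xi)}\left[h^-(\xi)-U'(\xi)e^{\gamma\xi}\left(k^++\int_{\xi}^0 e^{-\gamma\eta}h^+(\eta)\,d\eta\right)\right]d\xi\right),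 & x\le 0,\\ e^{-\gamma x}\left(k^-+\int_0^x e^{\gamma\xi}h^-(\xi)\,d\xi\right), & x>0,\end{cases}$$ where the constants $k^{\pm}=k^{\pm}(\gamma;h)$ are given by $$\begin{pmatrix}k^+(\gamma;h)\\ k^-(\gamma;h)\end{pmatrix}=\frac1{Z(\gamma)}\begin{pmatrix}1&\psi^+(\gamma)\\ \psi^-(\gamma)&1\end{pmatrix}K(\gamma)h,$$ with $K(\gamma):L^2(\mu)\to\mathbb C^2$ the bounded linear mapping given by $$K(\gamma)h=\begin{pmatrix}\int_0^\infty e^{-\gamma\xi-U(\xi)}h^+(\xi)\,d\xi+\int_0^\infty U'(\xi)e^{-2\gamma\xi-U(\xi)}\int_0^\xi e^{\gamma\eta}h^-(\eta)\,d\eta\,d\xi\\ \int_{-\infty}^0 e^{\gamma\xi-U(\xi)}h^-(\xi)\,d\xi-\int_{-\infty}^0U'(\xi)e^{2\gamma\xi-U(\xi)}\int_\xi^0 e^{-\gamma\eta}h^+(\eta)\,d\eta\,d\xi\end{pmatrix}.$$ For every $\gamma\in\sigma_p(L)$, the corresponding eigenfunctions form a one-dimensional space spanned by the function $f_\gamma\in\mathcal D(L)$ defined by $$f_\gamma^+(x)=\psi^+(\gamma)e^{\gamma x}\ (x\le0),\qquad f_\gamma^+(x)=e^{\gamma x+U(x)}\int_x^\infty U'(\xi)e^{-2\gamma\xi-U(\xi)}\,d\xi\ (x\ge0),$$ $$f_\gamma^-(x)=e^{-\gamma x}\ (x\ge0),\qquad f_\gamma^-(x)=-\psi^+(\gamma)e^{-\gamma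 x+U(x)}\int_{-\infty}^xU'(\xi)e^{2\gamma\xi-U(\xi)}\,d\xi\ (x\le0).$$ If $\gamma_1,\gamma_2\in\sigma_p(L)$, $\gamma_1\ne\gamma_2$, with corresponding eigenfunctions $f_1,f_2$, then either $\gamma_1=\overline{\gamma_2}$ or $\langle Ff_1,f_2\rangle=0$.
   Context: $E=\mathbb R\times\{-1,+1\}$; for $f:E\to\mathbb C$ write $f^{\pm}(x)=f(x,\pm1)$. $U:\mathbb R\to\mathbb R$ is the potential, $\lambda_{\mathrm{refr}}:\mathbb R\to[0,\infty)$ a continuous function, and $\lambda(x,\theta)=\max(\theta U'(x),0)+\lambda_{\mathrm{refr}}(x)$ for $(x,\theta)\in E$. The measure $\nu$ on $\mathbb R$ is $\nu(dx)=e^{-U(x)}dx$ and $\mu$ on $E$ is $\mu(A\times\{\theta\})=\nu(A)$. $L^2(\mu)$ is the complex Hilbert space with $\langle f,g\rangle=\sum_{\theta=\pm1}\int_{\mathbb R}f(x,\theta)\overline{g(x,\theta)}e^{-U(x)}dx$. $W^{1,2}_{\mathrm{loc}}(E)$ is the set of $f$ with $f^{\pm}\in W^{1,2}_{\mathrm{loc}}(\mathbb R)$. The zigzag generator is $Lf(x,\theta)=\theta\,\partial_xf(x,\theta)+\lambda(x,\theta)(f(x,-\theta)-f(x,\theta))$ with domain $\mathcal D(L)=\{f\in L^2(\mu)\cap W^{1,2}_{\mathrm{loc}}(E): Lf\in L^2(\mu)\}$ (where $Lf$ is the displayed expression). The flipping operator is $Ff(x,\theta)=f(x,-\theta)$.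 $\rho(L)$ is the set of $\gamma\in\mathbb C$ such that $\gamma-L$ is invertible with bounded inverse on $L^2(\mu)$, $\sigma(L)=\mathbb C\setminus\rho(L)$, and $\sigma_p(L)=\{\gamma:\gamma-L\text{ is not injective}\}$. For $\gamma\in\mathbb C$, $$\psi^+(\gamma)=\int_0^\infty U'(\xi)e^{-2\gamma\xi-U(\xi)}d\xi,\quad \psi^-(\gamma)=-\int_{-\infty}^0U'(\xi)e^{2\gamma\xi-U(\xi)}d\xi,\quad Z(\gamma)=1-\psi^+(\gamma)\psi^-(\gamma).$$ *)

(* Defs.v *)
From mathcomp Require Import all_boot all_order all_algebra.
From mathcomp Require Export complex.
From mathcomp Require Import all_classical all_reals all_analysis.
Import Order.TTheory GRing.Theory Num.Theory.
Import numFieldNormedType.Exports.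

Set Implicit Arguments.
Unset Strict Implicit.
Unset Printing Implicit Defensive.

Local Open Scope ring_scope.
Local Open Scope complex_scope.
Local Open Scope classical_set_scope.

(* Num.Theory's Re and Im are R[i]-valued; here they are R-valued. *)
Local Notation Re := complex.Re.
Local Notation Im := complex.Im.
Notation normc := ComplexField.Normc.normc.

Section ComplexAnalysis.
Context {R : realType}.
Implicit Types (D : set R) (f g : R -> R[i]) (z : R[i]).

Definition cexp z : R[i] :=
  (expR (Re z) * cos (Im z)) +i* (expR (Re z) * sin (Im z)).

Definition cmeasurable f : Prop :=
  measurable_fun setT (fun x => Re (f x)) /\
  measurable_fun setT (fun x => Im (f x)).

(* Meaningful when the real and imaginary parts of f are integrable on D. *)
Definition cint D f : R[i] :=
  (\int[lebesgue_measure]_(x in D) Re (f x)) +i*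
  (\int[lebesgue_measure]_(x in D) Im (f x)).

Definition L1loc f : Prop :=
  cmeasurable f /\ locally_integrable setT (fun x => normc (f x)).

Definition L2loc f : Prop :=
  cmeasurable f /\ locally_integrable setT (fun x => normc (f x) ^+ 2).

Definition test_function (phi : R -> R) : Prop :=
  (forall (n : nat) (x : R), derivable (derive1n n phi) x 1) /\
  compact (closure [set x | phi x != 0]).

Definition weak_derivative f g : Prop :=
  [/\ L1loc f, L1loc g &
      forall phi, test_function phi ->
        cint setT (fun x => f x * (derive1 phi x)%:C) =
        - cint setT (fun x => g x * (phi x)%:C)].

(* W^{1,2}_loc(R) *)
Definition W12loc f : Prop :=
  L2loc f /\ exists2 g, L2loc g & weak_derivative f g.

(* A chosen representative of the (a.e. unique) weak derivative of f. *)
Definition wderiv f : R -> R[i] := xget (fun=> 0) (weak_derivative f).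

Definition C2 (u : R -> R) : Prop :=
  [/\ forall x, derivable u x 1,
      forall x, derivable (derive1 u) x 1 &
      continuous (derive1 (derive1 u))].

End ComplexAnalysis.

Notation "'\cint_' ( x 'in' D ) F" := (cint D (fun x => F))
  (at level 36, F at level 36, x at level 50,
   format "'[' '\cint_' ( x  'in'  D ) '/  '  F ']'") : ring_scope.

(* E = R x {-1,+1}; the velocity +1 is encoded by true and -1 by false, so
   that flipping the velocity is negb. *)
Notation phase R := (R * bool)%type.

Section ZigZag.
Context {R : realType}.
Variables (U lrefr : R -> R).
Implicit Types (f g h : phase R -> R[i]) (gamma : R[i]).

Definition velocity (th : bool) : R := if th then 1 else - 1.

(* f^+ and f^- *)
Definition fplus f : R -> R[i] := fun x => f (x, true).
Definition fminus f : R -> R[i] := fun x => f (x, false).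

(* Square-integrable functions on E with respect to mu.  Elements of the
   Hilbert space L^2(mu) are represented by functions, their equality by
   [aeeq]; since e^{-U} > 0, mu-null sets are the sets with Lebesgue-null
   fibres. *)
Definition inL2 f : Prop :=
  forall th : bool, cmeasurable (fun x => f (x, th)) /\
    lebesgue_measure.-integrable setT
      (fun x => (normc (f (x, th)) ^+ 2 * expR (- U x))%:E).

Definition aeeq f g : Prop :=
  forall th : bool,
    {ae lebesgue_measure, forall x : R, f (x, th) = g (x, th)}.

Definition dotmu f g : R[i] :=
  \sum_(th : bool)
    \cint_(x in setT) (f (x, th) * conjc (g (x, th)) * (expR (- U x))%:C).

Definition normmu f : R := Num.sqrt (Re (dotmu f f)).

Definition W12locE f : Prop := forall th : bool, W12loc (fun x => f (x, th)).

Definition flip f : phase R -> R[i] := fun p => f (p.1, ~~ p.2).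

Definition rate (p : phase R) : R :=
  Num.max (velocity p.2 * derive1 U p.1) 0 + lrefr p.1.

Definition zzL f : phase R -> R[i] := fun p =>
  (velocity p.2)%:C * wderiv (fun x => f (x, p.2)) p.1
  + (rate p)%:C * (f (p.1, ~~ p.2) - f p).

Definition domL f : Prop := [/\ inL2 f, W12locE f & inL2 (zzL f)].

Definition shiftL gamma f : phase R -> R[i] :=
  fun p => gamma * f p - zzL f p.

Definition injective_shift gamma : Prop :=
  forall f, domL f -> aeeq (shiftL gamma f) (fun=> 0) -> aeeq f (fun=> 0).

(* f = (gamma - L)^{-1} h *)
Definition is_resolvent gamma h f : Prop :=
  domL f /\ aeeq (shiftL gamma f) h.

Definition rhoL : set R[i] := [set gamma |
  [/\ injective_shift gamma,
      forall h, inL2 h -> exists f, is_resolvent gamma h f &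
      exists M : R, forall h f, inL2 h -> is_resolvent gamma h f ->
        normmu f <= M * normmu h]].

Definition sigmaL : set R[i] := ~` rhoL.

Definition sigmapL : set R[i] := [set gamma | ~ injective_shift gamma].

Definition is_eigenfunction gamma f : Prop :=
  [/\ domL f, ~ aeeq f (fun=> 0) & aeeq (zzL f) (fun p => gamma * f p)].

Local Notation dU x := ((derive1 U x)%:C).
Local Notation cU x := ((U x)%:C).

Definition psip gamma : R[i] :=
  \cint_(xi in `[0, +oo[) (dU xi * cexp (- (2 * gamma * xi%:C) - cU xi)).

Definition psim gamma : R[i] :=
  - \cint_(xi in `]-oo, 0]) (dU xi * cexp (2 * gamma * xi%:C - cU xi)).

Definition Zf gamma : R[i] := 1 - psip gamma * psim gamma.

Definition SigmaZ : set R[i] := [set gamma | Zf gamma = 0].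

Definition col2 (a b : R[i]) : 'cV[R[i]]_2 :=
  \col_(i < 2) (if i == 0 then a else b).

Definition mat2 (a b c d : R[i]) : 'M[R[i]]_2 :=
  \matrix_(i < 2, j < 2)
    if i == 0 then (if j == 0 then a else b) else (if j == 0 then c else d).

Definition Kmap gamma h : 'cV[R[i]]_2 :=
  col2
    (\cint_(xi in `[0, +oo[) (cexp (- (gamma * xi%:C) - cU xi) * fplus h xi)
     + \cint_(xi in `[0, +oo[)
         (dU xi * cexp (- (2 * gamma * xi%:C) - cU xi) *
          \cint_(eta in `[0, xi]) (cexp (gamma * eta%:C) * fminus h eta)))
    (\cint_(xi in `]-oo, 0]) (cexp (gamma * xi%:C - cU xi) * fminus h xi)
     - \cint_(xi in `]-oo, 0])
         (dU xi * cexp (2 * gamma * xi%:C - cU xi) *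
          \cint_(eta in `[xi, 0]) (cexp (- (gamma * eta%:C)) * fplus h eta))).

Definition kvec gamma h : 'cV[R[i]]_2 :=
  (Zf gamma)^-1 *:
    (mat2 1 (psip gamma) (psim gamma) 1 *m Kmap gamma h).

Definition kplus gamma h : R[i] := kvec gamma h 0 0.
Definition kminus gamma h : R[i] := kvec gamma h 1 0.

Definition resolvent_plus gamma h (x : R) : R[i] :=
  if x <= 0 then
    cexp (gamma * x%:C) *
    (kplus gamma h
     + \cint_(xi in `[x, 0]) (cexp (- (gamma * xi%:C)) * fplus h xi))
  else
    cexp (gamma * x%:C + cU x) *
    (kplus gamma h
     - \cint_(xi in `[0, x])
         (cexp (- (gamma * xi%:C) - cU xi) *
          (fplus h xi
           + dU xi * cexp (- (gamma * xi%:C)) *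
             (kminus gamma h
              + \cint_(eta in `[0, xi])
                  (cexp (gamma * eta%:C) * fminus h eta))))).

Definition resolvent_minus gamma h (x : R) : R[i] :=
  if x <= 0 then
    cexp (- (gamma * x%:C) + cU x) *
    (kminus gamma h
     - \cint_(xi in `[x, 0])
         (cexp (gamma * xi%:C - cU xi) *
          (fminus h xi
           - dU xi * cexp (gamma * xi%:C) *
             (kplus gamma h
              + \cint_(eta in `[xi, 0])
                  (cexp (- (gamma * eta%:C)) * fplus h eta)))))
  else
    cexp (- (gamma * x%:C)) *
    (kminus gamma h
     + \cint_(xi in `[0, x]) (cexp (gamma * xi%:C) * fminus h xi)).

Definition resolvent_formula gamma h : phase R -> R[i] := fun p =>
  if p.2 then resolvent_plus gamma h p.1 else resolvent_minus gamma h p.1.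

(* The two formulas for each component agree at x = 0 when Z(gamma) = 0. *)
Definition eigen_plus gamma (x : R) : R[i] :=
  if x <= 0 then psip gamma * cexp (gamma * x%:C)
  else cexp (gamma * x%:C + cU x) *
    \cint_(xi in `[x, +oo[) (dU xi * cexp (- (2 * gamma * xi%:C) - cU xi)).

Definition eigen_minus gamma (x : R) : R[i] :=
  if 0 <= x then cexp (- (gamma * x%:C))
  else - psip gamma * cexp (- (gamma * x%:C) + cU x) *
    \cint_(xi in `]-oo, x]) (dU xi * cexp (2 * gamma * xi%:C - cU xi)).

Definition eigenfun gamma : phase R -> R[i] := fun p =>
  if p.2 then eigen_plus gamma p.1 else eigen_minus gamma p.1.

End ZigZag.

(* Main.v *)
(* The reflection (x, theta) -> (-x, -theta) exchanges the two half-lines, and on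
   x >= 0 the equation (gamma - L) f = h reads, with u = U and v = U' >= 0,
     p' = - gamma p + h2,   q' = (gamma + v) q - v p - h1,   p = f^-, q = f^+.
   The first equation is solved in L^2(e^{-u}) for every initial value p(0).  The
   difference d = q - p satisfies d' = (gamma + v) d + 2 gamma p - h1 - h2, whose
   source does not contain v; so d is in L^2(e^{-u}) exactly when it is given by
   the integral of the weighted source over [x, +oo[, by Schur's test for a kernel
   dominated by e^{-|x-y|} (U' tends to +oo).  In terms of q this is
   q(0) = K h + psi p(0).  The two half-lines give a 2x2 system for
   (f^+(0), f^-(0)) with determinant Z(gamma), which governs both the resolvent and
   the eigenvalues.  Weak solutions are identified with absolutely continuous ones
   by testing against differences of mollified Heaviside functions at Lebesgue
   points.  Orthogonality comes from the Wronskian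
   (f1^- conj f2^+ - f1^+ conj f2^-) e^{-U}, which vanishes at both infinities. *)
Require Import Defs.
From mathcomp Require Import all_boot all_order all_algebra.
From mathcomp Require Import all_classical all_reals all_analysis.
From mathcomp Require Import measurable_realfun ring lra.
Import Order.TTheory GRing.Theory Num.Theory.
Import numFieldNormedType.Exports.
Set Implicit Arguments.
Unset Strict Implicit.
Unset Printing Implicit Defensive.
Local Open Scope ring_scope.
Local Open Scope complex_scope.
Local Open Scope classical_set_scope.

Local Notation Re := complex.Re.
Local Notation Im := complex.Im.

(** * Complex-valued integrals and primitives *)

Section ComplexIntegral.
Context {R : realType}.
Local Notation mu := (@lebesgue_measure R).
Local Notation lmeasurable := (@measurable _ (measurableTypeR R)).
Implicit Types (D : set R) (f g : R -> R[i]) (c z w : R[i]).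

(** Since [gamma] ranges over the whole plane, no decay can be taken from its real part c; all of it
    comes from u. Conjugation by e^{-u/2} turns the solution kernels for p and for d into one
    function, e^{-c(x-y) - (u(x)-u(y))/2} with y <= x, read in the two directions. As U' tends to
    +oo, u outgrows every linear function, and this is dominated by e^{-|x-y|} for every c. The same
    growth makes every e^{cx} square integrable for e^{-u}, so that pairing with e^{-gamma x - u} is
    bounded and detects a solution that is not square integrable. The obstacle is U' itself, for
    which no pointwise bound is at hand: v p is not estimated in L^2(e^{-u}), whence the passage to
    d. Where v must stay, in psi and in K, it is removed by parts through v e^{-u} = -(e^{-u})'. An
    absolutely continuous function is a pair (F, f) with F(y) - F(x) equal to the integral of f over
    [x, y]; the product rule for such pairs is Fubini's theorem on a triangle. Estimates are made on
    squared norms, with real and imaginary parts bounded separately, which explains the powers of 2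
    in the constants. *)

Lemma cReD z w : Re (z + w) = Re z + Re w. Proof. by case: z; case: w. Qed.
Lemma cImD z w : Im (z + w) = Im z + Im w. Proof. by case: z; case: w. Qed.
Lemma cReM z w : Re (z * w) = Re z * Re w - Im z * Im w.
Proof. by case: z; case: w. Qed.
Lemma cImM z w : Im (z * w) = Re z * Im w + Im z * Re w.
Proof. by case: z; case: w. Qed.
Lemma cReN z : Re (- z) = - Re z. Proof. by case: z. Qed.
Lemma cImN z : Im (- z) = - Im z. Proof. by case: z. Qed.

Lemma complexP z w : Re z = Re w -> Im z = Im w -> z = w.
Proof. by case: z => a b; case: w => a' b' /= -> ->. Qed.

Lemma normcE z : normc z = Num.sqrt (Re z ^+ 2 + Im z ^+ 2).
Proof. by case: z. Qed.

Lemma normc_sq z : normc z ^+ 2 = Re z ^+ 2 + Im z ^+ 2.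
Proof. by rewrite normcE sqr_sqrtr// addr_ge0// sqr_ge0. Qed.

Lemma normc_ge0 z : 0 <= normc z.
Proof. by rewrite normcE sqrtr_ge0. Qed.

Lemma normRe z : `|Re z| <= normc z.
Proof.
rewrite normcE -sqrtr_sqr ler_wsqrtr// lerDl sqr_ge0//.
Qed.

Lemma normIm z : `|Im z| <= normc z.
Proof.
rewrite normcE -sqrtr_sqr ler_wsqrtr// lerDr sqr_ge0//.
Qed.

Lemma normc_leD z w : normc (z + w) <= normc z + normc w.
Proof. exact: le_normcD. Qed.

Lemma normcM z w : normc (z * w) = normc z * normc w.
Proof. exact: ComplexField.Normc.normcM. Qed.

Lemma normcN z : normc (- z) = normc z.
Proof. by rewrite !normcE cReN cImN !sqrrN. Qed.

Lemma normc_le_abs z : normc z <= `|Re z| + `|Im z|.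
Proof.
rewrite -(@ler_pXn2r _ 2)// ?nnegrE ?addr_ge0// ?normc_ge0//.
by rewrite normc_sq sqrrD !real_normK ?num_real// addrAC lerDl mulrn_wge0// mulr_ge0.
Qed.

Lemma normcR (x : R) : normc (x%:C) = `|x|.
Proof. by rewrite normcE /= expr0n addr0 sqrtr_sqr. Qed.

Lemma normc0 : normc (0 : R[i]) = 0 :> R.
Proof. by rewrite normcE /= expr0n addr0 sqrtr0. Qed.

Lemma normc_eq0 z : (normc z == 0) = (z == 0).
Proof.
apply/idP/idP => [/eqP/ComplexField.Normc.eq0_normc ->//|/eqP ->].
by rewrite normc0.
Qed.

Lemma normc_cexp z : normc (cexp z) = expR (Re z).
Proof.
rewrite normcE /= !exprMn -mulrDr cos2Dsin2 mulr1 sqrtr_sqr ger0_norm//.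
Qed.

Lemma cexpD z w : cexp (z + w) = cexp z * cexp w.
Proof.
apply: complexP.
  by rewrite cReM /= cReD cImD expRD cosD; ring.
by rewrite cImM /= cReD cImD expRD sinD; ring.
Qed.

Lemma cexp0 : cexp 0 = 1 :> R[i].
Proof. by rewrite /cexp /= expR0 cos0 sin0 mulr1 mulr0. Qed.

Lemma cexpN z : cexp (- z) * cexp z = 1.
Proof. by rewrite -cexpD addNr cexp0. Qed.

Lemma cexpR (x : R) : cexp (x%:C) = (expR x)%:C.
Proof. by rewrite /cexp /= cos0 sin0 mulr1 mulr0. Qed.

Lemma Re_cint D f : Re (cint D f) = \int[mu]_(x in D) Re (f x).
Proof. by []. Qed.

Lemma Im_cint D f : Im (cint D f) = \int[mu]_(x in D) Im (f x).
Proof. by []. Qed.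

Lemma eq_cint D f g : {in D, f =1 g} -> cint D f = cint D g.
Proof.
move=> fg; apply: complexP; apply: eq_Rintegral => x xD; by rewrite fg.
Qed.

Definition cintegrable D f : Prop :=
  mu.-integrable D (EFin \o (fun x => Re (f x))) /\
  mu.-integrable D (EFin \o (fun x => Im (f x))).

Definition cmeas D f : Prop :=
  measurable_fun D (fun x => Re (f x)) /\ measurable_fun D (fun x => Im (f x)).

Lemma eq_cintegrable D f g : lmeasurable D -> {in D, f =1 g} -> cintegrable D f -> cintegrable D g.
Proof.
move=> mD fg [h1 h2]; split.
  by apply: (eq_integrable mD _ _ _ h1) => x xD /=; rewrite fg.
by apply: (eq_integrable mD _ _ _ h2) => x xD /=; rewrite fg.
Qed.

Lemma cintegrableD D f g : lmeasurable D ->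
  cintegrable D f -> cintegrable D g -> cintegrable D (fun x => f x + g x).
Proof.
move=> mD [f1 f2] [g1 g2]; split.
  apply: (eq_integrable mD _ _ _ (integrableD mD f1 g1)) => x _ /=.
  by rewrite cReD EFinD.
apply: (eq_integrable mD _ _ _ (integrableD mD f2 g2)) => x _ /=.
by rewrite cImD EFinD.
Qed.

Lemma cintegrableZ D c f : lmeasurable D ->
  cintegrable D f -> cintegrable D (fun x => c * f x).
Proof.
move=> mD [f1 f2]; split.
  apply: (eq_integrable mD _ _ _ (integrableB mD (integrableZl mD (Re c) f1)
    (integrableZl mD (Im c) f2))) => x _ /=.
  by rewrite cReM EFinB !EFinM.
apply: (eq_integrable mD _ _ _ (integrableD mD (integrableZl mD (Re c) f2)
    (integrableZl mD (Im c) f1))) => x _ /=.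
by rewrite cImM EFinD !EFinM.
Qed.

Lemma cintegrableN D f : lmeasurable D ->
  cintegrable D f -> cintegrable D (fun x => - f x).
Proof.
move=> mD /(cintegrableZ (-1) mD); apply: (eq_cintegrable mD) => x _.
by rewrite mulN1r.
Qed.

Lemma cintegrableB D f g : lmeasurable D ->
  cintegrable D f -> cintegrable D g -> cintegrable D (fun x => f x - g x).
Proof. by move=> mD fi gi; apply: cintegrableD => //; exact: cintegrableN. Qed.

Lemma cintegrable0 D : cintegrable D (fun=> 0).
Proof. by split; apply: integrable0. Qed.

Lemma cint0 D : cint D (fun=> 0) = 0.
Proof. by rewrite /cint /= /Rintegral integral0. Qed.

Lemma cintD D f g : lmeasurable D -> cintegrable D f -> cintegrable D g ->
  cint D (fun x => f x + g x) = cint D f + cint D g.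
Proof.
move=> mD [f1 f2] [g1 g2]; apply: complexP.
  rewrite cReD !Re_cint -RintegralD//.
  by apply: eq_Rintegral => x _; rewrite cReD.
rewrite cImD !Im_cint -RintegralD//.
by apply: eq_Rintegral => x _; rewrite cImD.
Qed.

Lemma integrable_EFinZ D (r : R) (u : R -> R) : lmeasurable D ->
  mu.-integrable D (EFin \o u) -> mu.-integrable D (EFin \o (fun x => r * u x)).
Proof. by move=> mD /(integrableZl mD r). Qed.

Lemma cintZ D c f : lmeasurable D -> cintegrable D f ->
  cint D (fun x => c * f x) = c * cint D f.
Proof.
move=> mD [f1 f2]; apply: complexP.
  rewrite cReM !Re_cint !Im_cint -!RintegralZl// -RintegralB//;
    try exact: integrable_EFinZ.
  by apply: eq_Rintegral => x _; rewrite cReM.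
rewrite cImM !Re_cint !Im_cint -!RintegralZl// -RintegralD//;
  try exact: integrable_EFinZ.
by apply: eq_Rintegral => x _; rewrite cImM.
Qed.

Lemma cintN D f : lmeasurable D -> cintegrable D f ->
  cint D (fun x => - f x) = - cint D f.
Proof.
move=> mD fi; rewrite -mulN1r -cintZ//.
by apply: eq_cint => x _; rewrite mulN1r.
Qed.

Lemma cintB D f g : lmeasurable D -> cintegrable D f -> cintegrable D g ->
  cint D (fun x => f x - g x) = cint D f - cint D g.
Proof.
by move=> mD fi gi; rewrite cintD// ?cintN//; exact: cintegrableN.
Qed.

Lemma cintegrableS D E f : lmeasurable D -> lmeasurable E -> E `<=` D ->
  cintegrable D f -> cintegrable E f.
Proof.
by move=> mD mE ED [f1 f2]; split;
  [apply: integrableS f1|apply: integrableS f2].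
Qed.

Lemma cintegrable_meas D f : cintegrable D f -> cmeas D f.
Proof.
by case=> /measurable_int/measurable_EFinP h1 /measurable_int/measurable_EFinP h2.
Qed.

Lemma cmeas_normc D f : cmeas D f -> measurable_fun D (fun x => normc (f x)).
Proof.
move=> [h1 h2].
have -> : (fun x => normc (f x)) =
  (@Num.sqrt R \o (fun x => Re (f x) ^+ 2 + Im (f x) ^+ 2)).
  by apply/funext => x; rewrite normcE.
apply: measurableT_comp; first exact: continuous_measurable_fun (@sqrt_continuous R).
by apply: measurable_funD; apply: measurable_funX.
Qed.

Lemma le_cintegrable D f (g : R -> R) : lmeasurable D -> cmeas D f ->
  (forall x, D x -> normc (f x) <= g x) ->
  mu.-integrable D (EFin \o g) -> cintegrable D f.
Proof.
move=> mD [f1 f2] fg gi; split; (apply: (le_integrable mD _ _ gi);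
  first exact/measurable_EFinP) => x Dx /=; rewrite lee_fin;
  apply: (le_trans _ (ler_norm _)); apply: le_trans (fg _ Dx);
  [exact: normRe|exact: normIm].
Qed.

Lemma cintegrable_normc D f : lmeasurable D -> cintegrable D f ->
  mu.-integrable D (EFin \o (fun x => normc (f x))).
Proof.
move=> mD fi; have [f1 f2] := fi.
apply: (le_integrable mD _ _ (integrableD mD (integrable_norm f1) (integrable_norm f2))).
  by apply/measurable_EFinP; exact: cmeas_normc (cintegrable_meas fi).
move=> x Dx /=; rewrite lee_fin (ger0_norm (normc_ge0 _)).
exact: le_trans (normc_le_abs _) (ler_norm _).
Qed.

(* The constant 2 comes from bounding real and imaginary parts separately. *)
Lemma normc_cint_le D f : lmeasurable D -> cintegrable D f ->
  normc (cint D f) <= 2 * \int[mu]_(x in D) normc (f x).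
Proof.
move=> mD fi; have [f1 f2] := fi; have ni := cintegrable_normc mD fi.
apply: (le_trans (normc_le_abs _)); rewrite mulr_natl mulr2n lerD//.
  apply: (le_trans (le_normr_Rintegral mD f1)).
  by apply: le_Rintegral => //; [exact: integrable_norm|move=> x _; exact: normRe].
apply: (le_trans (le_normr_Rintegral mD f2)).
by apply: le_Rintegral => //; [exact: integrable_norm|move=> x _; exact: normIm].
Qed.

Lemma setU_itvcc (x y z : R) : x <= y -> y <= z ->
  `[x, z]%classic = `[x, y] `|` `]y, z].
Proof.
move=> xy yz; rewrite -itv_bndbnd_setU ?bnd_simp//.
Qed.

Lemma Rint_split (u : R -> R) (x y z : R) : x <= y -> y <= z ->
  mu.-integrable `[x, z] (EFin \o u) ->
  \int[mu]_(t in `[x, z]) u t =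
  \int[mu]_(t in `[x, y]) u t + \int[mu]_(t in `[y, z]) u t.
Proof.
move=> xy yz ui.
have mu' : mu.-integrable `]y, z] (EFin \o u).
  apply: integrableS ui => //.
  by apply: subset_itvr; rewrite bnd_simp.
apply/eqP; rewrite -subr_eq0 opprD addrA.
rewrite (@Rintegral_itvB _ _ (BLeft x) (BRight z) y)//.
by rewrite Rintegral_itv_obnd_cbnd// subrr.
Qed.

Lemma cint_split f (x y z : R) : x <= y -> y <= z -> cintegrable `[x, z] f ->
  cint `[x, z] f = cint `[x, y] f + cint `[y, z] f.
Proof.
move=> xy yz [f1 f2]; apply: complexP.
  by rewrite cReD !Re_cint -Rint_split.
by rewrite cImD !Im_cint -Rint_split.
Qed.

Lemma cintegrable_itvS f (x y z t : R) : x <= z -> t <= y ->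
  cintegrable `[x, y] f -> cintegrable `[z, t] f.
Proof.
move=> xz ty; apply: cintegrableS => //.
by apply: subset_itv; rewrite bnd_simp.
Qed.

Lemma cint_set1 f (x : R) : cint `[x, x] f = 0.
Proof. by rewrite set_itv1 /cint !Rintegral_set1. Qed.

End ComplexIntegral.

(** * Integration by parts for integrable densities *)

Section ProductRule.
Context {R : realType}.
Local Notation mu := (@lebesgue_measure R).
Local Notation lmeasurable := (@measurable _ (measurableTypeR R)).
Implicit Types (f g : R -> R) (a b x : R).

Lemma Rint_param_measurable f a b : a <= b ->
  mu.-integrable `[a, b] (EFin \o f) ->
  measurable_fun `[a, b] (fun x => \int[mu]_(t in `[a, x]) f t).
Proof.
move=> ab fi; apply: subspace_continuous_measurable_fun => //.
exact: parameterized_integral_continuous.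
Qed.

Lemma Rint_param_bound f a b x y : a <= x -> y <= b ->
  mu.-integrable `[a, b] (EFin \o f) ->
  `|\int[mu]_(t in `[x, y]) f t| <= \int[mu]_(t in `[a, b]) `|f t|.
Proof.
move=> ax yb fi.
have sub : `[x, y] `<=` `[a, b] by apply: subset_itv; rewrite bnd_simp.
have fi' : mu.-integrable `[x, y] (EFin \o f) by exact: integrableS fi.
apply: (le_trans (le_normr_Rintegral _ fi')) => //.
rewrite /Rintegral fine_le//.
- exact: integrable_fin_num (integrable_norm fi').
- exact: integrable_fin_num (integrable_norm fi).
- apply: ge0_subset_integral => //.
  exact: measurable_int (integrable_norm fi).
Qed.

Lemma integrableM_bounded (D : set R) f g (M : R) : lmeasurable D ->
  measurable_fun D f -> (forall x, D x -> `|f x| <= M) ->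
  mu.-integrable D (EFin \o g) -> mu.-integrable D (EFin \o (fun x => f x * g x)).
Proof.
move=> mD mf fM gi.
apply: (le_integrable mD _ _ (integrableZl mD M (integrable_norm gi))).
  apply/measurable_EFinP; apply: measurable_funM => //.
  by have /measurable_EFinP := measurable_int mu gi.
move=> x Dx /=; rewrite lee_fin normrM.
apply: le_trans (ler_norm _); rewrite ler_wpM2r//.
exact: fM.
Qed.

(** Fubini's theorem for f(s) g(t) on the triangle a <= t <= s <= b. This is the analytic content of
    the product rule [rprimM]. *)
Lemma Rint_parts_sum f g a b : a <= b ->
  mu.-integrable `[a, b] (EFin \o f) -> mu.-integrable `[a, b] (EFin \o g) ->
  \int[mu]_(s in `[a, b]) (f s * \int[mu]_(t in `[a, s]) g t) =
  \int[mu]_(t in `[a, b]) ((\int[mu]_(s in `[t, b]) f s) * g t).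
Proof.
move=> ab fi gi.
pose F := f \_ `[a, b]; pose G := g \_ `[a, b].
pose phi (z : measurableTypeR R * measurableTypeR R) := (if z.2 <= z.1 then F z.1 * G z.2 else 0)%:E.
have [/measurable_EFinP mf _] := (integrableP _ _ _ fi).
have [/measurable_EFinP mg _] := (integrableP _ _ _ gi).
have mF : measurable_fun setT F by apply/(measurable_restrictT _ _).1.
have mG : measurable_fun setT G by apply/(measurable_restrictT _ _).1.
have mFi : mu.-integrable setT (EFin \o F).
  by rewrite /F -restrict_EFin; apply/integrable_restrict => //=; rewrite setTI.
have mGi : mu.-integrable setT (EFin \o G).
  by rewrite /G -restrict_EFin; apply/integrable_restrict => //=; rewrite setTI.
have mphi : measurable_fun setT phi.
  apply/measurable_EFinP; apply: measurable_fun_ifT => //.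
    by apply: measurable_fun_ler.
  apply: measurable_funM.
    by apply: (measurableT_comp mF).
  by apply: (measurableT_comp mG).
(* Dominated by |F(x)| |G(y)|, whose double integral is the product of the two L^1 norms. *)
have phii : (mu \x mu)%E.-integrable setT phi.
  apply/integrable12ltyP => //.
  apply: (@le_lt_trans _ _ (\int[mu]_x \int[mu]_y (`|F x|%:E * `|G y|%:E))%E).
    apply: ge0_le_integral => //.
    - by move=> x _; apply: integral_ge0.
    - have mabs : measurable_fun setT (abse \o phi) by apply: measurableT_comp.
      have abs0 z : (0 <= (abse \o phi) z)%E by exact: abse_ge0.
      exact: (@measurable_fun_fubini_tonelli_F _ _ _ _ _ mu (abse \o phi) mabs abs0).
    - apply: (measurable_fun_fubini_tonelli_F (fun z : measurableTypeR R * measurableTypeR R => `|F z.1|%:E * `|G z.2|%:E)%E) => //.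
        apply: emeasurable_funM; apply/measurable_EFinP; apply: measurableT_comp => //.
          exact: (measurableT_comp mF).
        exact: (measurableT_comp mG).
    move=> x _; apply: ge0_le_integral => //.
    - apply: measurableT_comp => //; apply/measurable_EFinP => /=.
      apply: measurable_fun_ifT => //; first exact: measurable_fun_ler.
      exact: measurable_funM.
    - by apply: emeasurable_funM => //; apply/measurable_EFinP; apply: measurableT_comp.
    move=> y _; rewrite /phi /= -EFinM lee_fin; case: ifPn => _; first by rewrite normrM.
    by rewrite normr0 mulr_ge0.
  have /integrableP[_ Flt] := integrable_norm mFi.
  have /integrableP[_ Glt] := integrable_norm mGi.
  under eq_integral => x _.
    rewrite ge0_integralZl//; last by apply/measurable_EFinP/measurableT_comp.
    over.
  rewrite ge0_integralZr//; last 2 first.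
    by apply/measurable_EFinP/measurableT_comp.
    by apply: integral_ge0.
  apply: lte_mul_pinfty; first by apply: integral_ge0.
    rewrite fin_num_abs gee0_abs; last by apply: integral_ge0.
    apply: le_lt_trans Flt.
    by apply: ge0_le_integral => //; try (by apply/measurable_EFinP/measurableT_comp);
      [apply: measurableT_comp => //; apply/measurable_EFinP/measurableT_comp|move=> x _ /=; rewrite normr_id].
  apply: le_lt_trans Glt.
  by apply: ge0_le_integral => //; try (by apply/measurable_EFinP/measurableT_comp);
      [apply: measurableT_comp => //; apply/measurable_EFinP/measurableT_comp|move=> x _ /=; rewrite normr_id].
have /(congr1 fine) := Fubini phii.
rewrite /Rintegral [in X in X = _ -> _](_ : (\int[mu]_x \int[mu]_y phi (x, y))%E =
  (\int[mu]_(s in `[a, b]) (f s * fine (\int[mu]_(t in `[a, s]) (g t)%:E))%:E)%E).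
  move=> ->; congr fine; rewrite [RHS]integral_mkcond.
  apply: eq_integral => t _; rewrite patchE; case: ifPn => [|tab].
    rewrite inE /= in_itv /= => /andP[ta tb].
    have fi' : mu.-integrable `[t, b] (EFin \o f).
      by apply: integrableS fi => //; apply: subset_itv; rewrite bnd_simp.
    rewrite mulrC EFinM fineK; last exact: (integrable_fin_num _ fi').
    rewrite -integralZl// integral_mkcond; apply: eq_integral => s _.
    rewrite /phi /F /G /= !patchE !mem_setE !in_itv /= ta tb /=.
    case: ifPn => // ts /=.
    rewrite (le_trans ta ts) /=; case: ifPn => //; last by rewrite mul0r.
    by rewrite -EFinM mulrC.
  rewrite integral0_eq// => s _; rewrite /phi /G /= patchE (negbTE tab) mulr0.
  by case: ifP.
rewrite [RHS]integral_mkcond.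
apply: eq_integral => s _; rewrite patchE; case: ifPn => [|sab].
  rewrite inE /= in_itv /= => /andP[sa sb].
  have gi' : mu.-integrable `[a, s] (EFin \o g).
    by apply: integrableS gi => //; apply: subset_itv; rewrite bnd_simp.
  rewrite EFinM fineK; last exact: (integrable_fin_num _ gi').
  rewrite -integralZl// [RHS]integral_mkcond; apply: eq_integral => t _.
  rewrite /phi /F /G /= !patchE !mem_setE !in_itv /= sa sb /=.
  case: ifPn => ts; last by rewrite andbF.
  by rewrite (le_trans ts sb) andbT; case: ifPn => //; rewrite mulr0.
rewrite integral0_eq// => t _; rewrite /phi /F /= patchE (negbTE sab) mul0r.
by case: ifP.
Qed.

End ProductRule.

(** * Absolutely continuous functions and their densities *)

Section Primitives.
Context {R : realType}.
Local Notation mu := (@lebesgue_measure R).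
Local Notation lmeasurable := (@measurable _ (measurableTypeR R)).
Implicit Types (D : set R) (u v : R -> R) (F G f g : R -> R[i]).

(** Local absolute continuity of u on D with density v, encoded by the integral identity on
    segments. No derivative of u is mentioned, and v matters only up to a null set. *)
Definition rprim D u v : Prop := forall x y, D x -> D y -> x <= y ->
  mu.-integrable `[x, y] (EFin \o v) /\ u y - u x = \int[mu]_(t in `[x, y]) v t.

Definition prim D F f : Prop := forall x y, D x -> D y -> x <= y ->
  cintegrable `[x, y] f /\ F y - F x = cint `[x, y] f.

Lemma primP D F f : prim D F f <->
  rprim D (fun x => Re (F x)) (fun x => Re (f x)) /\
  rprim D (fun x => Im (F x)) (fun x => Im (f x)).
Proof.
split=> [H|[H1 H2]].
  split=> x y Dx Dy xy; have [[i1 i2] e] := H _ _ Dx Dy xy; split => //.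
    by rewrite -Re_cint -e cReD cReN.
  by rewrite -Im_cint -e cImD cImN.
move=> x y Dx Dy xy.
have [i1 e1] := H1 _ _ Dx Dy xy; have [i2 e2] := H2 _ _ Dx Dy xy.
by split=> //; apply: complexP; rewrite ?cReD ?cImD ?cReN ?cImN.
Qed.

Lemma eq_rprim D u v u' v' : is_interval D -> (forall x, D x -> u x = u' x) ->
  (forall x, D x -> v x = v' x) -> rprim D u v -> rprim D u' v'.
Proof.
move=> iD uu' vv' H x y Dx Dy xy; have [vi e] := H _ _ Dx Dy xy.
have E : {in `[x, y]%classic, v =1 v'}.
  move=> z; rewrite inE/= in_itv/= => zxy; apply: vv'; exact: iD zxy.
split; first by apply: (eq_integrable _ _ _ _ vi) => // z zxy /=; rewrite E.
by rewrite -!uu'// e; apply: eq_Rintegral.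
Qed.

Lemma eq_prim D F f F' f' : is_interval D -> (forall x, D x -> F x = F' x) ->
  (forall x, D x -> f x = f' x) -> prim D F f -> prim D F' f'.
Proof.
move=> iD FF ff /primP[H1 H2]; apply/primP; split.
  by apply: eq_rprim H1 => // x Dx; rewrite ?FF ?ff.
by apply: eq_rprim H2 => // x Dx; rewrite ?FF ?ff.
Qed.

Lemma rprimD D u v u' v' : rprim D u v -> rprim D u' v' ->
  rprim D (fun x => u x + u' x) (fun x => v x + v' x).
Proof.
move=> H H' x y Dx Dy xy; have [vi e] := H _ _ Dx Dy xy.
have [vi' e'] := H' _ _ Dx Dy xy; split.
  exact: (integrableD _ vi vi').
by rewrite RintegralD// -e -e'; ring.
Qed.

Lemma rprimB D u v u' v' : rprim D u v -> rprim D u' v' ->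
  rprim D (fun x => u x - u' x) (fun x => v x - v' x).
Proof.
move=> H H' x y Dx Dy xy; have [vi e] := H _ _ Dx Dy xy.
have [vi' e'] := H' _ _ Dx Dy xy; split.
  exact: (integrableB _ vi vi').
by rewrite RintegralB// -e -e'; ring.
Qed.

Lemma rprim_bounded D u v x y : is_interval D -> rprim D u v -> D x -> D y ->
  exists M, forall z, x <= z <= y -> `|u z| <= M.
Proof.
move=> iD H Dx Dy.
exists (`|u x| + \int[mu]_(t in `[x, y]) `|v t|) => z /andP[xz zy].
have [vi _] := H _ _ Dx Dy (le_trans xz zy).
have Dz : D z by apply: (iD _ _ Dx Dy); rewrite xz zy.
have [_ e] := H _ _ Dx Dz xz.
have -> : u z = u x + (u z - u x) by ring.
apply: (le_trans (ler_normD _ _)); rewrite lerD2l e.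
exact: Rint_param_bound.
Qed.

Lemma rprim_measurable D u v x y : is_interval D -> rprim D u v -> D x -> D y ->
  measurable_fun `[x, y] u.
Proof.
move=> iD H Dx Dy; have [xy|yx] := leP x y; last first.
  by rewrite set_itv_ge ?bnd_simp -?ltNge//; exact: measurable_fun_set0.
have [vi _] := H _ _ Dx Dy xy.
apply: (@eq_measurable_fun _ _ _ _ _ (fun z => u x + \int[mu]_(t in `[x, z]) v t)).
  move=> z; rewrite inE/= in_itv/= => /andP[xz zy].
  have Dz : D z by apply: (iD _ _ Dx Dy); rewrite xz zy.
  by have [_ <-] := H _ _ Dx Dz xz; ring.
by apply: measurable_funD => //; exact: Rint_param_measurable.
Qed.

(** Replacing u(t) and u'(t) by their value at x plus an integral over [x, t] reduces the product
    rule to two iterated integrals over complementary triangles, related by [Rint_parts_sum]. *)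
Lemma rprimM D u v u' v' : is_interval D -> rprim D u v -> rprim D u' v' ->
  rprim D (fun x => u x * u' x) (fun x => v x * u' x + u x * v' x).
Proof.
move=> iD H H' x y Dx Dy xy; have [vi e] := H _ _ Dx Dy xy.
have [vi' e'] := H' _ _ Dx Dy xy.
have [M uM] := rprim_bounded iD H Dx Dy.
have [M' uM'] := rprim_bounded iD H' Dx Dy.
have mu1 := rprim_measurable iD H Dx Dy.
have mu1' := rprim_measurable iD H' Dx Dy.
have i1 : mu.-integrable `[x, y] (EFin \o (fun z => u z * v' z)).
  by apply: (integrableM_bounded (M := M)) => // z; rewrite /= in_itv; exact: uM.
have i2' : mu.-integrable `[x, y] (EFin \o (fun z => u' z * v z)).
  by apply: (integrableM_bounded (M := M')) => // z; rewrite /= in_itv; exact: uM'.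
have i2 : mu.-integrable `[x, y] (EFin \o (fun z => v z * u' z)).
  by apply: (eq_integrable _ _ _ _ i2') => // z _ /=; rewrite mulrC.
split; first exact: (integrableD _ i2 i1).
set A := \int[mu]_(t in `[x, y]) v t in e.
set B := \int[mu]_(t in `[x, y]) v' t in e'.
have P1 : mu.-integrable `[x, y] (EFin \o (fun s => v s * \int[mu]_(t in `[x, s]) v' t)).
  have [mi _] := (Rint_param_measurable xy vi', Rint_param_measurable xy vi).
  apply: (eq_integrable _ _ _ _ (integrableM_bounded
     (M := \int[mu]_(t in `[x, y]) `|v' t|) _ mi _ vi)) => //.
    by move=> z _ /=; rewrite mulrC.
  by move=> z; rewrite /= in_itv/= => /andP[_ zy]; exact: Rint_param_bound.
have P2 : mu.-integrable `[x, y] (EFin \o (fun t => (\int[mu]_(s in `[x, t]) v s) * v' t)).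
  have mi := Rint_param_measurable xy vi.
  apply: (integrableM_bounded (M := \int[mu]_(t in `[x, y]) `|v t|)) => //.
  by move=> z; rewrite /= in_itv/= => /andP[_ zy]; exact: Rint_param_bound.
have K := Rint_parts_sum xy vi vi'.
(* The integral of v over [t, y] is A minus that over [x, t]; the latter cancels against the double
   integral of [E2] and leaves A B. *)
have K2 : \int[mu]_(t in `[x, y]) ((\int[mu]_(s in `[t, y]) v s) * v' t) =
    A * B - \int[mu]_(t in `[x, y]) ((\int[mu]_(s in `[x, t]) v s) * v' t).
  rewrite /B -RintegralZl// -RintegralB//; last exact: integrable_EFinZ.
  apply: eq_Rintegral => t; rewrite inE/= in_itv/= => /andP[xt ty].
  by rewrite /A (Rint_split xt ty vi); ring.
have E1 : \int[mu]_(t in `[x, y]) (v t * u' t) =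
    A * u' x + \int[mu]_(s in `[x, y]) (v s * \int[mu]_(t in `[x, s]) v' t).
  rewrite /A -RintegralZr// -RintegralD//; last first.
    apply: (eq_integrable _ _ _ _ (integrable_EFinZ (u' x) _ vi)) => //.
    by move=> z _ /=; rewrite mulrC.
  apply: eq_Rintegral => t; rewrite inE/= in_itv/= => /andP[xt ty].
  have Dt : D t by apply: (iD _ _ Dx Dy); rewrite xt ty.
  by have [_ <-] := H' _ _ Dx Dt xt; ring.
have E2 : \int[mu]_(t in `[x, y]) (u t * v' t) =
    u x * B + \int[mu]_(t in `[x, y]) ((\int[mu]_(s in `[x, t]) v s) * v' t).
  rewrite /B -RintegralZl// -RintegralD//; last exact: integrable_EFinZ.
  apply: eq_Rintegral => t; rewrite inE/= in_itv/= => /andP[xt ty].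
  have Dt : D t by apply: (iD _ _ Dx Dy); rewrite xt ty.
  by have [_ <-] := H _ _ Dx Dt xt; ring.
rewrite RintegralD// E1 E2 K K2 -e -e'; ring.
Qed.

Lemma primM D F f G g : is_interval D -> prim D F f -> prim D G g ->
  prim D (fun x => F x * G x) (fun x => f x * G x + F x * g x).
Proof.
move=> iD /primP[F1 F2] /primP[G1 G2]; apply/primP; split.
  apply: (eq_rprim iD _ _ (rprimB (rprimM iD F1 G1) (rprimM iD F2 G2))) => x _.
    by rewrite cReM.
  by rewrite cReD !cReM; ring.
apply: (eq_rprim iD _ _ (rprimD (rprimM iD F1 G2) (rprimM iD F2 G1))) => x _.
  by rewrite cImM.
by rewrite cImD !cImM; ring.
Qed.

Lemma primZ D c F f : prim D F f -> prim D (fun x => c * F x) (fun x => c * f x).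
Proof.
move=> H x y Dx Dy xy; have [vi e] := H _ _ Dx Dy xy.
split; first exact: cintegrableZ.
by rewrite cintZ// -e mulrBr.
Qed.

Lemma primB D F f G g : prim D F f -> prim D G g ->
  prim D (fun x => F x - G x) (fun x => f x - g x).
Proof.
move=> H H' x y Dx Dy xy; have [vi e] := H _ _ Dx Dy xy.
have [vi' e'] := H' _ _ Dx Dy xy; split; first exact: cintegrableB.
by rewrite cintB// -e -e'; ring.
Qed.

Lemma prim_cst D c : prim D (fun=> c) (fun=> 0).
Proof.
by move=> x y _ _ _; split; [exact: cintegrable0|rewrite cint0 subrr].
Qed.

Lemma primS D E F f : E `<=` D -> prim D F f -> prim E F f.
Proof. by move=> ED H x y /ED Dx /ED Dy; exact: H. Qed.

(** The two closed half-lines share the value F 0, so no matching condition remains; the point is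
    the integrability of f across 0. *)
Lemma prim_glue F f : prim `[0, +oo[ F f -> prim `]-oo, 0] F f ->
  prim setT F f.
Proof.
move=> Hp Hn x y _ _ xy.
have [x0|x0] := leP 0 x.
  by apply: Hp => //; rewrite /= in_itv/= andbT// (le_trans x0).
have [y0|y0] := leP y 0.
  by apply: Hn => //; rewrite /= in_itv/= // (le_trans xy).
have [ip ep] : cintegrable `[0, y] f /\ F y - F 0 = cint `[0, y] f.
  by apply: Hp => //; rewrite ?ltW// /= in_itv/= ?andbT// ltW.
have [i_n en] : cintegrable `[x, 0] f /\ F 0 - F x = cint `[x, 0] f.
  by apply: Hn => //; rewrite ?ltW// /= in_itv/= ?andbT// ltW.
have fi : cintegrable `[x, y] f.
  have H (u : R -> R) : mu.-integrable `[x, 0] (EFin \o u) ->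
      mu.-integrable `[0, y] (EFin \o u) -> mu.-integrable `[x, y] (EFin \o u).
    move=> /integrableP[m1 l1] H2; rewrite (setU_itvcc (ltW x0) (ltW y0)).
    have /integrableP[m2 l2] : mu.-integrable `]0, y] (EFin \o u).
      by apply: integrableS H2 => //; apply: subset_itvr; rewrite bnd_simp.
    have mm : measurable_fun (`[x, 0] `|` `]0, y]) (EFin \o u).
      by apply/measurable_funU.
    apply/integrableP; split => //.
    rewrite ge0_integral_setU//; first by rewrite lte_add_pinfty.
      exact: measurableT_comp.
    by apply/disj_set2P; rewrite -subset0 => z /= []; rewrite !in_itv/= => /andP[_ z0] /andP[]; rewrite ltNge z0.
  by case: ip => ? ?; case: i_n => ? ?; split; apply: H.
split=> //; rewrite (cint_split (ltW x0) (ltW y0))// -ep -en; ring.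
Qed.

End Primitives.

(** * Continuity, derivatives and measurability of complex functions of a real variable *)

Section Continuity.
Context {R : realType}.
Local Notation mu := (@lebesgue_measure R).
Local Notation lmeasurable := (@measurable _ (measurableTypeR R)).
Implicit Types (D : set R) (u v : R -> R) (F G f g : R -> R[i]).

Definition ccont f : Prop :=
  continuous (fun x => Re (f x)) /\ continuous (fun x => Im (f x)).

Definition cderiv F f : Prop := forall x : R,
  is_derive x 1 (fun x => Re (F x)) (Re (f x)) /\
  is_derive x 1 (fun x => Im (F x)) (Im (f x)).

Lemma rprim_derive u v : (forall x : R, is_derive x 1 u (v x)) -> continuous v ->
  rprim setT u v.
Proof.
move=> uv cv x y _ _ xy.
have vi : mu.-integrable `[x, y] (EFin \o v).
  apply: continuous_compact_integrable; first exact: segment_compact.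
  exact: continuous_subspaceT.
split=> //; move: xy; rewrite le_eqVlt => /orP[/eqP ->|xy].
  by rewrite set_itv1 Rintegral_set1 subrr.
have cu : continuous u.
  move=> z; apply/differentiable_continuous/derivable1_diffP.
  exact: (@ex_derive _ _ _ _ _ _ _ (uv z)).
have := @continuous_FTC2 _ v u x y xy _ _ _.
rewrite /Rintegral => -> //.
- exact: continuous_subspaceT.
- split.
  + by move=> z _; exact: (@ex_derive _ _ _ _ _ _ _ (uv z)).
  + exact/cvg_at_right_filter/cu.
  + exact/cvg_at_left_filter/cu.
- by move=> z _; rewrite derive1E (@derive_val _ _ _ _ _ _ _ (uv z)).
Qed.

Lemma prim_cderiv F f : cderiv F f -> ccont f -> prim setT F f.
Proof.
move=> Ff [c1 c2]; apply/primP; split; apply: rprim_derive => // x;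
  by have [] := Ff x.
Qed.

Lemma cderiv_cexp F f : cderiv F f ->
  cderiv (fun x => cexp (F x)) (fun x => f x * cexp (F x)).
Proof.
move=> Ff x; have [d1 d2] := Ff x.
have e1 : is_derive x 1 (expR \o (fun x => Re (F x))) (expR (Re (F x)) * Re (f x)).
  exact: is_derive1_comp.
have e2 : is_derive x 1 (cos \o (fun x => Im (F x))) (- sin (Im (F x)) * Im (f x)).
  exact: is_derive1_comp.
have e3 : is_derive x 1 (sin \o (fun x => Im (F x))) (cos (Im (F x)) * Im (f x)).
  exact: is_derive1_comp.
split.
  apply: (@is_derive_eq _ _ _ _ _ _ _ _ (is_deriveM e1 e2)).
  by rewrite cReM /= /GRing.scale /=; ring.
apply: (@is_derive_eq _ _ _ _ _ _ _ _ (is_deriveM e1 e3)).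
by rewrite cImM /= /GRing.scale /=; ring.
Qed.

Lemma cderiv_real u v : (forall x : R, is_derive x 1 u (v x)) ->
  cderiv (fun x => (u x)%:C) (fun x => (v x)%:C).
Proof. by move=> uv x; split => /=; [exact: uv|exact: is_derive_cst]. Qed.

Lemma cderivD F f G g : cderiv F f -> cderiv G g ->
  cderiv (fun x => F x + G x) (fun x => f x + g x).
Proof.
move=> Ff Gg x; have [a1 a2] := Ff x; have [b1 b2] := Gg x; split.
  rewrite cReD (_ : (fun x => _) = (fun x => Re (F x)) + (fun x => Re (G x))).
    exact: is_deriveD.
  by apply/funext => z; rewrite cReD.
rewrite cImD (_ : (fun x => _) = (fun x => Im (F x)) + (fun x => Im (G x))).
  exact: is_deriveD.
by apply/funext => z; rewrite cImD.
Qed.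

Lemma cderivZ c F f : cderiv F f ->
  cderiv (fun x => c * F x) (fun x => c * f x).
Proof.
move=> Ff x; have [a1 a2] := Ff x; split.
  rewrite cReM (_ : (fun x => _) = (Re c *: (fun x => Re (F x))) - (Im c *: (fun x => Im (F x)))).
    by apply: is_deriveB; apply: is_deriveZ.
  by apply/funext => z; rewrite cReM.
rewrite cImM (_ : (fun x => _) = (Re c *: (fun x => Im (F x))) + (Im c *: (fun x => Re (F x)))).
  by apply: is_deriveD; apply: is_deriveZ.
by apply/funext => z; rewrite cImM.
Qed.

Lemma ccont_cst c : ccont (fun=> c).
Proof. by split => x; exact: cvg_cst. Qed.

Lemma ccont_real u : continuous u -> ccont (fun x => (u x)%:C).
Proof. by move=> cu; split => //= x; exact: cvg_cst. Qed.

Lemma ccontD f g : ccont f -> ccont g -> ccont (fun x => f x + g x).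
Proof.
move=> [f1 f2] [g1 g2]; split.
  rewrite (_ : (fun x => _) = (fun x => Re (f x) + Re (g x))).
    by move=> x; apply: cvgD; [exact: f1|exact: g1].
  by apply/funext => x; rewrite cReD.
rewrite (_ : (fun x => _) = (fun x => Im (f x) + Im (g x))).
  by move=> x; apply: cvgD; [exact: f2|exact: g2].
by apply/funext => x; rewrite cImD.
Qed.

Lemma ccontM f g : ccont f -> ccont g -> ccont (fun x => f x * g x).
Proof.
move=> [f1 f2] [g1 g2]; split.
  rewrite (_ : (fun x => _) = (fun x => Re (f x) * Re (g x) - Im (f x) * Im (g x))).
    by move=> x; apply: cvgB; apply: cvgM; [exact: f1|exact: g1|exact: f2|exact: g2].
  by apply/funext => x; rewrite cReM.
rewrite (_ : (fun x => _) = (fun x => Re (f x) * Im (g x) + Im (f x) * Re (g x))).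
  by move=> x; apply: cvgD; apply: cvgM; [exact: f1|exact: g2|exact: f2|exact: g1].
by apply/funext => x; rewrite cImM.
Qed.

Lemma ccontN f : ccont f -> ccont (fun x => - f x).
Proof.
move=> cf; rewrite (_ : (fun x => _) = (fun x => -1 * f x)).
  by apply: ccontM => //; exact: ccont_cst.
by apply/funext => x; rewrite mulN1r.
Qed.

Lemma ccont_cexp f : ccont f -> ccont (fun x => cexp (f x)).
Proof.
move=> [f1 f2]; split => x /=; apply: cvgM.
- by apply: (continuous_comp (f1 x)); exact: continuous_expR.
- by apply: (continuous_comp (f2 x)); exact: continuous_cos.
- by apply: (continuous_comp (f1 x)); exact: continuous_expR.
- by apply: (continuous_comp (f2 x)); exact: continuous_sin.
Qed.

Lemma ccont_meas f D : lmeasurable D -> ccont f -> cmeas D f.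
Proof.
move=> mD [f1 f2].
by split; apply: measurable_funTS; exact: continuous_measurable_fun.
Qed.

Lemma cont_bounded u x y : continuous u -> exists M, forall z, x <= z <= y -> `|u z| <= M.
Proof.
move=> cu; have [xy|yx] := leP x y; last first.
  by exists 0 => z /andP[xz zy]; move: yx; rewrite ltNge (le_trans xz zy).
have c2 : {within `[x, y], continuous (fun z => `|u z|)}.
  apply: continuous_subspaceT => z.
  by apply: (continuous_comp (cu z)); exact: norm_continuous.
have [c _ H] := EVT_max xy c2.
by exists `|u c| => z zxy; apply: H; rewrite in_itv.
Qed.

Lemma ccont_bounded f x y : ccont f ->
  exists M, forall z, x <= z <= y -> normc (f z) <= M.
Proof.
move=> [f1 f2]; have [M HM] := @cont_bounded _ x y f1.
have [M' HM'] := @cont_bounded _ x y f2.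
exists (M + M') => z zxy; apply: (le_trans (normc_le_abs _)).
by rewrite lerD ?HM ?HM'.
Qed.

Lemma cmeasM D f g : cmeas D f -> cmeas D g -> cmeas D (fun x => f x * g x).
Proof.
move=> [f1 f2] [g1 g2]; split.
  rewrite (_ : (fun x => _) = (fun x => Re (f x) * Re (g x) - Im (f x) * Im (g x))).
    by apply: measurable_funB; apply: measurable_funM.
  by apply/funext => x; rewrite cReM.
rewrite (_ : (fun x => _) = (fun x => Re (f x) * Im (g x) + Im (f x) * Re (g x))).
  by apply: measurable_funD; apply: measurable_funM.
by apply/funext => x; rewrite cImM.
Qed.

Lemma cmeasD D f g : cmeas D f -> cmeas D g -> cmeas D (fun x => f x + g x).
Proof.
move=> [f1 f2] [g1 g2]; split.
  rewrite (_ : (fun x => _) = (fun x => Re (f x) + Re (g x))).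
    exact: measurable_funD.
  by apply/funext => x; rewrite cReD.
rewrite (_ : (fun x => _) = (fun x => Im (f x) + Im (g x))).
  exact: measurable_funD.
by apply/funext => x; rewrite cImD.
Qed.

Lemma cmeas_cst D c : cmeas D (fun=> c).
Proof. by split; exact: measurable_cst. Qed.

Lemma cmeasZ D c f : cmeas D f -> cmeas D (fun x => c * f x).
Proof. by move=> mf; apply: cmeasM => //; exact: cmeas_cst. Qed.

Lemma cmeasN D f : cmeas D f -> cmeas D (fun x => - f x).
Proof.
move=> cf; rewrite (_ : (fun x => _) = (fun x => -1 * f x)); first exact: cmeasZ.
by apply/funext => x; rewrite mulN1r.
Qed.

Lemma cmeasB D f g : cmeas D f -> cmeas D g -> cmeas D (fun x => f x - g x).
Proof. by move=> mf mg; apply: cmeasD => //; exact: cmeasN. Qed.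

Lemma cintegrableM_cont f g x y : ccont f -> cintegrable `[x, y] g ->
  cintegrable `[x, y] (fun z => f z * g z).
Proof.
move=> cf gi; have [M HM] := @ccont_bounded f x y cf.
apply: (@le_cintegrable _ _ _ (fun z => M * normc (g z))) => //.
- by apply: cmeasM; [exact: ccont_meas|exact: cintegrable_meas].
- move=> z; rewrite /= in_itv/= => zxy; rewrite normcM ler_wpM2r ?normc_ge0//.
  exact: HM.
- by apply: integrable_EFinZ => //; exact: cintegrable_normc.
Qed.

Lemma ccont_cintegrable f x y : ccont f -> cintegrable `[x, y] f.
Proof.
move=> [f1 f2]; split; (apply: continuous_compact_integrable;
  [exact: segment_compact|exact: continuous_subspaceT]).
Qed.

Lemma rprim_continuous u v : rprim setT u v -> continuous u.
Proof.
move=> H z.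
have zz : z - 1 <= z + 1 by lra.
have [vi _] := H (z - 1) (z + 1) I I zz.
have := parameterized_integral_continuous zz vi.
have zz' : z - 1 < z + 1 by lra.
move=> /(continuous_within_itvP _ zz')[+ _ _].
have zin : z \in `](z - 1), (z + 1)[%R by rewrite in_itv/=; apply/andP; split; lra.
move=> /(_ _ zin) c1.
have c2 : (u (z - 1) + parameterized_integral mu (z - 1) w v) @[w --> z] -->
   u (z - 1) + parameterized_integral mu (z - 1) z v.
  by apply: cvgD c1; exact: cvg_cst.
have E w : z - 1 <= w -> u (z - 1) + parameterized_integral mu (z - 1) w v = u w.
  by move=> zw; have [_ e] := H (z - 1) w I I zw; rewrite /parameterized_integral -e; ring.
rewrite /continuous_at -[in X in _ --> X](E z); last by lra.
apply: cvg_trans c2; apply: near_eq_cvg; near=> w.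
by rewrite E//; near: w; apply: lt_le_nbhsr; lra.
Unshelve. all: by end_near. Qed.

Lemma prim_ccont F f : prim setT F f -> ccont F.
Proof. by move=> /primP[/rprim_continuous ? /rprim_continuous ?]. Qed.

Lemma prim_conj D (F f : R -> R[i]) : prim D F f ->
  prim D (fun x => conjc (F x)) (fun x => conjc (f x)).
Proof.
move=> /primP[F1 F2]; have E z : Re (conjc z) = Re z :> R by case: z.
have E' z : Im (conjc z) = 0 - Im z :> R by case: z => a b /=; rewrite sub0r.
apply/primP; split; first by rewrite (funext (fun x => E (F x))) (funext (fun x => E (f x))).
rewrite (funext (fun x => E' (F x))) (funext (fun x => E' (f x))).
apply: rprimB F2 => x y _ _ _; split; first by have [] := @cintegrable0 R `[x, y].
by rewrite subrr /Rintegral integral0.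
Qed.

Lemma cmeas_conj D (f : R -> R[i]) : cmeas D f -> cmeas D (fun x => conjc (f x)).
Proof.
move=> [f1 f2]; split; first by apply: eq_measurable_fun f1 => x _; case: (f x).
have -> : (fun x => Im (conjc (f x))) = (fun x => - Im (f x)).
  by apply/funext => x; case: (f x).
exact: measurableT_comp.
Qed.

Lemma normc_conj (z : R[i]) : normc (conjc z) = normc z.
Proof. by case: z => a b; rewrite /= sqrrN. Qed.

End Continuity.

(** * Change of variables x -> -x *)

Section Reflection.
Context {R : realType}.
Local Notation mu := (@lebesgue_measure R).
Local Notation lmeasurable := (@measurable _ (measurableTypeR R)).
Implicit Types (D : set R) (u : R -> R) (F f : R -> R[i]).
Local Notation opp := (-%R : measurableTypeR R -> measurableTypeR R).

Let mopp : measurable_fun setT opp.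
Proof. by []. Qed.

Lemma ge0_integral_opp (w : R -> \bar R) : measurable_fun setT w ->
  (forall x, 0 <= w x)%E -> (\int[mu]_x w (- x)%R = \int[mu]_x w x)%E.
Proof.
move=> mw w0.
transitivity (\int[pushforward mu opp]_x w x)%E.
  by rewrite (ge0_integral_pushforward mopp)//= preimage_setT.
by apply: eq_measure_integral => A mA _; exact: lebesgue_measureN.
Qed.

Lemma integrable_opp (w : R -> \bar R) : mu.-integrable setT w ->
  mu.-integrable setT (w \o opp).
Proof.
move=> /integrableP[mw lw]; apply/integrableP; split.
  exact: (measurableT_comp mw mopp).
rewrite /= (ge0_integral_opp (w := fun x => `|w x|%E))//.
exact: measurableT_comp.
Qed.

Lemma integral_opp (w : R -> \bar R) : mu.-integrable setT w ->
  (\int[mu]_x w (- x)%R = \int[mu]_x w x)%E.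
Proof.
move=> iw; have iw' := integrable_opp iw.
have /integrableP[mw _] := iw.
transitivity (\int[pushforward mu opp]_x w x)%E.
  by rewrite (integral_pushforward mopp)// preimage_setT.
by apply: eq_measure_integral => A mA _; exact: lebesgue_measureN.
Qed.

Lemma Rint_opp D u : lmeasurable D -> mu.-integrable D (EFin \o u) ->
  mu.-integrable (opp @^-1` D) (EFin \o (u \o opp)) /\
  \int[mu]_(x in opp @^-1` D) u (- x) = \int[mu]_(x in D) u x.
Proof.
move=> mD ui.
have mD' : lmeasurable (opp @^-1` D) by rewrite -[X in lmeasurable X]setTI; exact: mopp.
have E : ((EFin \o (u \o opp)) \_ (opp @^-1` D)) = ((EFin \o u) \_ D) \o opp.
  by apply/funext => x; rewrite /= !patchE.
have ui' := (integrable_mkcond _ mD).1 ui.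
split; first by apply/integrable_mkcond => //; rewrite E; exact: integrable_opp.
rewrite /Rintegral [X in _ = fine X]integral_mkcond [X in fine X = _]integral_mkcond.
rewrite -(integral_opp ui'); congr fine; apply: eq_integral => x _ /=; rewrite !patchE.
Qed.

Lemma cint_opp D f : lmeasurable D -> cintegrable D f ->
  cintegrable (opp @^-1` D) (fun x => f (- x)) /\
  cint (opp @^-1` D) (fun x => f (- x)) = cint D f.
Proof.
move=> mD [f1 f2]; have [i1 e1] := Rint_opp mD f1; have [i2 e2] := Rint_opp mD f2.
by split => //; apply: complexP.
Qed.

Lemma cint_opp_itv f x y : cintegrable `[x, y] f ->
  cintegrable `[- y, - x] (fun z => f (- z)) /\
  cint `[- y, - x] (fun z => f (- z)) = cint `[x, y] f.
Proof.
have -> : `[- y, - x]%classic = opp @^-1` `[x, y].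
  by rewrite opp_preimage_itvbndbnd.
exact: cint_opp.
Qed.

Lemma prim_opp D F f : prim D F f ->
  prim (opp @^-1` D) (fun x => F (- x)) (fun x => - f (- x)).
Proof.
move=> H x y /= Dx Dy xy; rewrite -lerN2 in xy.
have [fi e] := H _ _ Dy Dx xy; have [fi' e'] := cint_opp_itv fi.
rewrite !opprK in fi' e'; split; first exact: cintegrableN.
by rewrite cintN// e' -e; ring.
Qed.

End Reflection.

(** * Weighted estimates on a half-line *)

Section Schur.
Context {R : realType}.
Local Notation mu := (@lebesgue_measure R).
Local Notation lmeasurable := (@measurable _ (measurableTypeR R)).
Local Notation mR := (measurableTypeR R).
Implicit Types (D : set R) (f g H : R -> R).

Lemma integral_expRNy (a : R) :
  (\int[mu]_(y in `[a, +oo[) (expR (- (y - a)))%:E = 1)%E.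
Proof.
have D (x : R) : is_derive x 1 (fun y => - expR (- (y - a))) (expR (- (x - a))).
  have e1 : is_derive x 1 (fun y : R => - (y - a)) (-1).
    apply: is_derive_eq (is_deriveN (is_deriveB (is_derive_id x 1) (is_derive_cst a x 1))) _.
    by rewrite subr0.
  apply: is_derive_eq (is_deriveN (@is_derive1_comp _ expR _ x _ _ (is_derive_expR _) e1)) _.
  by rewrite mulrN1 opprK.
have cF : continuous (fun y : R => - expR (- (y - a))).
  move=> x; apply/differentiable_continuous/derivable1_diffP.
  exact: (@ex_derive _ _ _ _ _ _ _ (D x)).
rewrite (@ge0_continuous_FTC2y R (fun y => expR (- (y - a))) (fun y => - expR (- (y - a))) a 0).
- by rewrite subrr oppr0 expR0 sub0e -EFinN opprK.
- by move=> x _; exact: expR_ge0.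
- apply: continuous_subspaceT => x.
  by rewrite /continuous_at -[expR (- (x - a))]opprK;
     apply: (cvg_trans _ (cvgN (cF x))); apply: near_eq_cvg; near=> y; rewrite opprK.
- rewrite -oppr0; apply: cvgN.
  apply: (@cvg_comp _ _ _ (fun y : R => y - a) (fun z => expR (- z)) _ +oo%R).
    exact: cvg_addrr.
  exact: cvgr_expR.
- by move=> x _; exact: (@ex_derive _ _ _ _ _ _ _ (D x)).
- exact/cvg_at_right_filter/cF.
- by move=> x _; rewrite derive1E (@derive_val _ _ _ _ _ _ _ (D x)).
Unshelve. all: by end_near. Qed.

(** Hölder's inequality at exponents 2 and 2, squared so that it is free of roots and makes sense
    for infinite integrals. *)
Lemma cauchy_schwarz_ge0 f g : measurable_fun setT f -> measurable_fun setT g ->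
  (forall x, 0 <= f x) -> (forall x, 0 <= g x) ->
  ((\int[mu]_x (f x * g x)%:E) * (\int[mu]_x (f x * g x)%:E) <=
   (\int[mu]_x (f x ^+ 2)%:E) * (\int[mu]_x (g x ^+ 2)%:E))%E.
Proof.
move=> mf mg f0 g0.
have two : (0 : R) < 2 by [].
have := @hoelder _ mR R mu f g 2 2 mf mg two two.
have -> : 2^-1 + 2^-1 = 1 :> R by lra.
move=> /(_ erefl); rewrite Lnorm1 Lnorm.unlock.
have E (w : R -> R) : (forall x, 0 <= w x) ->
    (\int[mu]_x `|(EFin \o w) x| `^ 2 = \int[mu]_x (w x ^+ 2)%:E)%E.
  by move=> w0; apply: eq_integral => x _; rewrite /= ger0_norm// ?poweR_EFin powR_mulrn.
have P0 (w : R -> R) : (0 <= \int[mu]_x (w x ^+ 2)%:E)%E.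
  by apply: integral_ge0 => x _; rewrite lee_fin sqr_ge0.
have A0 : (0 <= \int[mu]_x (f x * g x)%:E)%E.
  by apply: integral_ge0 => x _; rewrite lee_fin mulr_ge0.
rewrite !E// !poweR12_sqrt//.
under eq_integral => x _ do rewrite /= ger0_norm ?mulr_ge0//.
rewrite -sqrteM// => H.
have -> : (\int[mu]_x (f x ^+ 2)%:E * \int[mu]_x (g x ^+ 2)%:E =
  sqrte (\int[mu]_x (f x ^+ 2)%:E * \int[mu]_x (g x ^+ 2)%:E) *
  sqrte (\int[mu]_x (f x ^+ 2)%:E * \int[mu]_x (g x ^+ 2)%:E))%E.
  by rewrite -[RHS]/(sqrte _ ^+ 2)%E sqr_sqrte// mule_ge0.
exact: lee_pmul.
Qed.

Definition ekernel (x y : R) : R := expR (- `|x - y|).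

Lemma ekernel_sym x y : ekernel x y = ekernel y x.
Proof. by rewrite /ekernel distrC. Qed.

Lemma measurable_ekernel x : measurable_fun setT (ekernel x).
Proof.
apply: continuous_measurable_fun => y.
apply: (@continuous_comp _ _ _ (fun y => - `|x - y|) expR); last exact: continuous_expR.
apply: cvgN; apply: cvg_norm; apply: cvgB; [exact: cvg_cst|exact: cvg_id].
Qed.

(** Each side of x carries mass 1; the left side is reflected onto a right half-line to reuse the
    same integral. *)
Lemma integral_ekernel x : (\int[mu]_y (ekernel x y)%:E <= 2%:E)%E.
Proof.
have mk D : lmeasurable D -> measurable_fun D (fun y => (ekernel x y)%:E).
  by move=> mD; apply/measurable_EFinP; apply: measurable_funTS; exact: measurable_ekernel.
rewrite -(setUv (`[x, +oo[)) ge0_integral_setU//=; first last.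
- by rewrite disj_set2E setICr.
- by move=> y _; rewrite lee_fin expR_ge0.
- by rewrite setUv; exact: mk.
- exact: measurableC.
have -> : (2%:E = 1 + 1 :> \bar R)%E by rewrite -EFinD.
apply: leeD.
  rewrite -(integral_expRNy x) le_eqVlt; apply/orP; left; apply/eqP.
  apply: eq_integral => y; rewrite inE/= in_itv/= andbT => xy.
  by rewrite /ekernel distrC ger0_norm// subr_ge0.
rewrite setCitvr.
rewrite integral_mkcond -(@ge0_integral_opp _ (_ \_ _)); first last.
- by move=> y; rewrite patchE; case: ifP => // _; rewrite lee_fin expR_ge0.
- by apply/(measurable_restrictT _ _).1 => //; exact: mk.
rewrite -(integral_expRNy (- x)) [leRHS]integral_mkcond.
apply: ge0_le_integral => //.
- by move=> y _; rewrite patchE; case: ifP => // _; rewrite lee_fin expR_ge0.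
- have mopp : measurable_fun setT (-%R : mR -> mR) by [].
  have m1 : measurable_fun setT ((fun y => (ekernel x y)%:E) \_ `]-oo, x[).
    by apply/(measurable_restrictT _ _).1 => //; exact: mk.
  exact: (measurableT_comp m1 mopp).
- apply/(measurable_restrictT _ _).1 => //.
  apply/measurable_EFinP; apply: measurable_funTS; apply: continuous_measurable_fun => y.
  apply: (@continuous_comp _ _ _ (fun y => - (y - - x)) expR); last exact: continuous_expR.
  by apply: cvgN; apply: cvgB; [exact: cvg_id|exact: cvg_cst].
move=> y _; rewrite !patchE !mem_setE !in_itv/= andbT.
case: ifPn => [yx|_]; last by case: ifP => // _; rewrite lee_fin expR_ge0.
have -> : - x <= y by lra.
by rewrite lee_fin /ekernel ler_expR lerN2 ger0_norm; lra.
Qed.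

Lemma measurable_ekernel2 :
  measurable_fun setT (fun z : mR * mR => ekernel z.1 z.2).
Proof.
apply: (measurableT_comp (f := @expR R)) => //.
apply: measurableT_comp => //; apply: measurableT_comp => //.
exact: measurable_funB.
Qed.

(** Schur's test. With s the square root of the kernel, Cauchy-Schwarz for s and s H bounds the
    square of the integral of k H by the mass of k times the integral of k H^2. Integrating in x and
    exchanging the integrals uses the mass in the other variable. The constant 4 is the product of
    the two masses. *)
Lemma schur H : measurable_fun setT H -> (forall x, 0 <= H x) ->
  ((\int[mu]_x ((\int[mu]_y (ekernel x y * H y)%:E) *
               (\int[mu]_y (ekernel x y * H y)%:E))) <=
   4%:E * \int[mu]_y (H y ^+ 2)%:E)%E.
Proof.
move=> mH H0.
have mHz (z : mR * mR -> mR) : measurable_fun setT z -> measurable_fun setT (H \o z).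
  by move=> mz; exact: (measurableT_comp mH).
pose phi (z : mR * mR) := (ekernel z.1 z.2 * H z.2 ^+ 2)%:E.
have mphi : measurable_fun setT phi.
  apply/measurable_EFinP; apply: measurable_funM; first exact: measurable_ekernel2.
  by apply: measurable_funX; exact: (mHz snd).
have phi0 z : (0 <= phi z)%E by rewrite lee_fin mulr_ge0 ?expR_ge0 ?sqr_ge0.
have mG : measurable_fun setT (fun x => (\int[mu]_y (ekernel x y * H y)%:E)%E).
  apply: (@measurable_fun_fubini_tonelli_F _ _ mR mR _ mu
    (fun z : mR * mR => (ekernel z.1 z.2 * H z.2)%:E)).
    apply/measurable_EFinP; apply: measurable_funM; first exact: measurable_ekernel2.
    exact: (mHz snd).
  by move=> z; rewrite lee_fin mulr_ge0 ?expR_ge0.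
have mF := @measurable_fun_fubini_tonelli_F _ _ mR mR _ mu phi mphi phi0.
apply: (@le_trans _ _ (\int[mu]_x (2%:E * \int[mu]_y phi (x, y)))%E).
  apply: ge0_le_integral => //.
  - by move=> x _; apply: mule_ge0; apply: integral_ge0 => y _; rewrite lee_fin mulr_ge0 ?expR_ge0.
  - exact: emeasurable_funM.
  - by apply: emeasurable_funM => //.
  move=> x _.
  pose s y := expR (- `|x - y| / 2).
  have ms : measurable_fun setT s.
    apply: continuous_measurable_fun => y.
    apply: (@continuous_comp _ _ _ (fun y => - `|x - y| / 2) expR); last exact: continuous_expR.
    apply: cvgM; last exact: cvg_cst.
    by apply: cvgN; apply: cvg_norm; apply: cvgB; [exact: cvg_cst|exact: cvg_id].
  have ss y : s y * s y = ekernel x y by rewrite /s -expRD /ekernel; congr expR; field.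
  have := @cauchy_schwarz_ge0 s (fun y => s y * H y) ms (measurable_funM ms mH)
    (fun y => expR_ge0 _) (fun y => mulr_ge0 (expR_ge0 _) (H0 y)).
  under eq_integral do rewrite mulrA ss.
  under [in X in (_ <= X)%E -> _]eq_integral do rewrite expr2 ss.
  move=> /le_trans; apply.
  have -> : (\int[mu]_y ((s y * H y) ^+ 2)%:E = \int[mu]_y phi (x, y))%E.
    by apply: eq_integral => y _; rewrite /phi /= exprMn expr2 ss.
  apply: lee_wpmul2r; first by apply: integral_ge0.
  exact: integral_ekernel.
rewrite ge0_integralZl//; last by move=> x _; apply: integral_ge0.
rewrite (fubini_tonelli phi)//.
have -> : (4%:E = 2%:E * 2%:E :> \bar R)%E by rewrite -EFinM; congr EFin; ring.
rewrite -muleA; apply: lee_wpmul2l => //.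
rewrite -ge0_integralZl//; last 2 first.
  by apply/measurable_EFinP; exact: measurable_funX.
  by move=> y _; rewrite lee_fin sqr_ge0.
apply: ge0_le_integral => //.
- by move=> y _; apply: integral_ge0.
- exact: (@measurable_fun_fubini_tonelli_G _ _ mR mR _ mu phi mphi phi0).
- by apply: emeasurable_funM => //; apply/measurable_EFinP; exact: measurable_funX.
move=> y _; rewrite /phi /=.
under eq_integral do rewrite EFinM.
rewrite ge0_integralZr//; last 3 first.
  by apply/measurable_EFinP; under eq_fun do rewrite ekernel_sym; exact: measurable_ekernel.
  by move=> x _; rewrite lee_fin expR_ge0.
  by rewrite lee_fin sqr_ge0.
apply: lee_wpmul2r; first by rewrite lee_fin sqr_ge0.
under eq_integral do rewrite ekernel_sym.
exact: integral_ekernel.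
Qed.

(** The form in which Schur's test is applied: g need only be dominated pointwise by the kernel
    applied to H. Extension by 0 reduces the half-line to the line. *)
Lemma conv_L2 (g H : R -> R) (C : R) : 0 <= C ->
  measurable_fun (`[0, +oo[ : set R) g -> measurable_fun (`[0, +oo[ : set R) H ->
  (forall x, 0 <= x -> 0 <= H x) ->
  (forall x, 0 <= x ->
    (`|g x|%:E <= C%:E * \int[mu]_(y in `[0%R, +oo[) (ekernel x y * H y)%:E)%E) ->
  (\int[mu]_(x in `[0%R, +oo[) (g x ^+ 2)%:E <=
   (4 * C ^+ 2)%:E * \int[mu]_(x in `[0%R, +oo[) (H x ^+ 2)%:E)%E.
Proof.
move=> C0 mg mH H0 gH.
pose H' := H \_ (`[0, +oo[ : set R).
have mH' : measurable_fun setT H' by apply/(measurable_restrictT _ _).1.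
have H'0 x : 0 <= H' x.
  by rewrite /H' patchE; case: ifPn => //; rewrite inE/= in_itv/= andbT => /H0.
have -> : (\int[mu]_(x in `[0%R, +oo[) (H x ^+ 2)%:E = \int[mu]_x (H' x ^+ 2)%:E)%E.
  rewrite [LHS]integral_mkcond; apply: eq_integral => x _.
  by rewrite /H' !patchE; case: ifP => // _; rewrite expr0n.
rewrite mulrC EFinM -muleA.
apply: le_trans (lee_wpmul2l _ (schur mH' H'0)); last by rewrite lee_fin sqr_ge0.
pose S x := (\int[mu]_y (ekernel x y * H' y)%:E)%E.
have S0 x : (0 <= S x)%E by apply: integral_ge0 => y _; rewrite lee_fin mulr_ge0 ?expR_ge0.
have mS : measurable_fun setT S.
  apply: (@measurable_fun_fubini_tonelli_F _ _ mR mR _ mu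
    (fun z : mR * mR => (ekernel z.1 z.2 * H' z.2)%:E)).
    apply/measurable_EFinP; apply: measurable_funM; first exact: measurable_ekernel2.
    exact: (measurableT_comp mH').
  by move=> z; rewrite lee_fin mulr_ge0 ?expR_ge0.
have mSS : measurable_fun setT (fun x => S x * S x)%E by exact: emeasurable_funM.
have -> : ((C ^+ 2)%:E * \int[mu]_x (S x * S x) =
    \int[mu]_x ((C ^+ 2)%:E * (S x * S x)))%E.
  by rewrite (ge0_integralZl mu _ mSS)// ?lee_fin ?sqr_ge0// => x _; exact: mule_ge0.
apply: (@le_trans _ _ (\int[mu]_(x in `[0%R, +oo[) ((C ^+ 2)%:E * (S x * S x)))%E); last first.
  apply: ge0_subset_integral => //.
    by apply: emeasurable_funM => //; exact: emeasurable_funM.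
  by move=> x _; rewrite mule_ge0 ?lee_fin ?sqr_ge0// mule_ge0.
apply: ge0_le_integral => //.
- by move=> x _; rewrite lee_fin sqr_ge0.
- by apply/measurable_EFinP; exact: measurable_funX.
- apply: measurable_funTS.
  by apply: emeasurable_funM => //; exact: emeasurable_funM.
move=> x /=; rewrite in_itv/= andbT => x0.
have := gH x x0.
have -> : (\int[mu]_(y in `[0%R, +oo[) (ekernel x y * H y)%:E = S x)%E.
  rewrite [LHS]integral_mkcond; apply: eq_integral => y _.
  by rewrite /H' !patchE; case: ifP => // _; rewrite mulr0.
move=> gS.
have -> : ((g x ^+ 2)%:E = `|g x|%:E * `|g x|%:E)%E.
  by rewrite -EFinM -expr2 real_normK ?num_real.
have -> : ((C ^+ 2)%:E * (S x * S x) = (C%:E * S x) * (C%:E * S x))%E.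
  by rewrite expr2 EFinM muleACA.
by apply: lee_pmul.
Qed.

End Schur.

(** * Integrals over [0, +oo[, limits at infinity, and linear equations of order one *)

Section HalfLineIntegrals.
Context {R : realType}.
Local Notation mu := (@lebesgue_measure R).
Local Notation lmeasurable := (@measurable _ (measurableTypeR R)).
Local Notation halfline := (`[(0 : R), +oo[%classic).
Implicit Types (D : set R) (u v : R -> R) (F G f g : R -> R[i]).

Lemma halflineP (x : R) : halfline x <-> 0 <= x.
Proof. by rewrite /= in_itv/= andbT. Qed.

Lemma halfline_interval : is_interval halfline.
Proof. exact: interval_is_interval. Qed.

Lemma measurable_halfline u :
  (forall x : R, 0 <= x -> measurable_fun (`[0, x] : set R) u) -> measurable_fun halfline u.
Proof.
move=> H; rewrite itv0y_bigcup0S; apply/measurable_fun_bigcup => // n.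
exact: H.
Qed.

Lemma prim_meas_halfline F f : prim halfline F f -> cmeas halfline F.
Proof.
move=> /primP[H1 H2]; split; apply: measurable_halfline => x x0.
  by apply: (rprim_measurable halfline_interval H1); apply/halflineP.
by apply: (rprim_measurable halfline_interval H2); apply/halflineP.
Qed.

(** Monotone convergence along the segments [0, n]. *)
Lemma ge0_integral_halfline_le u (M : \bar R) :
  measurable_fun halfline u -> (forall x : R, 0 <= x -> 0 <= u x) ->
  (forall x : R, 0 <= x -> (\int[mu]_(y in `[0%R, x]) (u y)%:E <= M)%E) ->
  (\int[mu]_(y in halfline) (u y)%:E <= M)%E.
Proof.
move=> mU u0 H.
pose w := u \_ halfline.
have mw : measurable_fun setT w by apply/(measurable_restrictT _ _).1.
have w0 x : 0 <= w x.
  by rewrite /w patchE; case: ifPn => // ; rewrite inE => /halflineP/u0.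
have E D : D `<=` halfline ->
    (\int[mu]_(y in D) (u y)%:E = \int[mu]_(y in D) (w y)%:E)%E.
  move=> DH; apply: eq_integral => x xD; rewrite /w patchE.
  by rewrite mem_set//; exact/DH/set_mem.
rewrite E//.
have cv := @ge0_cvgn_integral R mu w w0 mw.
rewrite -(cvg_lim (@ereal_hausdorff R) cv).
apply: lime_le; first by apply/cvg_ex; eexists; exact: cv.
apply: nearW => n; rewrite -E ?H//.
by apply: subset_itvl; rewrite bnd_simp.
Qed.

Lemma integrable_halfline u (M : R) :
  measurable_fun halfline u -> (forall x : R, 0 <= x -> 0 <= u x) ->
  (forall x : R, 0 <= x -> (\int[mu]_(y in `[0%R, x]) (u y)%:E <= M%:E)%E) ->
  mu.-integrable halfline (EFin \o u).
Proof.
move=> mU u0 H; apply/integrableP; split; first exact/measurable_EFinP.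
apply: (@le_lt_trans _ _ M%:E); last exact: ltry.
rewrite [leLHS](_ : _ = \int[mu]_(y in halfline) (u y)%:E)%E.
  exact: ge0_integral_halfline_le.
by apply: eq_integral => x; rewrite inE => /halflineP x0 /=; rewrite ger0_norm ?u0.
Qed.

Lemma cintegrable_halflineS f (x y : R) : 0 <= x -> cintegrable halfline f ->
  cintegrable `[x, y] f.
Proof.
move=> x0; apply: cintegrableS => // z /=; rewrite !in_itv/= andbT => /andP[xz _].
exact: le_trans xz.
Qed.

Lemma cintegrable_halflineSy f (x : R) : 0 <= x -> cintegrable halfline f ->
  cintegrable `[x, +oo[ f.
Proof.
move=> x0; apply: cintegrableS => // z /=; rewrite !in_itv/= !andbT => xz.
exact: le_trans xz.
Qed.

Lemma Rint_splity u (x : R) : 0 <= x -> mu.-integrable halfline (EFin \o u) ->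
  \int[mu]_(t in halfline) u t =
  \int[mu]_(t in `[0, x]) u t + \int[mu]_(t in `[x, +oo[) u t.
Proof.
move=> x0 ui.
have mu' : mu.-integrable `]x, +oo[ (EFin \o u).
  apply: integrableS ui => // z /=; rewrite !in_itv/= !andbT => xz.
  by rewrite (le_trans x0)// ltW.
apply/eqP; rewrite -subr_eq0 opprD addrA.
rewrite (@Rintegral_itvB _ _ (BLeft 0) +oo%O x)//.
by rewrite Rintegral_itv_obnd_cbnd// subrr.
Qed.

Lemma cint_splity f (x : R) : 0 <= x -> cintegrable halfline f ->
  cint halfline f = cint `[0, x] f + cint `[x, +oo[ f.
Proof.
move=> x0 [f1 f2]; apply: complexP.
  by rewrite cReD !Re_cint -Rint_splity.
by rewrite cImD !Im_cint -Rint_splity.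
Qed.

Lemma cint_tail f (e : R) : cintegrable halfline f -> 0 < e ->
  exists2 X, 0 <= X & forall x, X <= x ->
    normc (cint halfline f - cint `[0, x] f) <= e.
Proof.
move=> fi e0; have ni := cintegrable_normc (measurable_itv _) fi.
pose w := (fun x => normc (f x)) \_ halfline.
have mw : measurable_fun setT w.
  apply/(measurable_restrictT _ _).1 => //.
  exact: cmeas_normc (cintegrable_meas fi).
have w0 x : 0 <= w x by rewrite /w patchE; case: ifPn => // _; exact: normc_ge0.
have E D : D `<=` halfline ->
    (\int[mu]_(y in D) (normc (f y))%:E = \int[mu]_(y in D) (w y)%:E)%E.
  move=> DH; apply: eq_integral => x xD; rewrite /w patchE.
  by rewrite mem_set//; exact/DH/set_mem.
have cv := @ge0_cvgn_integral R mu w w0 mw.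
rewrite -E// in cv.
(* Half of e, because [normc_cint_le] loses a factor 2. *)
have e4 : 0 < e / 2 by rewrite divr_gt0.
move: cv; rewrite -[X in _ --> X]fineK; last exact: integrable_fin_num ni.
move=> /fine_cvgP[_ /cvgrPdist_le/(_ _ e4)[n _ Hn]].
exists n%:R => // x nx; have x0 : 0 <= x by exact: le_trans nx.
rewrite (cint_splity x0 fi) addrAC subrr add0r.
have ixy := cintegrable_halflineSy x0 fi.
apply: (le_trans (normc_cint_le _ ixy)) => //.
have S1 := Rint_splity x0 ni.
have S2 : \int[mu]_(t in `[0, n%:R]) normc (f t) <= \int[mu]_(t in `[0, x]) normc (f t).
  have i1 := cintegrable_normc (measurable_itv _) (cintegrable_halflineS x (lexx 0) fi).
  have i2 := cintegrable_normc (measurable_itv _) (cintegrable_halflineS n%:R (lexx 0) fi).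
  rewrite /Rintegral fine_le//; try exact: integrable_fin_num.
  apply: ge0_subset_integral => //.
  - by have /integrableP[] := i1.
  - by move=> z _; rewrite lee_fin normc_ge0.
  - by apply: subset_itvl; rewrite bnd_simp.
have S3 := Hn n (leqnn n).
rewrite /= -E in S3; last by apply: subset_itvl; rewrite bnd_simp.
have S4 := le_trans (ler_norm _) S3.
rewrite -/(Rintegral mu halfline _) -/(Rintegral mu `[0, n%:R] _) in S4.
move: S1 S2 S4; set a := Rintegral _ _ _; set b := Rintegral _ _ _.
set c := Rintegral _ _ _; set d := Rintegral _ _ _ => S1 S2 S4; lra.
Qed.

(** If l were not 0, the modulus of F would be at least |l| / 2 on a ray, which has infinite
    measure. *)
Lemma cintegrable_limit0 F l : cintegrable halfline F ->
  (forall e : R, 0 < e -> exists X, forall x, X <= x -> normc (F x - l) <= e) ->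
  l = 0.
Proof.
move=> Fi H; apply/eqP; rewrite -normc_eq0; apply/negPn/negP => l0.
have L0 : 0 < normc l by rewrite lt_neqAle eq_sym l0 normc_ge0.
have L2 : 0 < normc l / 2 by rewrite divr_gt0.
have [X HX] := H _ L2.
pose Y := Num.max X 0.
have Y0 : 0 <= Y by rewrite /Y le_max lexx orbT.
have [_] := integrableP _ _ _ (cintegrable_normc (measurable_itv _)
  (cintegrable_halflineSy Y0 Fi)).
apply/negP; rewrite -leNgt.
apply: (@le_trans _ _ (\int[mu]_(x in `[Y, +oo[) (normc l / 2)%:E)%E); last first.
  apply: ge0_le_integral => //.
  - by move=> x _; rewrite lee_fin ltW.
  - apply: measurableT_comp => //; apply/measurable_EFinP.
    exact: cmeas_normc (cintegrable_meas (cintegrable_halflineSy Y0 Fi)).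
  move=> x /=; rewrite in_itv/= andbT => Yx; rewrite lee_fin.
  apply: le_trans (ler_norm _).
  have Xx : X <= x by apply: le_trans Yx; rewrite /Y le_max lexx.
  have h1 := HX x Xx.
  have h2 : normc l <= normc (F x) + normc (F x - l).
    have {1}-> : l = F x + - (F x - l) by ring.
    by apply: (le_trans (normc_leD _ _)); rewrite normcN.
  lra.
have muY : lebesgue_measure (`[Y, +oo[ : set R) = +oo%E.
  by rewrite lebesgue_measure_itv/= ltry.
rewrite (integral_cst mu)//. by rewrite [X in (_ <= _ * X)%E](_ : _ = +oo%E)// mulry gtr0_sg// mul1e.
Qed.

(** Integrating factor e^w: by the product rule the equation y' = s - w' y is (e^w y)' = e^w s, and
    multiplication by e^{-w} leads back. The density s need only be locally integrable. *)
Lemma linear_odeP (w w' y s : R -> R[i]) : cderiv w w' -> ccont w' ->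
  (forall x : R, 0 <= x -> cintegrable `[0, x] s) ->
  prim halfline y (fun x => s x - w' x * y x) <->
  (forall x : R, 0 <= x -> y x = cexp (- w x) *
     (cexp (w 0) * y 0 + cint `[0, x] (fun t => cexp (w t) * s t))).
Proof.
move=> dw cw' si.
have cw : ccont w by exact: prim_ccont (prim_cderiv dw cw').
have cew : ccont (fun x => cexp (w x)) by exact: ccont_cexp.
have cewN : ccont (fun x => cexp (- w x)) by apply: ccont_cexp; exact: ccontN.
have pe : prim halfline (fun x => cexp (w x)) (fun x => w' x * cexp (w x)).
  apply: (@primS _ setT) => //; apply: prim_cderiv; first exact: cderiv_cexp.
  exact: ccontM.
have peN : prim halfline (fun x => cexp (- w x)) (fun x => - w' x * cexp (- w x)).
  apply: (@primS _ setT) => //; apply: prim_cderiv; last by apply: ccontM => //; exact: ccontN.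
  have := @cderiv_cexp _ (fun x => -1 * w x) (fun x => -1 * w' x) (cderivZ (-1) dw).
  by under eq_fun do rewrite mulN1r; under [in X in cderiv _ X]eq_fun do rewrite !mulN1r.
have h0 : halfline 0 by apply/halflineP.
split=> H.
  have P := primM halfline_interval pe H.
  move=> x x0; have hx : halfline x by apply/halflineP.
  have [_ e] := P 0 x h0 hx x0.
  rewrite -(_ : cint `[0, x] (fun x0 => w' x0 * cexp (w x0) * y x0 +
    cexp (w x0) * (s x0 - w' x0 * y x0)) = cint `[0, x] (fun t => cexp (w t) * s t)).
    rewrite -e addrC subrK mulrA cexpN mul1r //.
  by apply: eq_cint => t _; ring.
pose E x := cexp (w 0) * y 0 + cint `[0, x] (fun t => cexp (w t) * s t).
have PE : prim halfline E (fun t => cexp (w t) * s t).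
  move=> a b /halflineP a0 /halflineP b0 ab.
  have ib : cintegrable `[0, b] (fun t => cexp (w t) * s t).
    by apply: cintegrableM_cont => //; exact: si.
  split; first by apply: cintegrable_itvS ib.
  by rewrite /E (cint_split a0 ab ib); ring.
apply: (eq_prim halfline_interval _ _ (primM halfline_interval peN PE)) => x /halflineP x0 /=.
  by rewrite H.
rewrite [y x]H// -/(E x) mulrA cexpN; ring.
Qed.

End HalfLineIntegrals.

(** * Weighted estimates for a potential whose derivative tends to +oo *)

Section Potential.
Context {R : realType}.
Local Notation mu := (@lebesgue_measure R).
Local Notation lmeasurable := (@measurable _ (measurableTypeR R)).
Local Notation halfline := (`[(0 : R), +oo[%classic).
Implicit Types (n : R -> R).

(** The hypotheses seen from one half-line: u is either U or its reflection x -> U(-x), and v is the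
    derivative of u. *)
Definition potential (u v : R -> R) : Prop :=
  [/\ forall x : R, is_derive x 1 u (v x), continuous v,
      forall x, 0 <= x -> 0 <= v x,
      v x @[x --> +oo%R] --> +oo%R & u 0 = 0].

Context (u v : R -> R) (uv : potential u v).

Let du : forall x : R, is_derive x 1 u (v x). Proof. by case: uv. Qed.
Let cv : continuous v. Proof. by case: uv. Qed.
Let v_ge0 : forall x, 0 <= x -> 0 <= v x. Proof. by case: uv. Qed.
Let vy : v x @[x --> +oo%R] --> +oo%R. Proof. by case: uv. Qed.
Let u0 : u 0 = 0. Proof. by case: uv. Qed.
Let ru : rprim setT u v. Proof. exact: rprim_derive. Qed.
Let cu : continuous u. Proof. exact: rprim_continuous ru. Qed.

Lemma derive_lower_bound k x y : x <= y -> (forall t, x <= t <= y -> k <= v t) ->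
  k * (y - x) <= u y - u x.
Proof.
move=> xy H; have [vi ->] := ru I I xy.
have -> : k * (y - x) = \int[mu]_(t in `[x, y]) k.
  have e : lebesgue_measure (`[x, y] : set R) = (y - x)%:E.
    rewrite lebesgue_measure_itv/= lte_fin; case: ltP => // yx.
    by rewrite (@le_anti _ _ x y) ?xy// subrr.
  by rewrite (Rintegral_cst mu)// [X in k * fine X](_ : _ = (y - x)%:E).
apply: le_Rintegral => //.
apply: continuous_compact_integrable; first exact: segment_compact.
by apply: continuous_subspaceT => z; exact: cvg_cst.
Qed.

(** Superlinear growth, uniform in the starting point x. Beyond X the slope of u is at least m', the
    positive part of m; before X the monotonicity of u loses at most m' X, which is the constant
    C. *)
Lemma potential_growth m : exists C, 0 <= C /\
  forall x y, 0 <= x -> x <= y -> m * (y - x) - C <= u y - u x.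
Proof.
pose m' := Num.max m 0.
have m'0 : 0 <= m' by rewrite le_max lexx orbT.
have mm' : m <= m' by rewrite le_max lexx.
have [M [_ HM]] : \forall x \near +oo%R, m' <= v x by exact: cvgry_ge.
pose X := Num.max (M + 1) 0.
have X0 : 0 <= X by rewrite le_max lexx orbT.
have XM t : X <= t -> m' <= v t.
  move=> Xt; apply: HM; apply: lt_le_trans Xt.
  by rewrite lt_max ltrDl ltr01.
exists (m' * X); split; first exact: mulr_ge0.
move=> x y x0 xy.
have mxy : m * (y - x) <= m' * (y - x) by rewrite ler_wpM2r// subr_ge0.
have mono a b : 0 <= a -> a <= b -> 0 <= u b - u a.
  move=> a0 ab; have := @derive_lower_bound 0 a b ab; rewrite mul0r; apply.
  by move=> t /andP[at_ _]; apply: v_ge0; exact: le_trans at_.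
have big a b : X <= a -> a <= b -> m' * (b - a) <= u b - u a.
  move=> Xa ab; apply: derive_lower_bound => // t /andP[at_ _].
  by apply: XM; exact: le_trans at_.
have [Xx|xX] := leP X x.
  have h1 := big x y Xx xy; have h2 := mulr_ge0 m'0 X0; lra.
have [Xy|yX] := leP X y.
  have h1 := big X y (lexx _) Xy; have h2 := mono x X x0 (ltW xX).
  have h3 : m' * (X - x) <= m' * X by rewrite ler_wpM2l//; lra.
  lra.
have h1 := mono x y x0 xy.
have h3 : m' * (y - x) <= m' * X by rewrite ler_wpM2l//; lra.
lra.
Qed.

(** Growth of slope 2(|c| + 1), halved by the factor 1/2, absorbs e^{|c|(x-y)} and leaves
    e^{-(x-y)}; K is e^{C/2}. *)
Lemma kernel_bound c : exists K, 0 <= K /\ forall x y, 0 <= y -> y <= x ->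
  expR (- (c * (x - y)) - (u x - u y) / 2) <= K * ekernel x y.
Proof.
have [C [C0 HC]] := potential_growth (2 * (`|c| + 1)).
exists (expR (C / 2)); split; first exact: expR_ge0.
move=> x y y0 yx; rewrite /ekernel -expRD ler_expR.
have h := HC y x y0 yx.
have xy0 : 0 <= x - y by rewrite subr_ge0.
have h1 : - c * (x - y) <= `|c| * (x - y).
  by rewrite ler_wpM2r// -normrN ler_norm.
rewrite ger0_norm//; lra.
Qed.

Lemma cont_exp_lin (a b : R) (w : R -> R) : (forall x, w x = a * x + b * u x) ->
  continuous (fun x => expR (w x)).
Proof.
move=> ww x; under eq_fun do rewrite ww.
apply: (@continuous_comp _ _ _ (fun x => a * x + b * u x) expR);
  last exact: continuous_expR.
by apply: cvgD; apply: cvgM; [exact: cvg_cst|exact: cvg_id|exact: cvg_cst|exact: cu].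
Qed.

Lemma measurable_exp_lin (a b : R) (D : set R) (w : R -> R) :
  lmeasurable D -> (forall x, w x = a * x + b * u x) ->
  measurable_fun D (fun x => expR (w x)).
Proof.
move=> mD ww; apply: measurable_funTS; apply: continuous_measurable_fun.
exact: cont_exp_lin ww.
Qed.

(** Growth of slope c + 1 leaves the majorant e^C e^{-x}. *)
Lemma exp_integrable c : mu.-integrable halfline (EFin \o (fun x => expR (c * x - u x))).
Proof.
have [C [C0 HC]] := potential_growth (c + 1).
have gi : mu.-integrable halfline (EFin \o (fun x : R => expR C * expR (- (x - 0)))).
  apply: integrable_EFinZ => //; apply/integrableP; split.
    apply/measurable_EFinP; apply: measurable_funTS; apply: continuous_measurable_fun => x.
    apply: (@continuous_comp _ _ _ (fun x => - (x - 0)) expR); last exact: continuous_expR.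
    by apply: cvgN; apply: cvgB; [exact: cvg_id|exact: cvg_cst].
  under eq_integral do rewrite /= ger0_norm ?expR_ge0//.
  by rewrite integral_expRNy ltry.
apply: (le_integrable _ _ _ gi) => //.
- apply/measurable_EFinP; apply: (@measurable_exp_lin c (-1)) => // ?; ring.
- move=> x /halflineP x0 /=; rewrite lee_fin !ger0_norm ?mulr_ge0 ?expR_ge0//.
  rewrite -expRD ler_expR; have := HC 0 x (lexx _) x0; rewrite u0; lra.
Qed.

Definition rL2 n : Prop := measurable_fun halfline n /\
  mu.-integrable halfline (EFin \o (fun x => n x ^+ 2 * expR (- u x))).

(** The square of the norm of L^2(e^{-u}) on the half-line; no root is taken, so that bounds can be
    added and composed linearly. *)
Definition rnrm n : R := \int[mu]_(x in halfline) (n x ^+ 2 * expR (- u x)).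

Lemma EFin_Rintegral (D : set R) (w : R -> R) : lmeasurable D -> mu.-integrable D (EFin \o w) ->
  (\int[mu]_(x in D) w x)%:E = (\int[mu]_(x in D) (w x)%:E)%E.
Proof. by move=> mD wi; rewrite /Rintegral fineK//; exact: integrable_fin_num wi. Qed.

Lemma rnrm_ge0 n : 0 <= rnrm n.
Proof. by apply: Rintegral_ge0 => x _; rewrite mulr_ge0 ?sqr_ge0 ?expR_ge0. Qed.

Let hexp x : expR (- u x) = expR (- u x / 2) * expR (- u x / 2).
Proof. by rewrite -expRD; congr expR; field. Qed.

Lemma rL2_exp_integrable c : exists E, 0 <= E /\ forall n, rL2 n ->
  (forall x, 0 <= x -> 0 <= n x) ->
  mu.-integrable halfline (EFin \o (fun x => expR (c * x - u x) * n x)) /\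
  (\int[mu]_(x in halfline) (expR (c * x - u x) * n x)) ^+ 2 <= E * rnrm n.
Proof.
have ei := exp_integrable (2 * c).
exists (\int[mu]_(x in halfline) expR (2 * c * x - u x)); split.
  by apply: Rintegral_ge0 => x _; exact: expR_ge0.
move=> n [mn ni] n0.
have mf : measurable_fun halfline (fun x => expR (c * x - u x) * n x).
  by apply: measurable_funM => //; apply: (@measurable_exp_lin c (-1)) => // ?; ring.
have I1 : mu.-integrable halfline (EFin \o (fun x => expR (c * x - u x) * n x)).
  apply: (le_integrable _ _ _ (integrableD _ ei ni)) => //; first exact/measurable_EFinP.
  move=> x /halflineP x0 /=; rewrite lee_fin ger0_norm ?mulr_ge0 ?expR_ge0 ?n0//.
  apply: le_trans (ler_norm _).
  have -> : expR (2 * c * x - u x) = expR (c * x - u x / 2) ^+ 2.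
    by rewrite expr2 -expRD; congr expR; field.
  rewrite hexp; set b := expR (- u x / 2).
  have -> : expR (c * x - u x) = expR (c * x - u x / 2) * b.
    by rewrite -expRD; congr expR; field.
  set a := expR _.
  have a0 : 0 <= a by exact: expR_ge0.
  have b0 : 0 <= b by exact: expR_ge0.
  have nx := n0 x x0.
  have h1 := sqr_ge0 (a - b * n x).
  have h2 : 0 <= a * (b * n x) by rewrite !mulr_ge0.
  nra.
split=> //.
pose f : R -> R := (fun x => expR (c * x - u x / 2)) \_ halfline.
pose g : R -> R := (fun x => n x * expR (- u x / 2)) \_ halfline.
have mff : measurable_fun setT f.
  apply/(measurable_restrictT _ _).1 => //.
  apply: (@measurable_exp_lin c (- 2^-1)) => // ?; ring.
have mg : measurable_fun setT g.
  apply/(measurable_restrictT _ _).1 => //; apply: measurable_funM => //.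
  apply: (@measurable_exp_lin 0 (- 2^-1)) => // ?; ring.
have f0 x : 0 <= f x by rewrite /f patchE; case: ifP => // _; exact: expR_ge0.
have g0 x : 0 <= g x.
  rewrite /g patchE; case: ifPn => // ; rewrite inE => /halflineP x0.
  by rewrite mulr_ge0 ?expR_ge0 ?n0.
have CS := cauchy_schwarz_ge0 mff mg f0 g0.
have E1 : (\int[mu]_x (f x * g x)%:E =
    \int[mu]_(x in halfline) (expR (c * x - u x) * n x)%:E)%E.
  rewrite [RHS]integral_mkcond; apply: eq_integral => x _.
  rewrite /f /g !patchE; case: ifPn => // _; last by rewrite mul0r.
  by rewrite [n x * _]mulrC mulrA -expRD; congr (expR _ * _)%:E; field.
have E2 : (\int[mu]_x (f x ^+ 2)%:E =
    \int[mu]_(x in halfline) (expR (2 * c * x - u x))%:E)%E.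
  rewrite [RHS]integral_mkcond; apply: eq_integral => x _.
  rewrite /f !patchE; case: ifPn => // _; last by rewrite expr0n.
  by rewrite expr2 -expRD; congr (expR _)%:E; field.
have E3 : (\int[mu]_x (g x ^+ 2)%:E =
    \int[mu]_(x in halfline) (n x ^+ 2 * expR (- u x))%:E)%E.
  rewrite [RHS]integral_mkcond; apply: eq_integral => x _.
  rewrite /g !patchE; case: ifPn => // _; last by rewrite expr0n.
  by rewrite exprMn hexp expr2.
rewrite -lee_fin expr2 !EFinM /rnrm !EFin_Rintegral//.
by rewrite -E1 -E2 -E3; exact: CS.
Qed.

(** On a segment e^u is bounded by some M, and |n| <= 1 + n^2 <= 1 + M n^2 e^{-u}. *)
Lemma rL2_locally_integrable n x : rL2 n -> mu.-integrable `[0, x] (EFin \o n).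
Proof.
move=> [mn ni].
have sub : `[0, x] `<=` halfline by apply: subset_itvl; rewrite bnd_simp.
have ni' : mu.-integrable `[0, x] (EFin \o (fun x => n x ^+ 2 * expR (- u x))).
  exact: integrableS ni.
have ceu : continuous (fun z => expR (u z)).
  by apply: (@cont_exp_lin 0 1) => z; ring.
have [M HM] := @cont_bounded _ _ 0 x ceu.
have i1 : mu.-integrable `[0, x] (EFin \o (fun=> (1 : R))).
  apply: continuous_compact_integrable; first exact: segment_compact.
  by apply: continuous_subspaceT => z; exact: cvg_cst.
apply: (le_integrable _ _ _ (integrableD _ i1 (integrable_EFinZ M _ ni'))) => //.
  by apply/measurable_EFinP; exact: measurable_funS mn.
move=> z; rewrite /= in_itv/= => zx; rewrite lee_fin; apply: le_trans (ler_norm _).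
have := HM z zx; rewrite ger0_norm ?expR_ge0// => h.
have h1 : n z ^+ 2 <= M * (n z ^+ 2 * expR (- u z)).
  rewrite mulrCA -[leLHS]mulr1 ler_wpM2l ?sqr_ge0//.
  by rewrite -[leLHS](expRxMexpNx_1 (u z)) ler_wpM2r// expR_ge0.
have h2 := sqr_ge0 (`|n z| - 1).
rewrite sqrrB1 real_normK ?num_real// in h2.
have h3 := normr_ge0 (n z).
have h4 := sqr_ge0 (n z).
nra.
Qed.

(** The solution of y' = -c y + n with y(0) = 0. With c = Re [gamma] and n = |h| it controls the
    inhomogeneous part of [hp], up to the factor 2 of [normc_cint_le]. *)
Definition Pw c n x : R := expR (- (c * x)) * \int[mu]_(t in `[0, x]) (expR (c * t) * n t).

Lemma exp_locally_integrable c n x : rL2 n ->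
  mu.-integrable `[0, x] (EFin \o (fun t => expR (c * t) * n t)).
Proof.
move=> nL; have ni := @rL2_locally_integrable n x nL.
have ce : continuous (fun t => expR (c * t)).
  by apply: (@cont_exp_lin c 0) => z; ring.
have [M HM] := @cont_bounded _ _ 0 x ce.
apply: (integrableM_bounded (M := M)) => //.
by apply: measurable_funTS; exact: continuous_measurable_fun.
Qed.

Lemma Y_rprim c n : rL2 n ->
  rprim halfline (fun x => \int[mu]_(t in `[0, x]) (expR (c * t) * n t))
    (fun t => expR (c * t) * n t).
Proof.
move=> nL a b /halflineP a0 /halflineP b0 ab.
have ib := @exp_locally_integrable c n b nL.
split; first by apply: integrableS ib => //; apply: subset_itvr; rewrite bnd_simp.
by rewrite (Rint_split a0 ab ib); ring.
Qed.

Lemma Pw_measurable c n : rL2 n -> measurable_fun halfline (Pw c n).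
Proof.
move=> nL; apply: measurable_funM.
  by apply: (@measurable_exp_lin (- c) 0) => // ?; ring.
apply: measurable_halfline => x x0.
by apply: (rprim_measurable halfline_interval (Y_rprim c nL)); apply/halflineP.
Qed.

Lemma Pw_ge0 c n x : (forall x, 0 <= x -> 0 <= n x) -> 0 <= Pw c n x.
Proof.
move=> n0; rewrite mulr_ge0 ?expR_ge0//; apply: Rintegral_ge0 => t.
by rewrite /= in_itv/= => /andP[/n0 ? _]; rewrite mulr_ge0 ?expR_ge0.
Qed.

(** Multiplication by e^{-u/2} carries the weighted space to the unweighted one, where [conv_L2]
    applies. *)
Lemma conv_rL2 n (g : R -> R) K : 0 <= K -> rL2 n ->
  (forall x, 0 <= x -> 0 <= n x) -> measurable_fun halfline g ->
  (forall x, 0 <= x -> (`|g x * expR (- u x / 2)|%:E <=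
    K%:E * \int[mu]_(y in halfline) (ekernel x y * (n y * expR (- u y / 2)))%:E)%E) ->
  rL2 g /\ rnrm g <= 4 * K ^+ 2 * rnrm n.
Proof.
move=> K0 [mn ni] n0 mg H.
have me : measurable_fun halfline (fun x => expR (- u x / 2)).
  apply: (@measurable_exp_lin 0 (- 2^-1)) => // ?; ring.
have mh := measurable_funM mg me; have mh' := measurable_funM mn me.
have E w : (\int[mu]_(x in halfline) ((w x * expR (- u x / 2)) ^+ 2)%:E =
    \int[mu]_(x in halfline) (w x ^+ 2 * expR (- u x))%:E)%E.
  by apply: eq_integral => x _; rewrite exprMn hexp expr2.
have := conv_L2 K0 mh mh' _ H; rewrite !E => H'.
have {}H' := H' (fun x x0 => mulr_ge0 (n0 x x0) (expR_ge0 _)).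
have gi : mu.-integrable halfline (EFin \o (fun x => g x ^+ 2 * expR (- u x))).
  apply/integrableP; split.
    apply/measurable_EFinP; apply: measurable_funM; first exact: measurable_funX.
    by apply: (@measurable_exp_lin 0 (-1)) => // ?; ring.
  rewrite [ltLHS](_ : _ = \int[mu]_(x in halfline) (g x ^+ 2 * expR (- u x))%:E)%E; last first.
    by apply: eq_integral => x _ /=; rewrite ger0_norm// mulr_ge0 ?sqr_ge0 ?expR_ge0.
  apply: (le_lt_trans H'); rewrite -EFin_Rintegral// -EFinM; exact: ltry.
split=> //; rewrite -lee_fin EFinM /rnrm !EFin_Rintegral//.
Qed.

(** After conjugation by e^{-u/2} the kernel of [Pw] is e^{-c(x-y) - (u(x)-u(y))/2} on y <= x, which
    [kernel_bound] dominates. *)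
Lemma Pw_rL2 c : exists C, 0 <= C /\ forall n, rL2 n ->
  (forall x, 0 <= x -> 0 <= n x) -> rL2 (Pw c n) /\ rnrm (Pw c n) <= C * rnrm n.
Proof.
have [K [K0 HK]] := kernel_bound c.
exists (4 * K ^+ 2); split; first by rewrite mulr_ge0// sqr_ge0.
move=> n nL n0; apply: conv_rL2 => //; first exact: Pw_measurable.
move=> x x0.
have mke D : lmeasurable D -> measurable_fun D (fun y => expR (- u y / 2)).
  move=> mD.
  apply: (@measurable_exp_lin 0 (- 2^-1)) => // ?; ring.
have mk : measurable_fun halfline (fun y => ekernel x y * (n y * expR (- u y / 2))).
  apply: measurable_funM; first by apply: measurable_funTS; exact: measurable_ekernel.
  by apply: measurable_funM; [case: nL|exact: mke].
rewrite ger0_norm; last by rewrite mulr_ge0 ?expR_ge0 ?Pw_ge0.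
have -> : Pw c n x * expR (- u x / 2) =
   (expR (- (c * x)) * expR (- u x / 2)) * \int[mu]_(t in `[0, x]) (expR (c * t) * n t).
  by rewrite /Pw mulrAC.
rewrite -RintegralZl//; last exact: exp_locally_integrable.
rewrite EFin_Rintegral//; last by apply: integrable_EFinZ => //; exact: exp_locally_integrable.
rewrite -ge0_integralZl//; last 2 first.
- exact/measurable_EFinP.
- by move=> y /halflineP y0; rewrite lee_fin !mulr_ge0 ?expR_ge0 ?n0.
have sub : `[0, x] `<=` halfline by apply: subset_itvl; rewrite bnd_simp.
apply: (@le_trans _ _ (\int[mu]_(y in `[0%R, x]) (K%:E * (ekernel x y * (n y * expR (- u y / 2)))%:E))%E); last first.
  apply: ge0_subset_integral => //.
    by apply: measurable_funeM; exact/measurable_EFinP.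
  move=> y /halflineP y0; rewrite -EFinM lee_fin !mulr_ge0 ?expR_ge0 ?n0//.
apply: ge0_le_integral => //.
- by move=> y; rewrite /= in_itv/= => /andP[/n0 y0 _]; rewrite lee_fin !mulr_ge0 ?expR_ge0.
- apply/measurable_EFinP; apply: measurable_funM => //.
  by have /measurable_EFinP := measurable_int mu (@exp_locally_integrable c n x nL).
- by apply: measurable_funeM; apply/measurable_EFinP; exact: measurable_funS mk.
move=> y; rewrite /= in_itv/= => /andP[y0 yx]; rewrite -EFinM lee_fin.
have -> : expR (- (c * x)) * expR (- u x / 2) * (expR (c * y) * n y) =
  expR (- (c * (x - y)) - (u x - u y) / 2) * (n y * expR (- u y / 2)).
  have -> : expR (- (c * (x - y)) - (u x - u y) / 2) =
    expR (- (c * x)) * expR (- u x / 2) * expR (c * y) * expR (u y / 2).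
    by rewrite -!expRD; congr expR; field.
  have e1 : expR (u y / 2) * expR (- u y / 2) = 1.
    by rewrite -expRD -expR0; congr expR; field.
  transitivity (expR (- (c * x)) * expR (- u x / 2) * (expR (c * y) * n y) * (expR (u y / 2) * expR (- u y / 2))).
    by rewrite e1 mulr1.
  by ring.
rewrite [leRHS]mulrA ler_wpM2r ?HK// mulr_ge0 ?n0 ?expR_ge0//.
Qed.

(** The counterpart of [Pw_rL2] for solutions integrated from infinity: after conjugation the kernel
    is that of [Pw] with x and y exchanged. The factor 2 in the hypothesis on g is the loss of
    [normc_cint_le], and it is why 2 K is squared in the constant. *)
Lemma tail_rL2 (c : R) : exists C, 0 <= C /\ forall n (g : R -> R), rL2 n ->
  (forall x, 0 <= x -> 0 <= n x) -> measurable_fun halfline g ->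
  (forall x, 0 <= x -> `|g x| <= 2 * (expR (c * x + u x) *
     \int[mu]_(t in `[x, +oo[) (expR (- (c * t) - u t) * n t))) ->
  rL2 g /\ rnrm g <= C * rnrm n.
Proof.
have [K [K0 HK]] := kernel_bound c.
have [E [E0 HE]] := rL2_exp_integrable (- c).
exists (4 * (2 * K) ^+ 2); split; first by rewrite mulr_ge0// sqr_ge0.
move=> n g nL n0 mg gH; apply: conv_rL2 => //; first exact: mulr_ge0.
move=> x x0.
have [ei _] := HE n nL n0.
have sub : `[x, +oo[ `<=` halfline.
  by move=> y /=; rewrite !in_itv/= !andbT; exact: le_trans.
have ei' : mu.-integrable `[x, +oo[ (EFin \o (fun t => expR (- (c * t) - u t) * n t)).
  apply: integrableS (eq_integrable _ _ _ _ ei) => // y _ /=.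
  by rewrite mulNr.
have mk : measurable_fun halfline (fun y => ekernel x y * (n y * expR (- u y / 2))).
  apply: measurable_funM; first by apply: measurable_funTS; exact: measurable_ekernel.
  apply: measurable_funM; first by case: nL.
  by apply: (measurable_exp_lin (a := 0) (b := - 2^-1)) => // ?; ring.
apply: (@le_trans _ _ ((2 * (expR (c * x + u x) * expR (- u x / 2)))%:E *
    \int[mu]_(t in `[x, +oo[) (expR (- (c * t) - u t) * n t)%:E)%E).
  rewrite -EFin_Rintegral// -EFinM lee_fin normrM (ger0_norm (expR_ge0 _)).
  apply: (le_trans (ler_wpM2r (expR_ge0 _) (gH x x0))).
  by rewrite le_eqVlt; apply/orP; left; apply/eqP; ring.
rewrite [in leRHS]EFinM EFinM -!muleA; apply: lee_wpmul2l; first by rewrite lee_fin.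
rewrite -ge0_integralZl//; last 2 first.
- exact: (measurable_int mu ei').
- by move=> y /sub/halflineP y0; rewrite lee_fin mulr_ge0 ?expR_ge0 ?n0.
rewrite -ge0_integralZl//; last 2 first.
- exact/measurable_EFinP.
- by move=> y /halflineP y0; rewrite lee_fin !mulr_ge0 ?expR_ge0 ?n0.
apply: (@le_trans _ _ (\int[mu]_(y in `[x, +oo[) (K%:E * (ekernel x y * (n y * expR (- u y / 2)))%:E))%E); last first.
  apply: ge0_subset_integral => //.
    by apply: measurable_funeM; exact/measurable_EFinP.
  by move=> y /halflineP y0; rewrite -EFinM lee_fin !mulr_ge0 ?expR_ge0 ?n0.
apply: ge0_le_integral => //.
- by move=> y /sub/halflineP y0; rewrite -EFinM lee_fin !mulr_ge0 ?expR_ge0 ?n0.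
- by apply: measurable_funeM; have /integrableP[] := ei'.
- by apply: measurable_funeM; apply/measurable_EFinP; exact: measurable_funS mk.
move=> y xy; have y0 : 0 <= y by apply/halflineP/sub.
move: xy; rewrite /= in_itv/= andbT => xy; rewrite -!EFinM lee_fin.
have -> : expR (c * x + u x) * expR (- u x / 2) * (expR (- (c * y) - u y) * n y) =
  expR (- (c * (y - x)) - (u y - u x) / 2) * (n y * expR (- u y / 2)).
  have -> : expR (- (c * y) - u y) = expR (- (c * y) - u y / 2) * expR (- u y / 2).
    by rewrite -expRD; congr expR; field.
  have -> : expR (- (c * (y - x)) - (u y - u x) / 2) =
     expR (c * x + u x) * expR (- u x / 2) * expR (- (c * y) - u y / 2).
    by rewrite -!expRD; congr expR; field.
  by ring.
by rewrite [leRHS]mulrA ekernel_sym ler_wpM2r ?HK// mulr_ge0 ?n0 ?expR_ge0.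
Qed.

(** With e = e^{-2ct - u} one has v e = -e' - 2c e. Integration by parts against Y trades the
    uncontrolled factor v for y = Y' and for 2|c| Y; the boundary term -e(x) Y(x) has a favourable
    sign and is dropped. The right-hand side can then be bounded uniformly in x. *)
Lemma weighted_parts c (Y y : R -> R) (x : R) : rprim halfline Y y ->
  (forall z, 0 <= z -> 0 <= Y z) -> 0 <= x ->
  mu.-integrable `[0, x] (EFin \o (fun t => v t * (expR (- (2 * c * t) - u t) * Y t))) /\
  \int[mu]_(t in `[0, x]) (v t * (expR (- (2 * c * t) - u t) * Y t)) <=
  Y 0 + \int[mu]_(t in `[0, x]) (expR (- (2 * c * t) - u t) * (2 * `|c| * Y t + y t)).
Proof.
move=> PY Y0 x0.
have h0 : halfline 0 by apply/halflineP.
have hx : halfline x by apply/halflineP.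
pose e t := expR (- (2 * c * t) - u t).
have ce : continuous e.
  by apply: (cont_exp_lin (a := - (2 * c)) (b := -1)) => ?; ring.
have cve : continuous (fun t => v t * e t) by move=> t; apply: cvgM; [exact: cv|exact: ce].
have cve' : continuous (fun t => - (2 * c + v t) * e t).
  move=> t; apply: cvgM; last exact: ce.
  by apply: cvgN; apply: cvgD; [exact: cvg_cst|exact: cv].
have de (t : R) : is_derive t 1 e (- (2 * c + v t) * e t).
  have d1 : is_derive t 1 (fun t : R => - (2 * c * t) - u t) (- (2 * c) - v t).
    have -> : (fun t : R => - (2 * c * t) - u t) = (- (2 * c)) *: (id : R -> R) - u.
      by apply/funext => z; rewrite !fctE /GRing.scale /= mulNr.
    apply: is_derive_eq (is_deriveB (is_deriveZ (- (2 * c)) (is_derive_id t 1)) (du t)) _.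
    by rewrite /GRing.scale /= mulr1.
  apply: is_derive_eq (@is_derive1_comp _ expR _ t _ _ (is_derive_expR _) d1) _.
  by rewrite mulrC; congr (_ * _); ring.
have Pe : rprim halfline e (fun t => - (2 * c + v t) * e t).
  by move=> a b _ _; apply: (rprim_derive de cve').
have iE (w : R -> R) : continuous w -> mu.-integrable `[0, x] (EFin \o (fun t => w t * Y t)).
  move=> cw; have [M HM] := @cont_bounded _ _ 0 x cw.
  have [M' HM'] := rprim_bounded halfline_interval PY h0 hx.
  have mY := rprim_measurable halfline_interval PY h0 hx.
  apply: measurable_bounded_integrable => //.
  - by rewrite /= lebesgue_measure_itv/=; case: ifP => // _; rewrite ltry.
  - apply: measurable_funM => //; apply: measurable_funTS.
    exact: continuous_measurable_fun.
  - exists (M * M'); split; first exact: num_real.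
    move=> b Mb z; rewrite /= in_itv/= => zx; rewrite normrM.
    by apply: le_trans (ltW Mb); apply: ler_pM => //; [exact: HM|exact: HM'].
have [_ yi] := rprimM halfline_interval Pe PY h0 hx x0.
have iv : mu.-integrable `[0, x] (EFin \o (fun t => v t * (e t * Y t))).
  by apply: (eq_integrable _ _ _ _ (iE _ cve)) => // t _ /=; rewrite mulrA.
split=> //.
have [ydi _] := PY _ _ h0 hx x0.
have iey : mu.-integrable `[0, x] (EFin \o (fun t => e t * y t)).
  have [M HM] := @cont_bounded _ _ 0 x ce.
  apply: (integrableM_bounded (M := M)) => //.
  by apply: measurable_funTS; exact: continuous_measurable_fun.
have ieY := iE _ ce.
have ieY1 : mu.-integrable `[0, x] (EFin \o (fun t => 2 * `|c| * (e t * Y t))) by exact: integrable_EFinZ.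
have ieY2 : mu.-integrable `[0, x] (EFin \o (fun t => 2 * c * (e t * Y t))) by exact: integrable_EFinZ.
have S1 : \int[mu]_(t in `[0, x]) (e t * (2 * `|c| * Y t + y t)) =
   2 * `|c| * \int[mu]_(t in `[0, x]) (e t * Y t) + \int[mu]_(t in `[0, x]) (e t * y t).
  rewrite -RintegralZl// -RintegralD//; apply: eq_Rintegral => t _; ring.
have S2 : \int[mu]_(t in `[0, x]) (- (2 * c + v t) * e t * Y t + e t * y t) =
   \int[mu]_(t in `[0, x]) (e t * y t) - 2 * c * \int[mu]_(t in `[0, x]) (e t * Y t)
   - \int[mu]_(t in `[0, x]) (v t * (e t * Y t)).
  rewrite -RintegralZl// -RintegralB// -RintegralB//; last first.
    by apply: (eq_integrable _ _ _ _ (integrableB _ iey ieY2)).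
  apply: eq_Rintegral => t _; ring.
have e0 : e 0 = 1 by rewrite /e mulr0 u0 subr0 oppr0 expR0.
have eY0 : 0 <= e x * Y x by rewrite mulr_ge0 ?expR_ge0 ?Y0.
have I0 : 0 <= \int[mu]_(t in `[0, x]) (e t * Y t).
  apply: Rintegral_ge0 => t; rewrite /= in_itv/= => /andP[t0 _].
  by rewrite mulr_ge0 ?expR_ge0 ?Y0.
have I1 : - (2 * c) * \int[mu]_(t in `[0, x]) (e t * Y t) <= 2 * `|c| * \int[mu]_(t in `[0, x]) (e t * Y t).
  rewrite ler_wpM2r// -mulrN ler_wpM2l// -normrN; exact: ler_norm.
rewrite S1; move: yi I1 eY0; rewrite S2 e0 mul1r; clear.
move: (Rintegral _ _ _) (Rintegral _ _ _) (Rintegral _ _ _) (e x * Y x) (Y 0).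
by move=> B A V eY Y_0; lra.
Qed.

Lemma exp2E (c t : R) : expR (- (2 * c * t) - u t) = expR (- c * t - u t) * expR (- (c * t)).
Proof. by rewrite -expRD; congr expR; ring. Qed.

(** The case Y = 1 of [weighted_parts]. It makes the integrals defining psi converge for every
    [gamma]. *)
Lemma v_exp_integrable c :
  mu.-integrable halfline (EFin \o (fun t => v t * expR (- (2 * c * t) - u t))).
Proof.
have P1 : rprim halfline (fun=> (1 : R)) (fun=> 0).
  move=> x y _ _ _; split; first exact: integrable0.
  by rewrite subrr /Rintegral integral0.
have ei : mu.-integrable halfline (EFin \o (fun t => expR (- (2 * c * t) - u t))).
  apply: (eq_integrable _ _ _ _ (exp_integrable (- (2 * c)))) => // t _ /=.
  by congr (expR _)%:E; ring.
apply: (integrable_halfline (M := 1 + \int[mu]_(t in halfline) (2 * `|c| * expR (- (2 * c * t) - u t)))).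
- apply: measurable_funM; first by apply: measurable_funTS; exact: continuous_measurable_fun.
  by apply: (measurable_exp_lin (a := - (2 * c)) (b := -1)) => // ?; ring.
- by move=> x x0; rewrite mulr_ge0 ?expR_ge0 ?v_ge0.
move=> x x0; have [i1 i2] := weighted_parts c P1 (fun _ _ => ler01) x0.
have sub : `[0, x] `<=` halfline by apply: subset_itvl; rewrite bnd_simp.
rewrite -EFin_Rintegral//; last first.
  by apply: (eq_integrable _ _ _ _ i1) => // t _ /=; rewrite mulr1.
rewrite lee_fin; apply: le_trans (le_trans i2 _).
  by rewrite le_eqVlt; apply/orP; left; apply/eqP/eq_Rintegral => t _; rewrite mulr1.
rewrite lerD2l.
have ei2 := integrable_EFinZ (2 * `|c|) (measurable_itv _) ei.
have -> : \int[mu]_(t in `[0, x]) (expR (- (2 * c * t) - u t) * (2 * `|c| * 1 + 0)) =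
   \int[mu]_(t in `[0, x]) (2 * `|c| * expR (- (2 * c * t) - u t)).
  by apply: eq_Rintegral => t _; ring.
rewrite -lee_fin !EFin_Rintegral//; last by apply: integrableS ei2.
apply: ge0_subset_integral => //; first exact: (measurable_int mu ei2).
Qed.

(** The case of [weighted_parts] in which Y is the integral of e^{ct} n over [0, x], so that Y(0) =
    0. What remains are the pairings A and B of e^{-cx - u} with n and with [Pw] c n. This bounds
    the double integral in K. *)
Lemma v_exp_Pw_integrable c : exists C, 0 <= C /\ forall n, rL2 n ->
  (forall x, 0 <= x -> 0 <= n x) ->
  mu.-integrable halfline (EFin \o (fun t => v t * (expR (- (c * t) - u t) * Pw c n t))) /\
  (\int[mu]_(t in halfline) (v t * (expR (- (c * t) - u t) * Pw c n t))) ^+ 2 <= C * rnrm n.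
Proof.
have [E [E0 HE]] := rL2_exp_integrable (- c).
have [D [D0 HD]] := Pw_rL2 c.
(* From (2|c| B + A)^2 <= 2((2|c| B)^2 + A^2), where A^2 is at most E and B^2 at most E D times the
   squared norm of n. *)
exists (2 * ((2 * `|c|) ^+ 2 * (E * D) + E)); split.
  by rewrite mulr_ge0// addr_ge0// !mulr_ge0// sqr_ge0.
move=> n nL n0.
have [pL pn] := HD n nL n0.
have p0 x : 0 <= Pw c n x by exact: Pw_ge0.
have [i1 b1] := HE n nL n0.
have [i2 b2] := HE _ pL (fun x _ => p0 x).
set A := \int[mu]_(x in halfline) _ in b1.
set B := \int[mu]_(x in halfline) _ in b2.
have A0 : 0 <= A by apply: Rintegral_ge0 => x /halflineP x0; rewrite mulr_ge0 ?expR_ge0 ?n0.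
have B0 : 0 <= B by apply: Rintegral_ge0 => x _; rewrite mulr_ge0 ?expR_ge0.
pose Y x := \int[mu]_(t in `[0, x]) (expR (c * t) * n t).
have PY := Y_rprim c nL.
have Y0 z : 0 <= z -> 0 <= Y z.
  move=> z0; apply: Rintegral_ge0 => t; rewrite /= in_itv/= => /andP[t0 _].
  by rewrite mulr_ge0 ?expR_ge0 ?n0.
have Y00 : Y 0 = 0 by rewrite /Y set_itv1 Rintegral_set1.
have EY t : expR (- (2 * c * t) - u t) * Y t = expR (- c * t - u t) * Pw c n t.
  by rewrite /Pw -/(Y t) mulrA exp2E.
have Ey t : expR (- (2 * c * t) - u t) * (expR (c * t) * n t) = expR (- c * t - u t) * n t.
  by rewrite mulrA -expRD; congr (expR _ * _); ring.
pose W t := v t * (expR (- (c * t) - u t) * Pw c n t).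
have EW t : W t = v t * (expR (- (2 * c * t) - u t) * Y t) by rewrite EY /W mulNr.
have W0 x : 0 <= x -> 0 <= W x.
  move=> x0; apply: mulr_ge0; first exact: v_ge0.
  by apply: mulr_ge0 => //; exact: expR_ge0.
have mW : measurable_fun halfline W.
  apply: measurable_funM; first by apply: measurable_funTS; exact: continuous_measurable_fun.
  apply: measurable_funM; last by case: pL.
  by apply: (measurable_exp_lin (a := - c) (b := -1)) => // ?; ring.
have sub x : `[0, x] `<=` halfline by apply: subset_itvl; rewrite bnd_simp.
have WM x : 0 <= x -> (\int[mu]_(y in `[0%R, x]) (W y)%:E <= (2 * `|c| * B + A)%:E)%E.
  move=> x0; have [j1 j2] := weighted_parts c PY Y0 x0.
  rewrite -EFin_Rintegral//; last by apply: (eq_integrable _ _ _ _ j1) => // t _ /=; rewrite EW.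
  rewrite lee_fin; apply: (le_trans _ (le_trans j2 _)).
    by rewrite le_eqVlt; apply/orP; left; apply/eqP/eq_Rintegral => t _; rewrite EW.
  rewrite -/(Y 0) Y00 add0r.
  have k1 : mu.-integrable `[0, x] (EFin \o (fun t => expR (- c * t - u t) * n t)) by exact: integrableS i1.
  have k2 : mu.-integrable `[0, x] (EFin \o (fun t => expR (- c * t - u t) * Pw c n t)) by exact: integrableS i2.
  have -> : \int[mu]_(t in `[0, x]) (expR (- (2 * c * t) - u t) *
      (2 * `|c| * \int[mu]_(t0 in `[0, t]) (expR (c * t0) * n t0) + expR (c * t) * n t)) =
    2 * `|c| * \int[mu]_(t in `[0, x]) (expR (- c * t - u t) * Pw c n t)
     + \int[mu]_(t in `[0, x]) (expR (- c * t - u t) * n t).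
    rewrite -RintegralZl// -RintegralD//; last by exact: integrable_EFinZ.
    apply: eq_Rintegral => t _; rewrite -EY -Ey /Y; ring.
  apply: lerD.
    rewrite ler_wpM2l ?mulr_ge0// -lee_fin !EFin_Rintegral//.
    apply: ge0_subset_integral => //; first exact: (measurable_int mu i2).
    by move=> t _; rewrite lee_fin; apply: mulr_ge0; rewrite ?expR_ge0.
  rewrite -lee_fin !EFin_Rintegral//.
  apply: ge0_subset_integral => //; first exact: (measurable_int mu i1).
  by move=> t /halflineP t0; rewrite lee_fin !mulr_ge0 ?expR_ge0 ?n0.
have Wi := integrable_halfline mW W0 WM.
split=> //.
have WB : \int[mu]_(x in halfline) W x <= 2 * `|c| * B + A.
  by rewrite -lee_fin EFin_Rintegral//; exact: ge0_integral_halfline_le.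
have Wge : 0 <= \int[mu]_(x in halfline) W x.
  by apply: Rintegral_ge0 => x /halflineP; exact: W0.
rewrite -/W; set I := \int[mu]_(x in halfline) W x in WB Wge *.
apply: (@le_trans _ _ ((2 * `|c| * B + A) ^+ 2)).
  by rewrite ler_sqr ?nnegrE// addr_ge0// !mulr_ge0.
apply: (@le_trans _ _ (2 * ((2 * `|c| * B) ^+ 2 + A ^+ 2))).
  have := sqr_ge0 (2 * `|c| * B - A); rewrite sqrrB sqrrD; lra.
set k := 2 * `|c|.
rewrite -[leRHS]mulrA ler_wpM2l// mulrDl exprMn; apply: lerD => //.
rewrite -[leRHS]mulrA ler_wpM2l ?sqr_ge0// -[leRHS]mulrA.
by apply: (le_trans b2); rewrite ler_wpM2l.
Qed.

End Potential.

(** * The zigzag system on a half-line *)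

Section HalfLineSystem.
Context {R : realType}.
Local Notation mu := (@lebesgue_measure R).
Local Notation lmeasurable := (@measurable _ (measurableTypeR R)).
Local Notation halfline := (`[(0 : R), +oo[%classic).
Implicit Types (f g h p q : R -> R[i]) (gamma k c : R[i]).
Context (u v : R -> R) (uv : potential u v).

Let du : forall x : R, is_derive x 1 u (v x). Proof. by case: uv. Qed.
Let cv : continuous v. Proof. by case: uv. Qed.
Let v_ge0 : forall x, 0 <= x -> 0 <= v x. Proof. by case: uv. Qed.
Let u0 : u 0 = 0. Proof. by case: uv. Qed.
Let cu : continuous u. Proof. exact: rprim_continuous (rprim_derive du cv). Qed.

Let mH : lmeasurable halfline. Proof. exact: measurable_itv. Qed.

Definition hL2 h : Prop := cmeas halfline h /\ mu.-integrable halfline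
  (EFin \o (fun x => normc (h x) ^+ 2 * expR (- u x))).

Definition hnrm h : R := rnrm u (fun x => normc (h x)).

Lemma hL2_rL2 h : hL2 h -> rL2 u (fun x => normc (h x)).
Proof. by case=> mh hi; split => //; exact: cmeas_normc. Qed.

Lemma hL2_le h (w : R -> R) : cmeas halfline h ->
  (forall x, 0 <= x -> normc (h x) ^+ 2 * expR (- u x) <= w x) ->
  mu.-integrable halfline (EFin \o w) ->
  hL2 h /\ hnrm h <= \int[mu]_(x in halfline) w x.
Proof.
move=> mh hw wi.
have hi : mu.-integrable halfline
  (EFin \o (fun x => normc (h x) ^+ 2 * expR (- u x))).
  apply: (le_integrable _ _ _ wi) => //.
    apply/measurable_EFinP; apply: measurable_funM.
      by apply: measurable_funX; exact: cmeas_normc.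
    by apply: (measurable_exp_lin uv (a := 0) (b := -1)) => // ?; ring.
  move=> x /halflineP x0 /=; rewrite lee_fin ger0_norm; last first.
    by rewrite mulr_ge0 ?sqr_ge0 ?expR_ge0.
  exact: le_trans (hw x x0) (ler_norm _).
split => //; apply: le_Rintegral => // x /halflineP; exact: hw.
Qed.

Lemma hL2D f g : hL2 f -> hL2 g ->
  hL2 (fun x => f x + g x) /\ hnrm (fun x => f x + g x) <= 2 * (hnrm f + hnrm g).
Proof.
move=> [mf fi] [mg gi].
have fgi := integrable_EFinZ 2 mH (integrableD mH fi gi).
have -> : 2 * (hnrm f + hnrm g) = \int[mu]_(x in halfline)
    (2 * (normc (f x) ^+ 2 * expR (- u x) + normc (g x) ^+ 2 * expR (- u x))).
  by rewrite RintegralZl// ?RintegralD//; exact: (integrableD mH fi gi).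
apply: hL2_le fgi; first exact: cmeasD.
move=> x x0; rewrite -mulrDl mulrA ler_wpM2r ?expR_ge0//.
apply: (@le_trans _ _ ((normc (f x) + normc (g x)) ^+ 2)).
  by rewrite ler_sqr ?nnegrE ?addr_ge0 ?normc_ge0//; exact: normc_leD.
have := sqr_ge0 (normc (f x) - normc (g x)); rewrite sqrrB sqrrD; lra.
Qed.

Lemma hL2Z c f : hL2 f -> hL2 (fun x => c * f x) /\
  hnrm (fun x => c * f x) <= normc c ^+ 2 * hnrm f.
Proof.
move=> [mf fi].
have fi' := integrable_EFinZ (normc c ^+ 2) mH fi.
rewrite /hnrm /rnrm -RintegralZl//; apply: hL2_le fi'; first exact: cmeasZ.
by move=> x _; rewrite normcM exprMn -mulrA.
Qed.

Lemma hL2_loc h (x : R) : hL2 h -> cintegrable `[0, x] h.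
Proof.
move=> hL; have [mh _] := hL.
have sub : `[0, x] `<=` halfline by apply: subset_itvl; rewrite bnd_simp.
apply: (@le_cintegrable _ _ _ (fun x => normc (h x))) => //.
  by case: mh => m1 m2; split; [exact: measurable_funS m1|exact: measurable_funS m2].
exact: (rL2_locally_integrable uv x (hL2_rL2 hL)).
Qed.

Lemma cderiv_lin gamma : cderiv (fun x => gamma * x%:C) (fun=> gamma).
Proof.
have := @cderivZ _ gamma (fun x : R => x%:C) (fun=> 1%:C) (cderiv_real (fun x => is_derive_id x 1)).
by under [in X in cderiv _ X]eq_fun do rewrite mulr1.
Qed.

Lemma cderiv_wq gamma :
  cderiv (fun x => - (gamma * x%:C) - (u x)%:C) (fun x => - gamma - (v x)%:C).
Proof.
have := cderivD (cderivZ (-1) (cderiv_lin gamma)) (cderivZ (-1) (cderiv_real du)).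
under eq_fun do rewrite !mulN1r.
by under [in X in cderiv _ X]eq_fun do rewrite !mulN1r.
Qed.

Lemma ccont_wq' gamma : ccont (fun x => - gamma - (v x)%:C).
Proof. by apply: ccontD; [exact: ccont_cst|apply: ccontN; exact: ccont_real]. Qed.

Lemma ccont_lin gamma : ccont (fun x => gamma * x%:C).
Proof. by apply: ccontM; [exact: ccont_cst|apply: ccont_real => x; exact: cvg_id]. Qed.

(** The integrating factor of q' = ([gamma] + v) q: its product with a solution of this homogeneous
    equation is constant. *)
Definition eweight gamma (x : R) : R[i] := cexp (- (gamma * x%:C) - (u x)%:C).

Lemma ccont_eweight gamma : ccont (eweight gamma).
Proof.
by apply: ccont_cexp; apply: ccontD; apply: ccontN; [exact: ccont_lin|exact: ccont_real].
Qed.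

Lemma normc_eweight gamma x : normc (eweight gamma x) = expR (- Re gamma * x - u x).
Proof.
by rewrite normc_cexp !cReD !cReN cReM /= mulr0 subr0 mulNr.
Qed.

Lemma Re_lin gamma x : Re (gamma * x%:C) = Re gamma * x.
Proof. by rewrite cReM /= mulr0 subr0. Qed.

Lemma eweight_hL2 gamma h : hL2 h ->
  cintegrable halfline (fun x => eweight gamma x * h x).
Proof.
move=> hL; have [E [_ HE]] := rL2_exp_integrable uv (- Re gamma).
have [ei _] := HE _ (hL2_rL2 hL) (fun x _ => normc_ge0 _).
apply: le_cintegrable ei => //.
  by apply: cmeasM; [apply: ccont_meas => //; exact: ccont_eweight|case: hL].
by move=> x _; rewrite normcM normc_eweight.
Qed.

(* With u = U, v = U', h1 = h^+ and h2 = h^-, the resolvent formula on x >= 0 is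
   f^- = hp k^- h2 and f^+ = hq k^+ k^- h1 h2, while hpsi = psi^+ and hK is the
   first entry of K; for x <= 0 the same holds after reflection. *)
Definition hp gamma k h (x : R) : R[i] := cexp (- (gamma * x%:C)) *
  (k + \cint_(t in `[0, x]) (cexp (gamma * t%:C) * h t)).

Definition hr gamma k h1 h2 (x : R) : R[i] :=
  eweight gamma x * (h1 x + (v x)%:C * cexp (- (gamma * x%:C)) *
    (k + \cint_(t in `[0, x]) (cexp (gamma * t%:C) * h2 t))).

Definition hq gamma k1 k2 h1 h2 (x : R) : R[i] :=
  cexp (gamma * x%:C + (u x)%:C) * (k1 - cint `[0, x] (hr gamma k2 h1 h2)).

Definition hpsi gamma : R[i] :=
  \cint_(x in halfline) ((v x)%:C * cexp (- (2 * gamma * x%:C) - (u x)%:C)).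

Definition hK gamma h1 h2 : R[i] :=
  \cint_(x in halfline) (eweight gamma x * h1 x) +
  \cint_(x in halfline) ((v x)%:C * cexp (- (2 * gamma * x%:C) - (u x)%:C) *
     \cint_(t in `[0, x]) (cexp (gamma * t%:C) * h2 t)).

Definition hsys gamma h1 h2 p q : Prop :=
  prim halfline p (fun x => - gamma * p x + h2 x) /\
  prim halfline q (fun x => (gamma + (v x)%:C) * q x - (v x)%:C * p x - h1 x).

Lemma hpP gamma h p : (forall x, 0 <= x -> cintegrable `[0, x] h) ->
  prim halfline p (fun x => - gamma * p x + h x) <->
  forall x, 0 <= x -> p x = hp gamma (p 0) h x.
Proof.
move=> hi; rewrite (_ : (fun x => - gamma * p x + h x) = (fun x => h x - gamma * p x)); last first.
  by apply/funext => x; ring.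
rewrite (linear_odeP p (cderiv_lin gamma) (ccont_cst _) hi).
by split=> H x x0; rewrite [LHS]H// /hp mulr0 cexp0 mul1r.
Qed.

Lemma hp0 gamma k h : hp gamma k h 0 = k.
Proof. by rewrite /hp mulr0 oppr0 cexp0 mul1r cint_set1 addr0. Qed.

Lemma hp_prim gamma k h : (forall x, 0 <= x -> cintegrable `[0, x] h) ->
  prim halfline (hp gamma k h) (fun x => - gamma * hp gamma k h x + h x).
Proof. by move=> hi; apply/hpP => // x _; rewrite hp0. Qed.

(** Pointwise |hp| <= e^{-cx} |k| + 2 Pw(|h|) with c the real part of [gamma]. The first term is
    square integrable for every c by [exp_integrable], so the initial value k is unrestricted. *)
Lemma hp_hL2 gamma : exists C, 0 <= C /\ forall k h, hL2 h ->
  hL2 (hp gamma k h) /\ hnrm (hp gamma k h) <= C * (normc k ^+ 2 + hnrm h).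
Proof.
pose c := Re gamma.
have [D [D0 HD]] := Pw_rL2 uv c.
have ei := exp_integrable uv (- (2 * c)).
pose E := \int[mu]_(x in halfline) expR (- (2 * c) * x - u x).
have E0 : 0 <= E by apply: Rintegral_ge0 => x _; exact: expR_ge0.
(* From (a + b)^2 <= 2(a^2 + b^2): the term in k contributes 2 E, and the factor 2 in front of [Pw]
   makes 8 D. *)
exists (2 * E + 8 * D); split; first by rewrite addr_ge0// mulr_ge0.
move=> k h hL; have nL := hL2_rL2 hL.
have [pL pn] := HD _ nL (fun x _ => normc_ge0 _).
set P := Pw c _ in pL pn.
have [_ Pi] := pL.
have i1 := integrable_EFinZ (2 * normc k ^+ 2) mH ei.
have i2 := integrable_EFinZ 8 mH Pi.
have [] := @hL2_le (hp gamma k h) (fun x => 2 * normc k ^+ 2 * expR (- (2 * c) * x - u x) +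
    8 * (P x ^+ 2 * expR (- u x))) _ _ (integrableD mH i1 i2).
- by apply: prim_meas_halfline (hp_prim gamma k _) => x _; exact: hL2_loc.
- move=> x x0.
  have hb : normc (hp gamma k h x) <= expR (- (c * x)) * normc k + 2 * P x.
    rewrite /hp normcM normc_cexp cReN Re_lin -/c.
    apply: (@le_trans _ _ (expR (- (c * x)) * (normc k + 2 * \int[mu]_(t in `[0, x]) (expR (c * t) * normc (h t))))).
      rewrite ler_wpM2l ?expR_ge0//; apply: (le_trans (normc_leD _ _)); rewrite lerD2l.
      have ci : cintegrable `[0, x] (fun t => cexp (gamma * t%:C) * h t).
        apply: cintegrableM_cont; last exact: hL2_loc.
        by apply: ccont_cexp; exact: ccont_lin.
      apply: (le_trans (normc_cint_le _ ci)) => //.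
      rewrite le_eqVlt; apply/orP; left; apply/eqP; congr (_ * _).
      by apply: eq_Rintegral => t _; rewrite normcM normc_cexp Re_lin.
    by rewrite mulrDr mulrCA.
  have -> : expR (- (2 * c) * x - u x) = expR (- (c * x)) ^+ 2 * expR (- u x).
    by rewrite expr2 -!expRD; congr expR; ring.
  have P0 : 0 <= P x by apply: Pw_ge0 => t _; exact: normc_ge0.
  set e := expR (- (c * x)) in hb *; have e0 : 0 <= e by exact: expR_ge0.
  move: (P x) P0 hb => Px P0 hb.
  apply: (@le_trans _ _ ((e * normc k + 2 * Px) ^+ 2 * expR (- u x))).
    rewrite ler_wpM2r ?expR_ge0// ler_sqr ?nnegrE ?normc_ge0//.
    by apply: addr_ge0; apply: mulr_ge0 => //; exact: normc_ge0.
  rewrite !mulrA -mulrDl ler_wpM2r ?expR_ge0//.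
  rewrite [leRHS](_ : _ = 2 * ((e * normc k) ^+ 2 + (2 * Px) ^+ 2)); last by ring.
  have := sqr_ge0 (e * normc k - 2 * Px); rewrite sqrrB sqrrD.
  move: (e * normc k) (2 * Px) => z1 z2; lra.
move=> H1 H2; split => //; apply: (le_trans H2).
rewrite RintegralD// !RintegralZl// -/E -/(rnrm u P).
have k0 := sqr_ge0 (normc k); have N0 : 0 <= hnrm h by exact: rnrm_ge0.
rewrite -/(hnrm h) in pn.
have := mulr_ge0 E0 N0; have := mulr_ge0 D0 k0.
move: (rnrm u P) (hnrm h) pn (normc k ^+ 2) => z1 z2 pn z3; lra.
Qed.

Lemma vexp_cintegrable gamma : cintegrable halfline
  (fun x => (v x)%:C * cexp (- (2 * gamma * x%:C) - (u x)%:C)).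
Proof.
apply: le_cintegrable (v_exp_integrable uv (Re gamma)) => //.
  apply: cmeasM; first by apply: ccont_meas => //; exact: ccont_real.
  apply: ccont_meas => //; exact: (ccont_eweight (2 * gamma)).
move=> x /halflineP x0; rewrite normcM normcR ger0_norm ?v_ge0//.
rewrite ler_wpM2l ?v_ge0// normc_cexp cReD !cReN Re_lin /=.
by rewrite le_eqVlt; apply/orP; left; apply/eqP; congr expR; rewrite cReM /=; ring.
Qed.

Let cexpM_loc gamma h x : hL2 h -> cintegrable `[0, x] (fun t => cexp (gamma * t%:C) * h t).
Proof.
move=> hL; apply: cintegrableM_cont; last exact: hL2_loc.
by apply: ccont_cexp; exact: ccont_lin.
Qed.

Lemma cint_param_meas h : (forall x, 0 <= x -> cintegrable `[0, x] h) ->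
  cmeas halfline (fun x => cint `[0, x] h).
Proof.
move=> hi; apply: (@prim_meas_halfline _ _ h) => x y /halflineP x0 /halflineP y0 xy.
split; first by apply: cintegrable_itvS (hi y y0).
by rewrite (cint_split x0 xy (hi y y0)); ring.
Qed.

Lemma vexp_cint_cintegrable gamma : exists C, 0 <= C /\ forall h, hL2 h ->
  cintegrable halfline (fun x => (v x)%:C * cexp (- (2 * gamma * x%:C) - (u x)%:C) *
     \cint_(t in `[0, x]) (cexp (gamma * t%:C) * h t)) /\
  normc (cint halfline (fun x => (v x)%:C * cexp (- (2 * gamma * x%:C) - (u x)%:C) *
     \cint_(t in `[0, x]) (cexp (gamma * t%:C) * h t))) ^+ 2 <= C * hnrm h.
Proof.
pose c := Re gamma.
have [C [C0 HC]] := v_exp_Pw_integrable uv c.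
(* The inner and the outer integral each lose a factor 2 in [normc_cint_le]; the product 4 is
   squared. *)
exists (16 * C); split; first by rewrite mulr_ge0.
move=> h hL; have nL := hL2_rL2 hL.
have [i1 b1] := HC _ nL (fun x _ => normc_ge0 _).
set W := (fun t => v t * _) in i1.
rewrite -/(Rintegral mu halfline W) in b1.
have i2 := integrable_EFinZ 2 mH i1.
set F := (fun x => (v x)%:C * _ * _).
have mF : cmeas halfline F.
  apply: cmeasM; first exact: cintegrable_meas (vexp_cintegrable gamma).
  by apply: cint_param_meas => x _; exact: cexpM_loc.
have FW x : 0 <= x -> normc (F x) <= 2 * W x.
  move=> x0; rewrite /F /W !normcM normcR ger0_norm ?v_ge0//.
  rewrite [leRHS]mulrCA -mulrA ler_wpM2l ?v_ge0//.
  rewrite normc_cexp cReD !cReN Re_lin /=.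
  have -> : expR (- (Re (2 * gamma) * x) - u x) = expR (- (c * x) - u x) * expR (- (c * x)).
    by rewrite -expRD; congr expR; rewrite cReM /= /c; ring.
  rewrite /Pw -[leLHS]mulrA [leRHS]mulrCA ler_wpM2l ?expR_ge0// [leRHS]mulrCA ler_wpM2l ?expR_ge0//.
  apply: (le_trans (normc_cint_le _ (cexpM_loc _ _ hL))) => //.
  rewrite le_eqVlt; apply/orP; left; apply/eqP; congr (_ * _).
  by apply: eq_Rintegral => t _; rewrite normcM normc_cexp Re_lin.
have Fi : cintegrable halfline F.
  by apply: (le_cintegrable _ mF _ i2) => // x /halflineP; exact: FW.
split=> //.
apply: (@le_trans _ _ ((4 * \int[mu]_(x in halfline) W x) ^+ 2)); last first.
  rewrite exprMn; have -> : 4 ^+ 2 = 16 :> R by ring.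
  by rewrite -mulrA ler_wpM2l.
have W0 : 0 <= \int[mu]_(x in halfline) W x.
  apply: Rintegral_ge0 => x /halflineP x0; have := le_trans (normc_ge0 _) (FW x x0).
  by rewrite pmulr_rge0.
rewrite ler_sqr ?nnegrE ?normc_ge0 ?mulr_ge0//.
apply: (le_trans (normc_cint_le _ Fi)) => //.
have -> : 4 = 2 * 2 :> R by ring.
rewrite -mulrA ler_wpM2l// -RintegralZl//.
apply: le_Rintegral => //; first exact: cintegrable_normc.
by move=> x /halflineP; exact: FW.
Qed.

Lemma hK_bound gamma : exists C, 0 <= C /\ forall h1 h2, hL2 h1 -> hL2 h2 ->
  normc (hK gamma h1 h2) ^+ 2 <= C * (hnrm h1 + hnrm h2).
Proof.
have [E [E0 HE]] := rL2_exp_integrable uv (- Re gamma).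
have [C [C0 HC]] := vexp_cint_cintegrable gamma.
(* From |A + B|^2 <= 2(|A|^2 + |B|^2), with |A|^2 bounded through 4 E and |B|^2 through C. *)
exists (8 * E + 2 * C); split; first by rewrite addr_ge0 ?mulr_ge0.
move=> h1 h2 L1 L2.
have [_ b2] := HC _ L2; have [i1 b1] := HE _ (hL2_rL2 L1) (fun x _ => normc_ge0 _).
have ci := eweight_hL2 gamma L1.
have b1' : normc (cint halfline (fun x => eweight gamma x * h1 x)) ^+ 2 <= 4 * (E * hnrm h1).
  apply: (@le_trans _ _ ((2 * \int[mu]_(x in halfline) (expR (- Re gamma * x - u x) * normc (h1 x))) ^+ 2)); last first.
    rewrite exprMn (_ : 2 ^+ 2 = 4 :> R); last by ring.
    by rewrite ler_wpM2l.
  rewrite ler_sqr ?nnegrE ?normc_ge0//; last first.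
    apply: mulr_ge0 => //; apply: Rintegral_ge0 => x _.
    by apply: mulr_ge0; [exact: expR_ge0|exact: normc_ge0].
  apply: (le_trans (normc_cint_le _ ci)) => //.
  rewrite le_eqVlt; apply/orP; left; apply/eqP; congr (_ * _).
  by apply: eq_Rintegral => t _; rewrite normcM normc_eweight.
rewrite /hK; set A := cint _ _ in b1' *; set B := cint _ _ in b2 *.
apply: (@le_trans _ _ ((normc A + normc B) ^+ 2)).
  by rewrite ler_sqr ?nnegrE ?addr_ge0 ?normc_ge0//; exact: normc_leD.
have h1n : 0 <= hnrm h1 by exact: rnrm_ge0.
have h2n : 0 <= hnrm h2 by exact: rnrm_ge0.
have := sqr_ge0 (normc A - normc B); rewrite sqrrB sqrrD.
have := mulr_ge0 E0 h2n; have := mulr_ge0 C0 h1n.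
lra.
Qed.

(** Separates the contributions of h1, of the initial value k and of h2. Integrated over the
    half-line, the outer two form [hK] and the middle one is k times [hpsi]. *)
Lemma eq_fun_hr gamma k h1 h2 x : hr gamma k h1 h2 x =
  eweight gamma x * h1 x + k * ((v x)%:C * cexp (- (2 * gamma * x%:C) - (u x)%:C)) +
  (v x)%:C * cexp (- (2 * gamma * x%:C) - (u x)%:C) *
     \cint_(t in `[0, x]) (cexp (gamma * t%:C) * h2 t).
Proof.
have e : cexp (- (2 * gamma * x%:C) - (u x)%:C) = eweight gamma x * cexp (- (gamma * x%:C)).
  by rewrite -cexpD; congr cexp; ring.
by rewrite /hr e; ring.
Qed.

Lemma hr_cintegrable gamma k h1 h2 : hL2 h1 -> hL2 h2 ->
  cintegrable halfline (hr gamma k h1 h2).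
Proof.
move=> L1 L2; have [C [_ HC]] := vexp_cint_cintegrable gamma.
have [i3 _] := HC _ L2.
have i1 := eweight_hL2 gamma L1.
have i2 := cintegrableZ k mH (vexp_cintegrable gamma).
apply: eq_cintegrable (cintegrableD _ (cintegrableD _ i1 i2) i3) => //.
by move=> x _; rewrite eq_fun_hr.
Qed.

Lemma cint_hr gamma k h1 h2 : hL2 h1 -> hL2 h2 ->
  cint halfline (hr gamma k h1 h2) = hK gamma h1 h2 + hpsi gamma * k.
Proof.
move=> L1 L2; have [C [_ HC]] := vexp_cint_cintegrable gamma.
have [i3 _] := HC _ L2.
have i1 := eweight_hL2 gamma L1.
have i2 := cintegrableZ k mH (vexp_cintegrable gamma).
rewrite (eq_cint (g := fun x => eweight gamma x * h1 x +
  k * ((v x)%:C * cexp (- (2 * gamma * x%:C) - (u x)%:C)) +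
  (v x)%:C * cexp (- (2 * gamma * x%:C) - (u x)%:C) *
     \cint_(t in `[0, x]) (cexp (gamma * t%:C) * h2 t))); last first.
  by move=> x _; rewrite eq_fun_hr.
rewrite cintD//; last exact: cintegrableD.
rewrite cintD// cintZ//; last exact: vexp_cintegrable.
by rewrite /hK /hpsi; ring.
Qed.

Lemma hK_linear gamma c f1 f2 g1 g2 : hL2 f1 -> hL2 f2 -> hL2 g1 -> hL2 g2 ->
  hK gamma (fun x => c * f1 x + g1 x) (fun x => c * f2 x + g2 x) =
  c * hK gamma f1 f2 + hK gamma g1 g2.
Proof.
move=> Lf1 Lf2 Lg1 Lg2; have [C [_ HC]] := vexp_cint_cintegrable gamma.
have [j1 _] := HC _ Lf2; have [j2 _] := HC _ Lg2.
have i1 := eweight_hL2 gamma Lf1; have i2 := eweight_hL2 gamma Lg1.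
rewrite /hK.
rewrite (eq_cint (g := fun x => c * (eweight gamma x * f1 x) + eweight gamma x * g1 x)); last first.
  by move=> x _; ring.
rewrite cintD//; last exact: cintegrableZ.
rewrite cintZ//.
rewrite [X in _ + X = _](eq_cint (g := fun x => c * ((v x)%:C * cexp (- (2 * gamma * x%:C) - (u x)%:C) *
     \cint_(t in `[0, x]) (cexp (gamma * t%:C) * f2 t)) +
     (v x)%:C * cexp (- (2 * gamma * x%:C) - (u x)%:C) *
     \cint_(t in `[0, x]) (cexp (gamma * t%:C) * g2 t))); last first.
  move=> x _.
  rewrite (eq_cint (g := fun t => c * (cexp (gamma * t%:C) * f2 t) + cexp (gamma * t%:C) * g2 t)).
    rewrite cintD//; [|by apply: cintegrableZ => //; exact: cexpM_loc|exact: cexpM_loc].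
    by rewrite cintZ//; [ring|exact: cexpM_loc].
  by move=> t _; ring.
rewrite cintD//; last exact: cintegrableZ.
by rewrite cintZ// mulrDr addrACA.
Qed.

Let eqW (x y : R) : x = y -> x <= y. Proof. by move=> ->. Qed.

Let alg1 (a b c : R[i]) : a - b - (a - c) = c - b. Proof. by ring. Qed.
Let alg2 (a b c : R[i]) : a + b - (a + c) = - (c - b). Proof. by ring. Qed.

Let alg3 (a b : R[i]) : - (a + b) + a = - b. Proof. by ring. Qed.

Lemma eweightK gamma (x : R) : cexp (gamma * x%:C + (u x)%:C) * eweight gamma x = 1.
Proof. by rewrite -cexpD -cexp0; congr cexp; ring. Qed.

Lemma eweightKV gamma (x : R) : cexp (- (- (gamma * x%:C) - (u x)%:C)) =
  cexp (gamma * x%:C + (u x)%:C).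
Proof. by congr cexp; ring. Qed.

Lemma eweight0 gamma : eweight gamma 0 = 1.
Proof. by rewrite /eweight u0 mulr0 subr0 oppr0 cexp0. Qed.

Lemma hsys_diff gamma h1 h2 p q : hsys gamma h1 h2 p q ->
  prim halfline (fun x => q x - p x)
    (fun x => (2 * gamma * p x - h1 x - h2 x) - (- gamma - (v x)%:C) * (q x - p x)).
Proof.
move=> [Pp Pq].
apply: (eq_prim (@halfline_interval R) _ _ (primB Pq Pp)) => // x _; ring.
Qed.

Lemma hq_prim gamma s q : (forall x, 0 <= x -> cintegrable `[0, x] s) ->
  prim halfline q (fun x => s x - (- gamma - (v x)%:C) * q x) <->
  forall x, 0 <= x -> q x = cexp (gamma * x%:C + (u x)%:C) *
    (q 0 + cint `[0, x] (fun t => eweight gamma t * s t)).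
Proof.
move=> si; rewrite (linear_odeP q (cderiv_wq gamma) (ccont_wq' gamma) si).
by split=> H x x0; rewrite [LHS]H// eweightKV -/(eweight gamma 0) eweight0 mul1r.
Qed.

(** The system is triangular: the equation for p does not involve q, and once p is known the
    equation for q is linear of order one. *)
Lemma hsysP gamma h1 h2 p q : hL2 h1 -> hL2 h2 ->
  hsys gamma h1 h2 p q <->
  (forall x, 0 <= x -> p x = hp gamma (p 0) h2 x) /\
  (forall x, 0 <= x -> q x = hq gamma (q 0) (p 0) h1 h2 x).
Proof.
move=> L1 L2.
have l2 x : 0 <= x -> cintegrable `[0, x] h2 by move=> _; exact: hL2_loc.
have E : (forall x, 0 <= x -> p x = hp gamma (p 0) h2 x) ->
  prim halfline q (fun x => (gamma + (v x)%:C) * q x - (v x)%:C * p x - h1 x) <->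
  (forall x, 0 <= x -> q x = hq gamma (q 0) (p 0) h1 h2 x).
  move=> pE.
  have Pp : prim halfline p (fun x => - gamma * p x + h2 x) by apply/hpP.
  (* The source of the equation for q. Its local integrability is that of h1 and of v p, where v is
     continuous and p is an exponential times a locally bounded primitive; against [eweight] it is
     the opposite of [hr]. *)
  pose s x := - (h1 x + (v x)%:C * p x).
  have mp := prim_meas_halfline Pp.
  have si x : 0 <= x -> cintegrable `[0, x] s.
    move=> x0; apply: cintegrableN => //; apply: cintegrableD => //; first exact: hL2_loc.
    apply: cintegrableM_cont; first exact: ccont_real.
    have h0 : halfline 0 by apply/halflineP.
    have hx : halfline x by apply/halflineP.
    apply: (@eq_cintegrable _ _ (hp gamma (p 0) h2)) => //.
      by move=> t; rewrite inE /= in_itv/= => /andP[t0 _]; rewrite -pE.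
    apply: cintegrableM_cont; first by apply: ccont_cexp; apply: ccontN; exact: ccont_lin.
    have Pi : prim halfline (fun x => p 0 + cint `[0, x] (fun t => cexp (gamma * t%:C) * h2 t))
       (fun t => cexp (gamma * t%:C) * h2 t).
      move=> a b /halflineP a0 /halflineP b0 ab.
      have ib : cintegrable `[0, b] (fun t => cexp (gamma * t%:C) * h2 t).
        by apply: cintegrableM_cont; [apply: ccont_cexp; exact: ccont_lin|exact: l2].
      split; first by apply: cintegrable_itvS ib.
      by rewrite (cint_split a0 ab ib) opprD addrACA subrr add0r [cint _ _ + _]addrC addrK.
    have [P1 P2] := (primP _ _ _).1 Pi.
    have fin : (mu (`[0%R, x]%classic : set R) < +oo)%E.
      by rewrite /= lebesgue_measure_itv/=; case: ifP => // _; rewrite ltry.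
    split; apply: measurable_bounded_integrable => //.
    - exact: (rprim_measurable (@halfline_interval R) P1 h0 hx).
    - have [M HM] := rprim_bounded (@halfline_interval R) P1 h0 hx.
      exists M; split; first exact: num_real.
      by move=> b Mb z; rewrite /= in_itv/= => zx; apply: le_trans (ltW Mb); exact: HM.
    - exact: (rprim_measurable (@halfline_interval R) P2 h0 hx).
    - have [M HM] := rprim_bounded (@halfline_interval R) P2 h0 hx.
      exists M; split; first exact: num_real.
      by move=> b Mb z; rewrite /= in_itv/= => zx; apply: le_trans (ltW Mb); exact: HM.
  rewrite (_ : (fun x => _) = (fun x => s x - (- gamma - (v x)%:C) * q x)); last first.
    by apply/funext => x; rewrite /s; ring.
  rewrite (hq_prim gamma q si).
  have Es x : 0 <= x -> cint `[0, x] (fun t => eweight gamma t * s t) =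
      - cint `[0, x] (hr gamma (p 0) h1 h2).
    move=> x0; rewrite -cintN//; last first.
      apply: (@eq_cintegrable _ _ (fun t => - (eweight gamma t * s t))) => //.
        move=> t; rewrite inE /= in_itv/= => /andP[t0 _].
        rewrite /s /hr -mulrN opprK pE// /hp; congr (_ * (_ + _)); exact: mulrA.
      by apply: cintegrableN => //; apply: cintegrableM_cont; [exact: ccont_eweight|exact: si].
    apply: eq_cint => t; rewrite inE /= in_itv/= => /andP[t0 _].
    by rewrite /s /hr pE// /hp mulrN; congr (- (_ * (_ + _))); exact: mulrA.
  by split=> H x x0; rewrite [LHS]H// /hq Es.
split=> [[H1 H2]|[H1 H2]].
  have H1' := (hpP gamma p l2).1 H1.
  by split=> //; apply: (E H1').1.
by split; [exact: (hpP gamma p l2).2|exact: (E H1).2].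
Qed.

Lemma limit_zero_of_weighted gamma f : hL2 f -> forall l,
  (forall e : R, 0 < e -> exists X, forall x, X <= x ->
     normc (eweight gamma x * f x - l) <= e) -> l = 0.
Proof.
move=> fL l H; apply: (cintegrable_limit0 (eweight_hL2 gamma fL)) => e e0.
exact: H.
Qed.

(* The function e^{-gamma x - u} q tends to q 0 - (hK + hpsi * p 0) and is
   integrable when q is in L^2(e^{-u}), which forces this limit to be 0. *)
Lemma hsys_hL2 gamma : exists C, 0 <= C /\ forall h1 h2 p q,
  hL2 h1 -> hL2 h2 -> hsys gamma h1 h2 p q ->
  [/\ hL2 p, hnrm p <= C * (normc (p 0) ^+ 2 + hnrm h2),
      hL2 q <-> q 0 = hK gamma h1 h2 + hpsi gamma * p 0 &
      hL2 q -> hnrm q <= C * (normc (p 0) ^+ 2 + hnrm h1 + hnrm h2)].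
Proof.
have [C1 [C10 HC1]] := hp_hL2 gamma.
have [C2 [C20 HC2]] := tail_rL2 uv (Re gamma).
pose g2 := normc (2 * gamma) ^+ 2.
have g20 : 0 <= g2 by exact: sqr_ge0.
(* Obtained by inserting the bounds of p (constant C1) and of the source s into that of q = d + p.
   Each sum of two functions costs a factor 2, so the worst term passes through three of them. *)
exists (2 * C1 + 8 * C2 * (1 + g2 * C1)); split.
  by rewrite addr_ge0 ?mulr_ge0// addr_ge0// mulr_ge0.
move=> h1 h2 p q L1 L2 S.
have [pE qE] := (hsysP gamma p q L1 L2).1 S.
have [Pp Pq] := S.
have mp := prim_meas_halfline Pp; have mq := prim_meas_halfline Pq.
have [hpL hpn] := HC1 (p 0) h2 L2.
have E1 x : 0 <= x -> normc (p x) ^+ 2 * expR (- u x) = normc (hp gamma (p 0) h2 x) ^+ 2 * expR (- u x).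
  by move=> x0; rewrite -pE.
have [_ hpi] := hpL.
have [pL pn'] := hL2_le mp (fun x x0 => eqW (E1 x x0)) hpi.
rewrite -/(rnrm u _) -/(hnrm _) in pn'.
have pn := le_trans pn' hpn.
set N1 := hnrm h1; set N2 := hnrm h2 in hpn pn *; set K := normc (p 0) ^+ 2 in hpn pn *.
have N10 : 0 <= N1 by exact: rnrm_ge0.
have N20 : 0 <= N2 by exact: rnrm_ge0.
have K0 : 0 <= K by exact: sqr_ge0.
have Np0 : 0 <= hnrm p by exact: rnrm_ge0.
pose s x := 2 * gamma * p x - h1 x - h2 x.
have [L2g n2g] := hL2Z (2 * gamma) pL.
have [N1L n1g] := hL2Z (-1) L1.
have [N2L n22g] := hL2Z (-1) L2.
have normN1 : normc (-1 : R[i]) ^+ 2 = 1 :> R.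
  by rewrite normcN normc_sq /= expr1n expr0n addr0.
rewrite normN1 [leRHS]mul1r in n1g; rewrite normN1 [leRHS]mul1r in n22g.
have [A1 a1] := hL2D L2g N1L.
have [A2 a2] := hL2D A1 N2L.
have sE : s = (fun x => 2 * gamma * p x + -1 * h1 x + -1 * h2 x).
  by apply/funext => x; rewrite /s !mulN1r.
have sL : hL2 s by rewrite sE.
have sn : hnrm s <= 2 * (2 * (g2 * hnrm p + N1) + N2).
  rewrite sE; apply: (le_trans a2); rewrite ler_wpM2l//; apply: (lerD _ n22g).
  by apply: (le_trans a1); rewrite ler_wpM2l//; exact: (lerD n2g n1g).
have sl x : 0 <= x -> cintegrable `[0, x] s by move=> _; exact: hL2_loc.
pose d x := q x - p x.
have Pd := hsys_diff S.
have dE := (hq_prim gamma d sl).1 Pd.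
have md : cmeas halfline d := prim_meas_halfline Pd.
have es := eweight_hL2 gamma sL.
have ri := hr_cintegrable gamma (p 0) L1 L2.
have eq0E x : 0 <= x -> eweight gamma x * q x = q 0 - cint `[0, x] (hr gamma (p 0) h1 h2).
  by move=> x0; rewrite qE// /hq mulrA [eweight _ _ * _]mulrC eweightK mul1r.
have ed x : 0 <= x -> eweight gamma x * d x = d 0 + cint `[0, x] (fun t => eweight gamma t * s t).
  by move=> x0; rewrite dE// mulrA [eweight _ _ * _]mulrC eweightK mul1r.
set kap := cint halfline (hr gamma (p 0) h1 h2).
set sig := cint halfline (fun t => eweight gamma t * s t).
have limq (e : R) : 0 < e -> exists2 X, 0 <= X & forall x, X <= x ->
    normc (eweight gamma x * q x - (q 0 - kap)) <= e.
  move=> e0; have [X X0 HX] := cint_tail ri e0; exists X => // x Xx.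
  rewrite eq0E; last exact: le_trans Xx.
  by rewrite alg1; exact: HX.
have limd (e : R) : 0 < e -> exists2 X, 0 <= X & forall x, X <= x ->
    normc (eweight gamma x * d x - (d 0 + sig)) <= e.
  move=> e0; have [X X0 HX] := cint_tail es e0; exists X => // x Xx.
  rewrite ed; last exact: le_trans Xx.
  by rewrite alg2 normcN; exact: HX.
(* The weighted q and d both have limits at infinity. Their difference e^{-gamma x - u} p is
   integrable because p is square integrable, so the two limits agree. *)
have lim0 : (q 0 - kap) - (d 0 + sig) = 0.
  apply: (limit_zero_of_weighted pL (gamma := gamma)) => e e0.
  have e2 : 0 < e / 2 by rewrite divr_gt0.
  have [X X0 HX] := limq _ e2; have [Y Y0 HY] := limd _ e2.
  exists (Num.max X Y) => x; rewrite ge_max => /andP[Xx Yx].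
  have -> : eweight gamma x * p x - (q 0 - kap - (d 0 + sig)) =
     (eweight gamma x * q x - (q 0 - kap)) + - (eweight gamma x * d x - (d 0 + sig)).
    rewrite /d mulrBr; move: (eweight gamma x * q x) (eweight gamma x * p x).
    by move: (q 0 - kap) (q 0 - p 0 + sig) => z1 z2 z3 z4; ring.
  apply: (le_trans (normc_leD _ _)); rewrite normcN (splitr e).
  by apply: lerD; [exact: HX|exact: HY].
have kapE : kap = hK gamma h1 h2 + hpsi gamma * p 0 by exact: cint_hr.
have iff1 : hL2 q -> q 0 = kap.
  move=> qL; apply/eqP; rewrite -subr_eq0; apply/eqP.
  apply: (limit_zero_of_weighted qL (gamma := gamma)) => e e0.
  by have [X _ HX] := limq e e0; exists X.
(* Under this condition both limits vanish, hence d 0 = - sig and d is minus the integral of its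
   weighted source over [x, +oo[, multiplied by e^{gamma x + u}. This is the form to which
   [tail_rL2] applies; q is recovered as d + p. *)
have iff2 : q 0 = kap -> hL2 q /\ hnrm q <= 2 * (C2 * hnrm s + hnrm p).
  move=> qk; rewrite qk subrr sub0r in lim0.
  have d0 : d 0 = - sig by apply/eqP; rewrite -addr_eq0 -oppr_eq0 lim0.
  have dB x : 0 <= x -> normc (d x) <= 2 * (expR (Re gamma * x + u x) *
     \int[mu]_(t in `[x, +oo[) (expR (- (Re gamma * t) - u t) * normc (s t))).
    move=> x0; rewrite dE// d0 normcM normc_cexp cReD Re_lin [Re (u x)%:C]/= [leRHS]mulrCA.
    rewrite ler_wpM2l ?expR_ge0//.
    rewrite /sig (cint_splity x0 es) alg3 normcN.
    have esx := cintegrable_halflineSy x0 es.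
    apply: (le_trans (normc_cint_le _ esx)) => //.
    rewrite le_eqVlt; apply/orP; left; apply/eqP; congr (_ * _).
    by apply: eq_Rintegral => t _; rewrite normcM normc_eweight mulNr.
  have [dL dn] := HC2 _ (fun x => normc (d x)) (hL2_rL2 sL) (fun x _ => normc_ge0 _)
    (cmeas_normc md) (fun x x0 => le_trans (eqW (ger0_norm (normc_ge0 _))) (dB x x0)).
  have dL' : hL2 d by split => //; case: dL.
  have [qL qn] := hL2D dL' pL.
  have qdp : q = (fun x => d x + p x) by apply/funext => x; rewrite /d subrK.
  rewrite qdp; split=> //; apply: (le_trans qn); rewrite ler_wpM2l// lerD//.
split; first exact: pL.
- apply: (le_trans pn).
  have := mulr_ge0 C20 (addr_ge0 ler01 (mulr_ge0 g20 C10)).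
  move=> z0; rewrite ler_wpM2r ?addr_ge0//.
  rewrite mulr_natl mulr2n -addrA lerDl addr_ge0// -mulrA mulr_ge0//.
- split=> [qL|e]; first exact: etrans (iff1 qL) kapE.
  by apply: (iff2 _).1; exact: (etrans e (esym kapE)).
move=> /iff1/iff2[_ qn]; apply: (le_trans qn).
have c1 : C2 * hnrm s <= C2 * (2 * (2 * (g2 * hnrm p + N1) + N2)) by rewrite ler_wpM2l.
have c2 : C2 * (g2 * hnrm p) <= C2 * (g2 * (C1 * (K + N2))).
  by rewrite !ler_wpM2l.
have c3 : 0 <= C2 * (g2 * (C1 * N1)) by do 3 apply: mulr_ge0 => //.
have c4 := mulr_ge0 C20 N20; have c5 := mulr_ge0 C20 N10; have c6 := mulr_ge0 C20 K0.
have c7 := mulr_ge0 C10 N10.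
move: pn c1 c2 c3 c4 c5 c6 c7; clear.
move: (hnrm p) (hnrm s) => x1 x2; lra.
Qed.

Lemma eweight_real (x : R) : eweight 0 x = (expR (- u x))%:C.
Proof. by rewrite /eweight mul0r oppr0 sub0r -cexpR raddfN. Qed.

Lemma hL2_dot p q : hL2 p -> hL2 q ->
  cintegrable halfline (fun x => p x * conjc (q x) * (expR (- u x))%:C).
Proof.
move=> [mp pi] [mq qi].
have i := integrableD mH pi qi.
apply: (le_cintegrable mH _ _ i).
  apply: cmeasM; first by apply: cmeasM => //; exact: cmeas_conj.
  rewrite -(funext eweight_real); apply: ccont_meas => //; exact: ccont_eweight.
move=> x _ /=; rewrite !normcM normc_conj normcR (ger0_norm (expR_ge0 _)) -mulrDl.
rewrite ler_wpM2r ?expR_ge0//.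
move: (normc (p x)) (normc (q x)) => a b; have := sqr_ge0 (a - b); nra.
Qed.

(** The density of the inner product of F f1 with f2 on one half-line: flipping the velocity pairs
    p1 with q2 and q1 with p2. *)
Definition hdot p1 q1 p2 q2 (x : R) : R[i] :=
  (p1 x * conjc (q2 x) + q1 x * conjc (p2 x)) * (expR (- u x))%:C.

Lemma hdot_cintegrable p1 q1 p2 q2 : hL2 p1 -> hL2 q1 -> hL2 p2 -> hL2 q2 ->
  cintegrable halfline (hdot p1 q1 p2 q2).
Proof.
move=> P1 Q1 P2 Q2; apply: eq_cintegrable (cintegrableD mH (hL2_dot P1 Q2) (hL2_dot Q1 P2)) => //.
by move=> x _; rewrite /hdot mulrDl.
Qed.

(* W = (p1 conj q2 - q1 conj p2) e^{-u} satisfies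
   W' = (conj gamma2 - gamma1) * hdot; being integrable, it vanishes at +oo. *)
Lemma hwronskian gamma1 gamma2 p1 q1 p2 q2 :
  hsys gamma1 (fun=> 0) (fun=> 0) p1 q1 -> hsys gamma2 (fun=> 0) (fun=> 0) p2 q2 ->
  hL2 p1 -> hL2 q1 -> hL2 p2 -> hL2 q2 ->
  (conjc gamma2 - gamma1) * cint halfline (hdot p1 q1 p2 q2) =
  q1 0 * conjc (p2 0) - p1 0 * conjc (q2 0).
Proof.
move=> [sp1 sq1] [sp2 sq2] P1 Q1 P2 Q2.
have Si := hdot_cintegrable P1 Q1 P2 Q2.
set S := hdot _ _ _ _ in Si *; set c := conjc gamma2 - gamma1.
pose W x := (p1 x * conjc (q2 x) - q1 x * conjc (p2 x)) * eweight 0 x.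
have iH := @halfline_interval R.
have cjD (a b : R[i]) : conjc (a + b) = conjc a + conjc b by case: a => ? ?; case: b => ? ?; apply: complexP; rewrite /= ?opprD.
have cjM (a b : R[i]) : conjc (a * b) = conjc a * conjc b.
  by case: a => ? ?; case: b => ? ?; apply: complexP; rewrite /=; ring.
have cjN (a : R[i]) : conjc (- a) = - conjc a by case: a.
have cjR (a : R) : conjc (a%:C) = a%:C by apply: complexP; rewrite /= ?oppr0.
(* The two terms v p1 conj(p2) cancel each other, and the remaining v W is cancelled by the
   derivative of the weight. *)
have PW : prim halfline W (fun x => c * S x).
  have Pe : prim halfline (eweight 0) (fun x => (- 0 - (v x)%:C) * eweight 0 x).
    apply: primS (subsetT halfline) _; apply: prim_cderiv; first exact: (cderiv_cexp (cderiv_wq 0)).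
    by apply: ccontM; [exact: ccont_wq'|exact: ccont_eweight].
  have PB := primB (primM iH sp1 (prim_conj sq2)) (primM iH sq1 (prim_conj sp2)).
  apply: (eq_prim iH _ _ (primM iH PB Pe)) => // x _.
  rewrite /S /hdot -eweight_real /c oppr0 sub0r; cbv beta.
  rewrite !(cjD, cjM, cjN, cjR); have -> : 0%:C = 0 :> R[i] by [].
  move: (conjc gamma2) (conjc (q2 x)) (conjc (p2 x)) (eweight 0 x) (p1 x) (q1 x) ((v x)%:C).
  by move=> a1 a2 a3 a4 a5 a6 a7; ring.
have W0 : W 0 = p1 0 * conjc (q2 0) - q1 0 * conjc (p2 0).
  by rewrite /W eweight_real u0 oppr0 expR0 mulr1.
have Wi : cintegrable halfline W.
  apply: eq_cintegrable (cintegrableB mH (hL2_dot P1 Q2) (hL2_dot Q1 P2)) => //.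
  by move=> x _; rewrite /W eweight_real mulrBl.
suff : W 0 + c * cint halfline S = 0.
  by rewrite W0 => /eqP; rewrite addrC addr_eq0 => /eqP ->; rewrite opprB.
apply: (cintegrable_limit0 Wi) => e e0.
(* The added 1 keeps the denominator positive when c = 0. *)
have [|X X0 HX] := cint_tail (e := e / (normc c + 1)) Si.
  by rewrite divr_gt0// ltr_wpDl// normc_ge0.
exists X => x Xx; have x0 := le_trans X0 Xx.
have c1 : 0 < normc c + 1 by rewrite ltr_wpDl// normc_ge0.
have [_ eW] := PW 0 x ((halflineP 0).2 (lexx 0)) ((halflineP x).2 x0) x0.
rewrite cintZ// in eW; last exact: cintegrable_halflineS Si.
have -> : W x - (W 0 + c * cint halfline S) = - (c * (cint halfline S - cint `[0, x] S)).
  by rewrite opprD addrA eW; move: (cint _ _) (cint _ _) => z1 z2; ring.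
rewrite normcN normcM; have := HX x Xx.
rewrite ler_pdivlMr// => H; apply: le_trans H; rewrite mulrC ler_wpM2l ?normc_ge0//.
by rewrite lerDl.
Qed.

End HalfLineSystem.

(** * Weak derivatives *)

Section Bump.
Context {R : realType}.
Local Notation mu := (@lebesgue_measure R).
Implicit Types (f g : R -> R) (q : {poly R}).

(** Serves at the endpoints 0 and 1 of the bump: quadratic flatness makes the difference quotient,
    extended by 0 at a, continuous there. *)
Lemma is_derive_quadratic f (a C : R) :
  (forall y, `|f y| <= C * `|y - a| ^+ 2) -> is_derive a 1 f 0.
Proof.
move=> H; have fa : f a = 0.
  by apply/eqP; rewrite -normr_le0; apply: le_trans (H a) _; rewrite subrr normr0 expr0n mulr0.
apply/is_derive1_caratheodory; exists (fun z => if z == a then 0 else f z / (z - a)).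
split; last by rewrite eqxx.
  move=> z; case: eqP => [->|/eqP za]; first by rewrite !subrr mulr0.
  by rewrite fa subr0 mulfVK// subr_eq0.
rewrite /prop_for /continuous_at eqxx; apply/cvgrPdist_le => e e0.
have C0 : 0 <= `|C| + 1 by rewrite addr_ge0.
have C1 : 0 < `|C| + 1 by rewrite ltr_wpDl.
near=> z; rewrite sub0r normrN; case: eqP => [_|/eqP za]; first by rewrite normr0 ltW.
have za0 : 0 < `|z - a| by rewrite normr_gt0 subr_eq0.
rewrite normrM normfV ler_pdivrMr//; apply: (le_trans (H z)).
rewrite expr2 mulrA ler_wpM2r//.
apply: (@le_trans _ _ ((`|C| + 1) * `|z - a|)).
  by rewrite ler_wpM2r// (le_trans (ler_norm _))// lerDl.
rewrite mulrC -ler_pdivlMr//; near: z.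
apply/nbhs_ballP; exists (e / (`|C| + 1)) => /=; first exact: divr_gt0.
by move=> z /=; rewrite /ball/= distrC => /ltW.
Unshelve. all: by end_near. Qed.

Definition tpoly : {poly R} := 'X * (1 - 'X).

Lemma tpolyE x : tpoly.[x] = x * (1 - x).
Proof. by rewrite /tpoly !hornerE. Qed.

(* Closed under differentiation, see [is_derive_bumpq]. *)
Definition bumpq q k (x : R) : R := if 0 < x < 1 then
  q.[x] * tpoly.[x]^-1 ^+ k * expR (- tpoly.[x]^-1) else 0.

(** With t = [tpoly], the derivative of q t^{-k} e^{-1/t} is t^{-(k+2)} e^{-1/t} times this
    polynomial. *)
Definition bumpq' q k : {poly R} :=
  q^`() * tpoly ^+ 2 - k%:R *: (q * tpoly^`() * tpoly) + q * tpoly^`().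

Lemma bumpq'E q k x : (bumpq' q k).[x] = q^`().[x] * tpoly.[x] ^+ 2 -
  k%:R * (q.[x] * tpoly^`().[x] * tpoly.[x]) + q.[x] * tpoly^`().[x].
Proof. by rewrite /bumpq'; move: tpoly => T; rewrite !hornerE. Qed.

Lemma poly_bounded01 q : exists M, forall x, 0 < x < 1 -> `|q.[x]| <= M.
Proof.
have [M HM] := @cont_bounded _ (horner q) 0 1 (@continuous_horner R q).
by exists M => x /andP[/ltW x0 /ltW x1]; apply: HM; rewrite x0 x1.
Qed.

Lemma tpoly_gt0 x : 0 < x < 1 -> 0 < tpoly.[x].
Proof. by move=> /andP[x0 x1]; rewrite tpolyE mulr_gt0// subr_gt0. Qed.

(** The term of degree k + 2 of the exponential series at 1/t. Two powers of t are left over, enough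
    for differentiability with derivative 0 where t vanishes. *)
Lemma exp_flat k (t : R) : 0 < t -> t^-1 ^+ k * expR (- t^-1) <= (k.+2)`!%:R * t ^+ 2.
Proof.
move=> t0; have s0 : 0 < t^-1 by rewrite invr_gt0.
have f0 : 0 < (k.+2)`!%:R :> R by rewrite ltr0n fact_gt0.
have e1 : t^-1 ^+ k.+2 <= (k.+2)`!%:R * expR t^-1.
  rewrite mulrC -ler_pdivrMr//; apply: le_trans (expR_ge1Dxn k.+1 (ltW s0)).
  by rewrite lerDr.
rewrite expRN ler_pdivrMr ?expR_gt0// mulrAC.
have -> : t^-1 ^+ k = t^-1 ^+ k.+2 * t ^+ 2.
  by rewrite -addn2 exprD -mulrA -exprMn mulVf ?gt_eqF// expr1n mulr1.
by rewrite ler_wpM2r// exprn_ge0// ltW.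
Qed.

Lemma bumpq_quadratic q k : exists C, forall x, forall a, a = 0 \/ a = 1 ->
  `|bumpq q k x| <= C * `|x - a| ^+ 2.
Proof.
have [M HM] := poly_bounded01 q.
have M0 : 0 <= M by apply: le_trans (HM (1 / 2) _) => //; apply/andP; split; lra.
exists (M * (k.+2)`!%:R) => x a a01; rewrite /bumpq; case: ifPn => x01; last first.
  by rewrite normr0 mulr_ge0 ?sqr_ge0 ?mulr_ge0.
have t0 := tpoly_gt0 x01.
rewrite -mulrA normrM -mulrA; apply: ler_pM => //; first exact: HM.
rewrite ger0_norm; last by rewrite mulr_ge0 ?expR_ge0 ?exprn_ge0 ?invr_ge0 ?ltW.
apply: (le_trans (exp_flat k t0)).
rewrite ler_wpM2l//; rewrite ler_pXn2r// ?nnegrE ?(ltW t0)//.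
rewrite tpolyE; case/andP: x01 => x0 x1.
case: a01 => ->.
  rewrite subr0 gtr0_norm//; nra.
rewrite ltr0_norm ?subr_lt0//; nra.
Qed.

(** Outside [0, 1] the function vanishes locally, at 0 and at 1 it is quadratically flat, and inside
    the rules of calculus apply. *)
Lemma is_derive_bumpq q k (x : R) :
  is_derive x 1 (bumpq q k.+1) (bumpq (bumpq' q k.+1) k.+3 x).
Proof.
have out (y : R) : ~~ (0 <= y <= 1) -> is_derive y 1 (bumpq q k.+1) 0.
  move=> yo; apply: (@near_eq_is_derive _ _ _ (cst (0 : R))).
  have yo' : (~` `[(0:R), 1]%classic) y by rewrite /= in_itv/=; exact/negP.
  have op : open (~` `[(0:R), 1]%classic).
    by apply: closed_openC; exact: interval_closed.
  have := open_nbhs_nbhs (conj op yo').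
  apply: filterS => z; rewrite /= in_itv/= /bumpq => zo.
  by rewrite ifF//; apply/negP => /andP[z0 z1]; apply: zo; rewrite !ltW.
rewrite [X in is_derive _ _ _ X]/bumpq; case: ifPn => [x01|x01]; last first.
  have [C HC] := bumpq_quadratic q k.+1.
  have [->|x0] := eqVneq x 0; first by apply: is_derive_quadratic => y; apply: HC; left.
  have [->|x1] := eqVneq x 1; first by apply: is_derive_quadratic => y; apply: HC; right.
  apply: out; apply: contra x01 => /andP[x0' x1'].
  by rewrite !lt_neqAle eq_sym x0 x1 x0' x1'.
have t0 := tpoly_gt0 x01.
have tn0 : tpoly.[x] != 0 by rewrite gt_eqF.
have ds := is_deriveV tn0 (is_derive_poly tpoly x).
have dsk : is_derive x 1 (fun z => tpoly.[z]^-1 ^+ k.+1)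
    ((k.+1%:R * tpoly.[x]^-1 ^+ k) *: (- tpoly.[x] ^- 2 *: tpoly^`().[x])).
  rewrite (_ : (fun z => _) = (fun y => tpoly.[y]^-1) ^+ k.+1); last first.
    by apply/funext => z; rewrite fctE.
  exact: is_deriveX.
have de := @is_derive1_comp _ expR _ x _ _ (is_derive_expR _) (is_deriveN ds).
have D := is_deriveM (is_deriveM (is_derive_poly q x) dsk) de.
set s := tpoly.[x]^-1; set e := expR (- s); set t' := tpoly^`().[x].
have D' : is_derive x 1 (fun z => q.[z] * tpoly.[z]^-1 ^+ k.+1 * expR (- tpoly.[z]^-1))
    (q.[x] * s ^+ k.+1 * (e * (- (- tpoly.[x] ^- 2 * t'))) +
     e * (q.[x] * (k.+1%:R * s ^+ k * (- tpoly.[x] ^- 2 * t')) + s ^+ k.+1 * q^`().[x])).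
  exact: D.
apply: near_eq_is_derive; last first.
  apply: (is_derive_eq D').
  rewrite bumpq'E -/t' -exprVn -/s !exprS.
  have st : tpoly.[x] * s = 1 by rewrite mulfV.
  move: (tpoly.[x]) st => t st; move: (s ^+ k) => sk.
  rewrite [RHS](_ : _ = q^`().[x] * (t * s) * (t * s) * (s * sk) * e -
    k.+1%:R * q.[x] * t' * (t * s) * (s * s * sk) * e + q.[x] * t' * (s * s * s * sk) * e).
    by rewrite st; ring.
  by ring.
have op : open (`]0%R, 1%R[%classic : set R) by exact: interval_open.
have xin : (`]0%R, 1%R[%classic : set R) x by rewrite /= in_itv.
have := open_nbhs_nbhs (conj op xin).
apply: filterS => z; rewrite /= in_itv/= /bumpq => ->.
by [].
Qed.

Definition smooth f : Prop := forall n x, derivable (derive1n n f) x 1.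

(** Smoothness by an invariant class of functions, which replaces any formula for the n-th
    derivative. *)
Lemma smooth_coind (P : (R -> R) -> Prop) f :
  (forall g, P g -> (forall x : R, derivable g x 1) /\ P (derive1 g)) -> P f -> smooth f.
Proof.
move=> H + n; elim: n f => [|n IH] f Pf x.
  by have [] := H f Pf.
by rewrite derive1Sn; apply: IH; have [] := H f Pf.
Qed.

Lemma smooth_derivable f x : smooth f -> derivable f x 1.
Proof. by move=> /(_ 0%N x). Qed.

Lemma smooth_derive1 f : smooth f -> smooth (derive1 f).
Proof. by move=> sf n x; rewrite -derive1Sn; exact: sf. Qed.

Lemma is_derive_derive1 f (x d : R) : is_derive x 1 f d -> derive1 f x = d.
Proof. by move=> fd; rewrite derive1E (@derive_val _ _ _ _ _ _ _ fd). Qed.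

Lemma derivable_is_derive f (x : R) : derivable f x 1 -> is_derive x 1 f (derive1 f x).
Proof. by move=> fd; rewrite derive1E; exact: derivableP. Qed.

Lemma smooth_bumpq q k : smooth (bumpq q k.+1).
Proof.
apply: (@smooth_coind (fun f => exists q k, f = bumpq q k.+1)); last by exists q, k.
move=> g [q' [k' ->]]; split=> [x|].
  exact: (@ex_derive _ _ _ _ _ _ _ (is_derive_bumpq q' k' x)).
exists (bumpq' q' k'.+1), k'.+2; apply/funext => x.
exact/is_derive_derive1/is_derive_bumpq.
Qed.

Lemma smooth_antiderivative f g : (forall x : R, is_derive x 1 f (g x)) ->
  smooth g -> smooth f.
Proof.
move=> fg sg [|n] x; first exact: (@ex_derive _ _ _ _ _ _ _ (fg x)).
rewrite derive1Sn (_ : derive1 f = g); first exact: sg.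
by apply/funext => y; exact/is_derive_derive1.
Qed.

Lemma is_derive_affine f (c a e d x : R) : is_derive ((x - a) / e) 1 f d ->
  is_derive x 1 (fun y => c * f ((y - a) / e)) (c * (d / e)).
Proof.
move=> fd.
have d1 : is_derive x 1 (fun y : R => (y - a) / e) e^-1.
  have -> : (fun y : R => (y - a) / e) = e^-1 *: ((id : R -> R) - cst a).
    by apply/funext => y; rewrite !fctE /GRing.scale/= mulrC.
  apply: is_derive_eq (is_deriveZ _ (is_deriveB (is_derive_id x 1) (is_derive_cst a x 1))) _.
  by rewrite /GRing.scale/= subr0 mulr1.
have d2 := is_deriveZ c (@is_derive1_comp _ f _ x _ _ fd d1).
exact: d2.
Qed.

Lemma smooth_affine f (c a e : R) : smooth f ->
  smooth (fun x => c * f ((x - a) / e)).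
Proof.
move=> sf; apply: (@smooth_coind (fun g => exists c f, smooth f /\
   g = (fun x => c * f ((x - a) / e)))); last by exists c, f.
move=> g [c' [f' [sf' ->]]].
have D x := is_derive_affine c' (derivable_is_derive (@smooth_derivable _ ((x - a) / e) sf')).
split=> [x|]; first exact: (@ex_derive _ _ _ _ _ _ _ (D x)).
exists (c' / e), (derive1 f'); split; first exact: smooth_derive1.
by apply/funext => x; rewrite (is_derive_derive1 (D x)) mulrA mulrAC.
Qed.

Lemma smoothB f g : smooth f -> smooth g -> smooth (fun x => f x - g x).
Proof.
move=> sf sg; apply: (@smooth_coind (fun h => exists f g, [/\ smooth f, smooth g &
   h = (fun x => f x - g x)])); last by exists f, g.
move=> h [f' [g' [sf' sg' ->]]].
have D x := is_deriveB (derivable_is_derive (@smooth_derivable _ x sf'))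
  (derivable_is_derive (@smooth_derivable _ x sg')).
split=> [x|]; first exact: (@ex_derive _ _ _ _ _ _ _ (D x)).
exists (derive1 f'), (derive1 g'); split; try exact: smooth_derive1.
by apply/funext => x; rewrite (is_derive_derive1 (D x)).
Qed.

(** The numerator [tpoly] cancels the exponent 1, the smallest exponent covered by [smooth_bumpq];
    what remains on ]0, 1[ is e^{-1/(x(1-x))}. *)
Definition bumpf : R -> R := bumpq tpoly 1.

Lemma bumpE x : bumpf x = if 0 < x < 1 then expR (- (x * (1 - x))^-1) else 0.
Proof.
rewrite /bumpf /bumpq; case: ifPn => // x01.
by have t0 := tpoly_gt0 x01; rewrite expr1 mulfV ?gt_eqF// mul1r tpolyE.
Qed.

Lemma bump_ge0 x : 0 <= bumpf x.
Proof. by rewrite bumpE; case: ifP => // _; exact: expR_ge0. Qed.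

Lemma bump_le1 x : bumpf x <= 1.
Proof.
rewrite bumpE; case: ifPn => // /andP[x0 x1]; rewrite -[leRHS]expR0 ler_expR oppr_le0 invr_ge0.
by rewrite mulr_ge0 ?subr_ge0 ?(ltW x0) ?(ltW x1).
Qed.

Lemma bump_out x : ~~ (0 < x < 1) -> bumpf x = 0.
Proof. by rewrite bumpE => /negbTE ->. Qed.

Lemma smooth_bump : smooth bumpf. Proof. exact: smooth_bumpq. Qed.

Lemma smooth_continuous f : smooth f -> continuous f.
Proof.
move=> sf x; apply/differentiable_continuous/derivable1_diffP.
exact: smooth_derivable.
Qed.

Definition bump_mass : R := \int[mu]_(t in `[0, 1]) bumpf t.

Lemma bump_mass_gt0 : 0 < bump_mass.
Proof.
have cb := smooth_continuous smooth_bump.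
have bi (a b : R) : mu.-integrable `[a, b] (EFin \o bumpf).
  apply: continuous_compact_integrable; first exact: segment_compact.
  exact: continuous_subspaceT.
have q1 : (0 : R) <= 1 / 4 by lra.
have q2 : 1 / 4 <= (1 : R) by lra.
have q3 : 1 / 4 <= 3 / 4 :> R by lra.
have q4 : 3 / 4 <= 1 :> R by lra.
rewrite /bump_mass (Rint_split q1 q2 (bi _ _)) (Rint_split q3 q4 (bi _ _)).
have p0 (a b : R) : 0 <= \int[mu]_(t in `[a, b]) bumpf t.
  by apply: Rintegral_ge0 => t _; exact: bump_ge0.
rewrite ltr_wpDl// ltr_pwDl//.
(* On [1/4, 3/4] one has t(1 - t) >= 3/16, hence the lower bound e^{-16/3}. *)
apply: (@lt_le_trans _ _ (\int[mu]_(t in `[1 / 4 : R, 3 / 4]) expR (- (16 / 3)))).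
  have E : lebesgue_measure (`[1 / 4 : R, 3 / 4]%classic : set R) = (1 / 2)%:E.
    rewrite lebesgue_measure_itv/= lte_fin ifT; last by lra.
    by congr EFin; lra.
  rewrite (Rintegral_cst mu)// mulr_gt0 ?expR_gt0//.
  by rewrite [X in fine X](_ : _ = (1 / 2)%:E)//= divr_gt0.
apply: le_Rintegral => //.
  apply: continuous_compact_integrable; first exact: segment_compact.
  by apply: continuous_subspaceT => z; exact: cvg_cst.
move=> t; rewrite /= in_itv/= => /andP[t1 t2].
have t01 : 0 < t < 1 by apply/andP; split; lra.
rewrite bumpE t01 ler_expR lerN2.
have t0 : 0 < t * (1 - t) by case/andP: t01 => ? ?; rewrite mulr_gt0// subr_gt0.
rewrite -[leLHS]mul1r ler_pdivrMr//; nra.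
Qed.

End Bump.

(** * Weak derivatives of real functions, mollifiers and Lebesgue points *)

Section RealWeakDerivative.
Context {R : realType}.
Local Notation mu := (@lebesgue_measure R).
Local Notation lmeasurable := (@measurable _ (measurableTypeR R)).
Implicit Types (f g w F phi : R -> R).

Lemma locally_integrable_itv w (x y : R) : locally_integrable setT w ->
  mu.-integrable `[x, y] (EFin \o w).
Proof.
move=> [mw _ lw]; apply/integrableP; split.
  by apply/measurable_EFinP; exact: measurable_funTS.
by apply: lw => //; exact: segment_compact.
Qed.

(** The integral of w oriented from 0 to x: the primitive of w that vanishes at 0. *)
Definition rop w (x : R) : R := if 0 <= x then \int[mu]_(t in `[0, x]) w t
  else - \int[mu]_(t in `[x, 0]) w t.

Lemma rprim_rop w : (forall x y, mu.-integrable `[x, y] (EFin \o w)) ->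
  rprim setT (rop w) w.
Proof.
move=> wi x y _ _ xy; split=> //; rewrite /rop.
have [x0|x0] := leP 0 x.
  by rewrite (le_trans x0 xy) (Rint_split x0 xy (wi _ _)) addrAC subrr add0r.
have [y0|y0] := leP 0 y; last first.
  by rewrite (Rint_split xy (ltW y0) (wi _ _)) opprK addrC addrK.
by rewrite opprK addrC (Rint_split (ltW x0) y0 (wi _ _)).
Qed.

Lemma rop0 w : rop w 0 = 0.
Proof. by rewrite /rop lexx set_itv1 Rintegral_set1. Qed.

Lemma rprim_is_derive F w (x : R) : rprim setT F w -> continuous w -> is_derive x 1 F (w x).
Proof.
move=> FW cw.
have xx : x - 1 <= x + 1 by lra.
have [wi _] := FW _ _ I I xx.
have x1 : x < x + 1 by lra.
have x2 : x - 1 < x by lra.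
have [D1 D2] := continuous_FTC1_closed x1 wi x2 (cw x).
have D : is_derive x 1 (fun y => F (x - 1) + \int[mu]_(t in `[x - 1, y]) w t) (w x).
  have d0 := is_derive_cst (F (x - 1)) x 1.
  apply: is_derive_eq (is_deriveD d0 (derivable_is_derive D1)) _.
  by rewrite add0r D2.
apply: near_eq_is_derive D; near=> y.
have xy : x - 1 <= y by near: y; apply: lt_le_nbhsr; lra.
by have [_ <-] := FW (x - 1) y I I xy; ring.
Unshelve. all: by end_near. Qed.

Lemma Rint_supp w (M : R) : 0 <= M -> (forall x, M < `|x| -> w x = 0) ->
  \int[mu]_x w x = \int[mu]_(x in `[- M, M]) w x.
Proof.
move=> M0 H; rewrite [RHS]Rintegral_mkcond; apply: eq_Rintegral => x _.
rewrite patchE; case: ifPn => // xM; apply: H; rewrite ltNge; apply: contra xM.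
by rewrite ler_norml inE /= in_itv.
Qed.

Lemma test_function_smooth phi : test_function phi -> smooth phi.
Proof. by case. Qed.

Lemma test_function_support phi : test_function phi ->
  exists2 M, 0 <= M & forall x, M < `|x| -> phi x = 0 /\ derive1 phi x = 0.
Proof.
move=> [_ /compact_bounded[M [_ HM]]].
pose M' := Num.max M 0 + 1.
have M'0 : 0 <= M' by rewrite /M' addr_ge0// le_max lexx orbT.
have MM' : M < M' by rewrite ltr_pwDr// le_max lexx.
have z x : M' < `|x| -> phi x = 0.
  move=> Mx; apply/eqP/negPn/negP => px.
  have px' : closure [set x0 | phi x0 != 0] x by apply: subset_closure.
  have := HM _ MM' x px'.
  by rewrite /= leNgt Mx.
exists M' => // x Mx; split; first exact: z.
apply: is_derive_derive1; apply: (@near_eq_is_derive _ _ _ (cst (0 : R))).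
near=> y; rewrite z//; near: y.
have cn : continuous (fun y : R => `|y|) by move=> y; exact: norm_continuous.
exact: (cvgr_gt _ (cn x)).
Unshelve. all: by end_near. Qed.

Lemma rprim_weak F w phi : rprim setT F w -> test_function phi ->
  \int[mu]_x (F x * derive1 phi x) = - \int[mu]_x (w x * phi x).
Proof.
move=> FW tphi; have sphi := test_function_smooth tphi.
have [M M0 HM] := test_function_support tphi.
(* [HM] gives vanishing only strictly outside radius M; a larger radius kills the boundary terms at
   both ends. *)
pose N := M + 1; have N0 : 0 <= N by rewrite addr_ge0.
have MN : M < N by rewrite ltrDl.
have HN x : N < `|x| -> phi x = 0 /\ derive1 phi x = 0.
  by move=> Nx; apply: HM; exact: lt_trans Nx.
rewrite (Rint_supp N0); last by move=> x /HN[_ ->]; rewrite mulr0.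
rewrite (Rint_supp N0); last by move=> x /HN[-> _]; rewrite mulr0.
have cphi := smooth_continuous sphi.
have cphi' := smooth_continuous (smooth_derive1 sphi).
have dphi x := derivable_is_derive (@smooth_derivable _ _ x sphi).
have P := rprim_derive dphi cphi'.
have NN : - N <= N by rewrite ge0_cp.
have iT : is_interval [set: R] by [].
have [_] := rprimM iT FW P I I NN.
have [-> _] : phi N = 0 /\ derive1 phi N = 0.
  by apply: HM; rewrite ger0_norm.
have [-> _] : phi (- N) = 0 /\ derive1 phi (- N) = 0.
  by apply: HM; rewrite normrN ger0_norm.
rewrite !mulr0 subrr => /esym.
have [wi _] := FW _ _ I I NN.
have i1 : mu.-integrable `[- N, N] (EFin \o (fun x => w x * phi x)).
  have [K HK] := @cont_bounded _ _ (- N) N cphi.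
  have := integrableM_bounded (M := K) _ _ _ wi.
  move=> /(_ phi (measurable_itv _)) H.
  apply: (eq_integrable _ _ _ _ (H _ _)) => //.
  - by move=> x _ /=; rewrite mulrC.
  - by apply: measurable_funTS; exact: continuous_measurable_fun.
have i2 : mu.-integrable `[- N, N] (EFin \o (fun x => F x * derive1 phi x)).
  apply: continuous_compact_integrable; first exact: segment_compact.
  apply: continuous_subspaceT => x; apply: cvgM; last exact: cphi'.
  exact: (rprim_continuous FW).
by rewrite RintegralD// => /eqP; rewrite addrC addr_eq0 => /eqP.
Qed.

(** A one-sided mollifier, supported in [a, a + e] and of total mass [bump_mass] instead of 1. *)
Definition mol (a e x : R) : R := e^-1 * bumpf ((x - a) / e).

(** The mollified Heaviside step at a: 0 to the left of a, [bump_mass] to the right of a + e, with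
    derivative [mol] a e. The factor 1 gives it the shape of [smooth_affine]. *)
Definition plat (a e x : R) : R := 1 * rop bumpf ((x - a) / e).

Let bumpi x y : mu.-integrable `[x, y] (EFin \o (@bumpf R)).
Proof.
apply: continuous_compact_integrable; first exact: segment_compact.
apply: continuous_subspaceT; exact: smooth_continuous smooth_bump.
Qed.

Let dPhi (x : R) : is_derive x 1 (rop (@bumpf R)) (bumpf x).
Proof.
apply: rprim_is_derive; first exact: rprim_rop.
exact: smooth_continuous smooth_bump.
Qed.

Lemma is_derive_plat a e (x : R) : is_derive x 1 (plat a e) (mol a e x).
Proof.
apply: is_derive_eq (is_derive_affine 1 (dPhi ((x - a) / e))) _.
by rewrite mul1r mulrC.
Qed.

Lemma smooth_plat a e : smooth (plat a e).
Proof. by apply: smooth_affine; exact: smooth_antiderivative dPhi smooth_bump. Qed.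

Lemma smooth_mol a e : smooth (mol a e).
Proof. by apply: smooth_affine; exact: smooth_bump. Qed.

Lemma mol_out a e x : 0 < e -> ~~ (a <= x <= a + e) -> mol a e x = 0.
Proof.
move=> e0 H; rewrite /mol bump_out ?mulr0//; apply: contra H => /andP[h1 h2].
have h3 : 0 < x - a by rewrite -(pmulr_lgt0 _ (_ : 0 < e^-1)) ?invr_gt0.
rewrite ltr_pdivrMr// mul1r in h2.
by apply/andP; split; lra.
Qed.

Lemma plat_left a e x : 0 < e -> x <= a -> plat a e x = 0.
Proof.
move=> e0 xa; rewrite /plat mul1r.
have y0 : (x - a) / e <= 0 by rewrite pmulr_lle0 ?invr_gt0// subr_le0.
have [_ e1] := rprim_rop bumpi I I y0; rewrite rop0 sub0r in e1.
apply/eqP; rewrite -oppr_eq0 e1; apply/eqP.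
rewrite /Rintegral integral0_eq// => t; rewrite /= in_itv/= => /andP[_ t0].
by rewrite bump_out//; apply/negP => /andP[]; rewrite ltNge t0.
Qed.

Lemma plat_right a e x : 0 < e -> a + e <= x -> plat a e x = bump_mass.
Proof.
move=> e0 xa; rewrite /plat mul1r.
have y0 : 1 <= (x - a) / e by rewrite ler_pdivlMr// mul1r; lra.
have [_ e1] := rprim_rop bumpi I I y0.
have [_ e2] := rprim_rop bumpi I I (@ler01 R); rewrite rop0 subr0 in e2.
rewrite -/(bump_mass) in e2; rewrite -e2; apply/eqP; rewrite -subr_eq0 e1; apply/eqP.
rewrite /Rintegral integral0_eq// => t; rewrite /= in_itv/= => /andP[t0 _].
by rewrite bump_out//; apply/negP => /andP[_]; rewrite ltNge t0.
Qed.

Lemma compact_support phi (A B : R) : (forall x, ~~ (A <= x <= B) -> phi x = 0) ->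
  compact (closure [set x | phi x != 0]).
Proof.
move=> H; apply: (subclosed_compact (@closed_closure _ _) (@segment_compact _ A B)).
rewrite closureE; apply: smallest_sub; first exact: interval_closed.
by move=> x /=; rewrite in_itv/= => px; apply/negPn/negP => /H /eqP; exact/negP.
Qed.

Lemma test_mol a e : 0 < e -> test_function (mol a e).
Proof.
move=> e0; split; first exact: smooth_mol.
by apply: (@compact_support _ a (a + e)) => x; exact: mol_out.
Qed.

Lemma test_plat a b e : 0 < e -> a <= b -> test_function (fun x => plat a e x - plat b e x).
Proof.
move=> e0 ab; split.
  by apply: smoothB; exact: smooth_plat.
apply: (@compact_support _ a (b + e)) => x; rewrite negb_and -!ltNge => /orP[xa|bx].
  by rewrite !plat_left ?subrr//; lra.
by rewrite !plat_right ?subrr//; lra.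
Qed.

Lemma derive1_plat a b e x :
  derive1 (fun x => plat a e x - plat b e x) x = mol a e x - mol b e x.
Proof.
apply: is_derive_derive1; apply: is_deriveB; exact: is_derive_plat.
Qed.

Lemma mol_mass a e : 0 < e -> \int[mu]_(x in `[a, a + e]) mol a e x = bump_mass.
Proof.
move=> e0; have cm := smooth_continuous (@smooth_mol a e).
have ae : a <= a + e by lra.
have [_ <-] := rprim_derive (is_derive_plat a e) cm I I ae.
by rewrite plat_right// plat_left// subr0.
Qed.

Lemma lebesgue_ptP f a (eta : R) : lebesgue_pt f a -> 0 < eta ->
  exists2 d, 0 < d & forall r, 0 < r -> r < d -> (davg f a r <= eta%:E)%E.
Proof.
move=> L eta0; move/fine_cvgP: L => [fin /cvgrPdist_le/(_ _ eta0) H].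
have : \forall r \near 0^'+, (davg f a r <= eta%:E)%E.
  near=> r.
  have h1 : davg f a r \is a fin_num by near: r.
  rewrite -(fineK h1) lee_fin; apply: le_trans (ler_norm _) _.
  rewrite -normrN -sub0r; near: r; exact: H.
move=> [d /= d0 Hd]; exists d => // r r0 rd; apply: Hd => //.
by rewrite /ball_ /= sub0r normrN gtr0_norm.
Unshelve. all: by end_near. Qed.

(** The mollifier is bounded by 1/e on [a, a + e], so the error is at most a multiple of the mean of
    |f - f(a)| over a ball around a, which tends to 0 at a Lebesgue point. *)
Lemma mollifier_limit f a (eta : R) : locally_integrable setT f -> lebesgue_pt f a ->
  0 < eta -> exists2 d, 0 < d & forall e, 0 < e -> e < d ->
  `|\int[mu]_x (f x * mol a e x) - bump_mass * f a| <= eta.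
Proof.
move=> lf La eta0; have eta4 : 0 < eta / 4 by rewrite divr_gt0.
have [d d0 Hd] := lebesgue_ptP La eta4.
exists (d / 2); first exact: divr_gt0.
move=> e e0 ed.
have cm := smooth_continuous (@smooth_mol a e).
have fi := locally_integrable_itv a (a + e) lf.
have mi : mu.-integrable `[a, a + e] (EFin \o mol a e).
  apply: continuous_compact_integrable; first exact: segment_compact.
  exact: continuous_subspaceT.
have mb x : `|mol a e x| <= e^-1.
  rewrite /mol normrM !ger0_norm ?bump_ge0 ?invr_ge0 ?(ltW e0)//.
  by rewrite -[leRHS]mulr1 ler_wpM2l ?bump_le1// invr_ge0 (ltW e0).
have mm : measurable_fun (`[a, a + e] : set R) (mol a e).
  by apply: measurable_funTS; exact: continuous_measurable_fun.
have fmi : mu.-integrable `[a, a + e] (EFin \o (fun x => mol a e x * f x)).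
  by apply: (integrableM_bounded (M := e^-1)).
have E : \int[mu]_x (f x * mol a e x) = \int[mu]_(x in `[a, a + e]) (mol a e x * f x).
  rewrite [RHS]Rintegral_mkcond; apply: eq_Rintegral => x _; rewrite patchE.
  case: ifPn => [_|xa]; first by rewrite mulrC.
  by rewrite mol_out ?mulr0//; apply: contra xa; rewrite inE /= in_itv.
rewrite E -(mol_mass a e0) -RintegralZr// -RintegralB//; last first.
  by apply: (eq_integrable _ _ _ _ (integrable_EFinZ (f a) _ mi)) => // x _ /=; rewrite mulrC.
have -> : \int[mu]_(x in `[a, a + e]) (mol a e x * f x - mol a e x * f a) =
   \int[mu]_(x in `[a, a + e]) (mol a e x * (f x - f a)).
  by apply: eq_Rintegral => x _; rewrite mulrBr.
have ci : mu.-integrable `[a, a + e] (EFin \o (fun=> f a)).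
  apply: continuous_compact_integrable; first exact: segment_compact.
  by apply: continuous_subspaceT => z; exact: cvg_cst.
have mI : lmeasurable `[a, a + e] by exact: measurable_itv.
have fci := integrableB mI fi ci.
have i3 : mu.-integrable `[a, a + e] (EFin \o (fun x => mol a e x * (f x - f a))).
  by apply: (integrableM_bounded (M := e^-1)).
apply: (le_trans (le_normr_Rintegral _ i3)) => //.
have i4 : mu.-integrable `[a, a + e] (EFin \o (fun x => `|f x - f a|)) := integrable_norm fci.
apply: (@le_trans _ _ (\int[mu]_(x in `[a, a + e]) (e^-1 * `|f x - f a|))).
  apply: le_Rintegral => //; [exact: integrable_norm i3|exact: integrable_EFinZ|].
  by move=> x _; rewrite normrM ler_wpM2r.
rewrite RintegralZl//.
(* The open ball of radius 2 e contains the segment [a, a + e]; its length 4 e, against the bound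
   1/e of the mollifier, costs the factor 4 anticipated in [eta4]. *)
have e2 : 0 < 2 * e by lra.
have e2d : 2 * e < d by lra.
have := Hd _ e2 e2d; rewrite /davg /iavg lebesgue_measure_ball; last exact: ltW.
have [mf _ _] := lf.
have S : (\int[mu]_(x in `[a, (a + e)%R]) `|f x - f a|%:E <=
   \int[mu]_(y in ball a (2 * e)%R) `|((center (f a) \o f) y)%:E|)%E.
  apply: ge0_subset_integral => //.
  - exact: measurable_ball.
  - apply: measurable_funTS; apply/measurable_EFinP; apply: measurableT_comp => //.
    by apply: measurable_funB.
  - move=> x; rewrite /= in_itv/= => /andP[h1 h2]; rewrite /ball/=.
    by rewrite ler0_norm; lra.
rewrite inver ifF; last by apply/negbTE; rewrite -mulr_natl; lra.
move=> H; rewrite -lee_fin EFinM /Rintegral fineK; last exact: integrable_fin_num i4.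
apply: (@le_trans _ _ (e^-1%:E * \int[mu]_(y in ball a (2 * e)%R) `|((center (f a) \o f) y)%:E|)%E).
  by apply: lee_wpmul2l => //; rewrite lee_fin invr_ge0 ltW.
have -> : e^-1 = 4 * (2 * e *+ 2)^-1.
  by rewrite -[_ *+ 2]mulr_natl; field; rewrite gt_eqF.
rewrite EFinM -muleA; apply: (@le_trans _ _ (4%:E * (eta / 4)%:E)%E).
  exact: lee_wpmul2l.
by rewrite -EFinM lee_fin; lra.
Unshelve. all: by []. Qed.

(** Both f and [rop] g have weak derivative g. Tested against the difference of steps at a and b,
    they have the same integral against [mol] a e minus [mol] b e; as e tends to 0 these integrals
    recover the increments over [a, b], up to the common factor minus [bump_mass]. *)
Lemma weak_primitive f g : locally_integrable setT f -> locally_integrable setT g ->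
  (forall phi, test_function phi ->
     \int[mu]_x (f x * derive1 phi x) = - \int[mu]_x (g x * phi x)) ->
  forall a b, a <= b -> lebesgue_pt f a -> lebesgue_pt f b ->
  f b - f a = rop g b - rop g a.
Proof.
move=> lf lg H a b ab La Lb.
have PG := rprim_rop (fun x y => locally_integrable_itv x y lg).
have cG := rprim_continuous PG.
have mG := continuous_measurable_fun cG.
have lG : locally_integrable setT (rop g).
  split => //; first exact: openT.
  move=> K _ cK; have : mu.-integrable K (EFin \o rop g).
    by apply: continuous_compact_integrable => //; exact: continuous_subspaceT.
  by move=> /integrableP[].
have LG x : lebesgue_pt (rop g) x.
  apply: (@continuous_lebesgue_pt _ _ _ setT) => //.
    by split => //; exact: openT.
  exact: cG.
have I0 := @bump_mass_gt0 R.
apply/eqP; rewrite -subr_eq0; apply/negPn/negP => D0.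
set D := f b - f a - (rop g b - rop g a) in D0.
(* Four mollification errors of size eta add up to half of [bump_mass] |D|, a contradiction if D is
   not 0. *)
pose eta := bump_mass * `|D| / 8.
have D1 : 0 < `|D| by rewrite normr_gt0.
have eta0 : 0 < eta by rewrite /eta divr_gt0// mulr_gt0.
have [d1 d10 H1] := mollifier_limit lf La eta0.
have [d2 d20 H2] := mollifier_limit lf Lb eta0.
have [d3 d30 H3] := mollifier_limit lG (LG a) eta0.
have [d4 d40 H4] := mollifier_limit lG (LG b) eta0.
pose e := Num.min (Num.min d1 d2) (Num.min d3 d4) / 2.
have m0 : 0 < Num.min (Num.min d1 d2) (Num.min d3 d4) by rewrite !lt_min d10 d20 d30 d40.
have e0 : 0 < e by rewrite divr_gt0.
have em : e < Num.min (Num.min d1 d2) (Num.min d3 d4) by rewrite /e ltr_pdivrMr// ltr_pMr// ltr1n.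
move: em; rewrite !lt_min => /andP[/andP[ed1 ed2] /andP[ed3 ed4]].
have {}H1 := H1 e e0 ed1; have {}H2 := H2 e e0 ed2.
have {}H3 := H3 e e0 ed3; have {}H4 := H4 e e0 ed4.
have T := test_plat e0 ab.
have := H _ T; rewrite -(rprim_weak PG T).
have mint h c : locally_integrable setT h -> mu.-integrable setT (EFin \o (fun x => h x * mol c e x)).
  move=> lh; have hi := locally_integrable_itv c (c + e) lh.
  have mb x : `|mol c e x| <= e^-1.
    rewrite /mol normrM !ger0_norm ?bump_ge0 ?invr_ge0 ?(ltW e0)//.
    by rewrite -[leRHS]mulr1 ler_wpM2l ?bump_le1// invr_ge0 (ltW e0).
  have mm : measurable_fun (`[c, c + e] : set R) (mol c e).
    by apply: measurable_funTS; apply: continuous_measurable_fun; exact: smooth_continuous (@smooth_mol _ _).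
  have hmi : mu.-integrable `[c, c + e] (EFin \o (fun x => mol c e x * h x)).
    by apply: (integrableM_bounded (M := e^-1)).
  have mI : lmeasurable `[c, c + e] by exact: measurable_itv.
  have := (integrable_mkcond _ mI).1 hmi.
  apply: eq_integrable => // x _; rewrite patchE.
  case: ifPn => [_ /=|xc /=]; first by rewrite mulrC.
  by rewrite mol_out ?mulr0//; apply: contra xc; rewrite inE /= in_itv.
have split h : locally_integrable setT h ->
    \int[mu]_x (h x * derive1 (fun x0 => plat a e x0 - plat b e x0) x) =
    \int[mu]_x (h x * mol a e x) - \int[mu]_x (h x * mol b e x).
  move=> lh; rewrite -RintegralB//; try exact: mint.
  by apply: eq_Rintegral => x _; rewrite derive1_plat mulrBr.
rewrite !split//.
move: H1 H2 H3 H4; clear -I0 D1 eta0.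
set fa := Rintegral _ _ _; set fb := Rintegral _ _ _.
set ga := Rintegral _ _ _; set gb := Rintegral _ _ _ => H1 H2 H3 H4 E.
have : bump_mass * `|D| <= 4 * eta.
  rewrite -(ger0_norm (ltW I0)) -normrM.
  have -> : bump_mass * D = (fa - bump_mass * f a) - (fb - bump_mass * f b)
     - (ga - bump_mass * rop g a) + (gb - bump_mass * rop g b).
    by rewrite /D; move: (rop g b) (rop g a) => z1 z2; lra.
  apply: (le_trans (ler_normD _ _)).
  apply: (le_trans (lerD (ler_normB _ _) (lexx _))).
  apply: (le_trans (lerD (lerD (ler_normB _ _) (lexx _)) (lexx _))).
  lra.
rewrite /eta in eta0 *; lra.
Qed.

Lemma weak_zero g : locally_integrable setT g ->
  (forall phi, test_function phi -> \int[mu]_x (g x * phi x) = 0) ->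
  forall a, lebesgue_pt g a -> g a = 0.
Proof.
move=> lg H a La; have I0 := @bump_mass_gt0 R.
apply/eqP/negPn/negP => g0.
have g1 : 0 < `|g a| by rewrite normr_gt0.
pose eta := bump_mass * `|g a| / 2.
have eta0 : 0 < eta by rewrite /eta divr_gt0// mulr_gt0.
have [d d0 Hd] := mollifier_limit lg La eta0.
have e0 : 0 < d / 2 by rewrite divr_gt0.
have ed : d / 2 < d by lra.
have := Hd _ e0 ed; rewrite H; last exact: test_mol.
rewrite sub0r normrN normrM (ger0_norm (ltW I0)) /eta.
have := mulr_gt0 I0 g1; lra.
Qed.

End RealWeakDerivative.

(** * Absolutely continuous representatives of weakly differentiable complex functions *)

Section ComplexWeakDerivative.
Context {R : realType}.
Local Notation mu := (@lebesgue_measure R).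
Local Notation lmeasurable := (@measurable _ (measurableTypeR R)).
Implicit Types (D : set R) (f g F : R -> R[i]) (w : R -> R).

Lemma aeS (P Q : R -> Prop) : (forall x, P x -> Q x) ->
  {ae mu, forall x, P x} -> {ae mu, forall x, Q x}.
Proof. by move=> PQ; apply: filterS; first exact: (ae_filter_ringOfSetsType mu). Qed.

Lemma aeI (P Q : R -> Prop) : {ae mu, forall x, P x} -> {ae mu, forall x, Q x} ->
  {ae mu, forall x, P x /\ Q x}.
Proof. by apply: filterI; first exact: (ae_filter_ringOfSetsType mu). Qed.

Lemma ae_exists (P : R -> Prop) : {ae mu, forall x, P x} ->
  exists2 x, 0 <= x <= 1 & P x.
Proof.
move=> [A [mA A0 HA]]; apply: contrapT => nP.
have AT : `[0, 1] `<=` A.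
  move=> x; rewrite /= in_itv/= => x01; apply: HA => Px; apply: nP; by exists x.
have e : lebesgue_measure (`[0 : R, 1] : set R) = 1%:E.
  by rewrite lebesgue_measure_itv/= lte_fin ltr01 oppr0 adde0.
have : (mu `[0%R : R, 1%R] <= mu A)%E.
  by apply: le_measure; rewrite ?inE//; exact: measurable_itv.
by rewrite A0 [X in (X <= _)%E](_ : _ = 1%:E)// lee_fin ler10.
Qed.

Lemma cintegrable_ae D f g : lmeasurable D -> cmeas D g ->
  {ae mu, forall x, D x -> f x = g x} -> cintegrable D f -> cintegrable D g.
Proof.
move=> mD [g1 g2] fg fi; have [f1 f2] := fi.
have key (u w : R -> R) : measurable_fun D w -> {ae mu, forall x, D x -> u x = w x} ->
    mu.-integrable D (EFin \o u) -> mu.-integrable D (EFin \o w).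
  move=> mw uw /integrableP[mu' lu]; apply/integrableP; split; first exact/measurable_EFinP.
  apply: le_lt_trans lu; rewrite le_eqVlt; apply/orP; left; apply/eqP.
  apply: ae_eq_integral => //.
  - by apply: measurableT_comp => //; exact/measurable_EFinP.
  - exact: measurableT_comp.
  - by apply: (aeS _ uw) => x H Dx /=; rewrite H.
split.
  by apply: key f1 => //; apply: (aeS _ fg) => x H Dx; rewrite H.
by apply: key f2 => //; apply: (aeS _ fg) => x H Dx; rewrite H.
Qed.

Lemma cint_ae D f g : lmeasurable D -> cmeas D f -> cmeas D g ->
  {ae mu, forall x, D x -> f x = g x} -> cint D f = cint D g.
Proof.
move=> mD [f1 f2] [g1 g2] fg; apply: complexP; rewrite ?Re_cint ?Im_cint /Rintegral; congr fine;
  apply: ae_eq_integral => //; try exact/measurable_EFinP;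
  by apply: (aeS _ fg) => x H Dx /=; rewrite H.
Qed.

Lemma cReMr (z : R[i]) (r : R) : Re (z * r%:C) = Re z * r.
Proof. by rewrite cReM /= mulr0 subr0. Qed.

Lemma cImMr (z : R[i]) (r : R) : Im (z * r%:C) = Im z * r.
Proof. by rewrite cImM /= mulr0 add0r. Qed.

Lemma L1loc_components f : L1loc f ->
  locally_integrable setT (fun x => Re (f x)) /\
  locally_integrable setT (fun x => Im (f x)).
Proof.
move=> [[m1 m2] [mn _ ln]].
have key w : measurable_fun setT w -> (forall x, `|w x| <= normc (f x)) ->
    locally_integrable setT w.
  move=> mw wn; split => //; first exact: openT.
  move=> K KT cK; apply: le_lt_trans (ln K KT cK).
  have mK : lmeasurable K by exact: compact_measurable.
  apply: ge0_le_integral => //.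
  - by apply/measurable_EFinP; apply: measurableT_comp => //; exact: measurable_funTS.
  - by apply/measurable_EFinP; apply: measurableT_comp => //; exact: measurable_funTS.
  - by move=> x _; rewrite lee_fin (ger0_norm (normc_ge0 _)).
by split; apply: key => // x; [exact: normRe|exact: normIm].
Qed.

Lemma L1loc_cintegrable f x y : L1loc f -> cintegrable `[x, y] f.
Proof. by move=> /L1loc_components[l1 l2]; split; exact: locally_integrable_itv. Qed.

Lemma compact_itv (K : set R) : compact K -> exists M, K `<=` `[- M, M].
Proof.
move=> /compact_bounded[M [_ HM]]; exists (M + 1) => x Kx.
have MM : M < M + 1 by rewrite ltrDl.
by have := HM _ MM x Kx; rewrite /= in_itv/= ler_norml.
Qed.

Lemma locally_integrable_of_itv w : measurable_fun setT w ->
  (forall M, mu.-integrable `[- M, M] (EFin \o w)) -> locally_integrable setT w.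
Proof.
move=> mw H; split => //; first exact: openT.
move=> K _ cK; have [M KM] := compact_itv cK.
have /integrableP[_] : mu.-integrable K (EFin \o w).
  by apply: integrableS (H M) => //; exact: compact_measurable.
by [].
Qed.

Lemma L1loc_of_cintegrable f : cmeasurable f ->
  (forall x y, cintegrable `[x, y] f) -> L1loc f.
Proof.
move=> mf H; split=> //; apply: locally_integrable_of_itv; first exact: cmeas_normc.
by move=> M; apply: cintegrable_normc.
Qed.

Definition oprim f (x : R) : R[i] :=
  rop (fun t => Re (f t)) x +i* rop (fun t => Im (f t)) x.

Lemma prim_oprim f : L1loc f -> prim setT (oprim f) f.
Proof.
move=> /L1loc_components[l1 l2]; apply/primP; split; apply: rprim_rop => x y;
  exact: locally_integrable_itv.
Qed.

Lemma weak_derivative_real f g : weak_derivative f g -> forall phi, test_function phi ->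
  (\int[mu]_x (Re (f x) * derive1 phi x) = - (\int[mu]_x (Re (g x) * phi x))) /\
  (\int[mu]_x (Im (f x) * derive1 phi x) = - (\int[mu]_x (Im (g x) * phi x))).
Proof.
move=> [_ _ H] phi tphi; have E := H phi tphi; split.
  have := congr1 (@complex.Re R) E; rewrite cReN !Re_cint.
  under eq_Rintegral do rewrite cReMr.
  by under [in X in _ = X -> _]eq_Rintegral do rewrite cReMr.
have := congr1 (@complex.Im R) E; rewrite cImN !Im_cint.
under eq_Rintegral do rewrite cImMr.
by under [in X in _ = X -> _]eq_Rintegral do rewrite cImMr.
Qed.

Lemma weak_derivative_prim f g : weak_derivative f g ->
  exists2 F, prim setT F g & {ae mu, forall x, f x = F x}.
Proof.
move=> H; have [lf lg _] := H; have W := weak_derivative_real H.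
have [f1 f2] := L1loc_components lf; have [g1 g2] := L1loc_components lg.
have A := aeI (lebesgue_differentiation f1) (lebesgue_differentiation f2).
(* The base point of the representative: a common Lebesgue point of the real and imaginary parts,
   where f has its correct value. The representative then agrees with f at every such point. *)
have [x0 _ [x01 x02]] := ae_exists A.
pose F x := f x0 - oprim g x0 + oprim g x.
exists F.
  move=> x y Dx Dy xy; have [gi e] := prim_oprim lg Dx Dy xy.
  by split=> //; rewrite -e /F opprD addrACA subrr add0r.
apply: (aeS _ A) => x [h1 h2].
have key (a b : R) : a <= b -> lebesgue_pt (fun x => Re (f x)) a -> lebesgue_pt (fun x => Im (f x)) a ->
   lebesgue_pt (fun x => Re (f x)) b -> lebesgue_pt (fun x => Im (f x)) b ->
   f b - f a = oprim g b - oprim g a.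
  move=> ab a1 a2 b1 b2; apply: complexP.
    rewrite !cReD !cReN; apply: (weak_primitive f1 g1) => // phi tphi.
    by have [] := W phi tphi.
  rewrite !cImD !cImN; apply: (weak_primitive f2 g2) => // phi tphi.
  by have [] := W phi tphi.
rewrite /F -addrA [- _ + _]addrC.
have [xx|/ltW xx] := leP x0 x.
  by rewrite -(key _ _ xx)// addrC subrK.
by rewrite -[X in _ + X]opprB -(key _ _ xx)// opprB addrC subrK.
Qed.

Lemma prim_weak_derivative F f g : prim setT F g -> cmeasurable g -> cmeasurable f ->
  {ae mu, forall x, f x = F x} -> weak_derivative f g.
Proof.
move=> P mg mf fF; have cF := prim_ccont P.
have gi x y : cintegrable `[x, y] g.
  have [xy|yx] := leP x y; first by have [] := P x y I I xy.
  rewrite set_itv_ge ?bnd_simp -?ltNge//; split; exact: integrable_set0.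
have mF : cmeas setT F by exact: ccont_meas.
have Fi x y : cintegrable `[x, y] f.
  apply: (@cintegrable_ae _ F) (ccont_cintegrable x y cF) => //.
    by case: mf => m1 m2; split; exact: measurable_funTS.
  by apply: (aeS _ fF) => z Hz _.
split; [exact: L1loc_of_cintegrable|exact: L1loc_of_cintegrable|].
move=> phi tphi; have sphi := test_function_smooth tphi.
have cphi' : ccont (fun x => (derive1 phi x)%:C).
  by apply: ccont_real; exact: smooth_continuous (smooth_derive1 sphi).
have mphi' : cmeas setT (fun x => (derive1 phi x)%:C) by exact: ccont_meas.
rewrite (@cint_ae _ _ (fun x => F x * (derive1 phi x)%:C))//; last first.
- by apply: (aeS _ fF) => z Hz _; rewrite Hz.
- exact: cmeasM.
- exact: cmeasM.
have [P1 P2] := (primP _ _ _).1 P.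
apply: complexP.
  rewrite cReN !Re_cint.
  under eq_Rintegral do rewrite cReMr.
  under [in RHS]eq_Rintegral do rewrite cReMr.
  exact: rprim_weak.
rewrite cImN !Im_cint.
under eq_Rintegral do rewrite cImMr.
under [in RHS]eq_Rintegral do rewrite cImMr.
exact: rprim_weak.
Qed.

Lemma smooth_bounded_integrable w phi : locally_integrable setT w -> test_function phi ->
  mu.-integrable setT (EFin \o (fun x => w x * phi x)).
Proof.
move=> lw tphi; have [M M0 HM] := test_function_support tphi.
have cphi := smooth_continuous (test_function_smooth tphi).
have wi := locally_integrable_itv (- M) M lw.
have mI : lmeasurable `[- M, M] by exact: measurable_itv.
have [K HK] := @cont_bounded _ _ (- M) M cphi.
have i1 : mu.-integrable `[- M, M] (EFin \o (fun x => phi x * w x)).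
  apply: (integrableM_bounded (M := K)) => //.
  by apply: measurable_funTS; exact: continuous_measurable_fun.
have := (integrable_mkcond _ mI).1 i1.
apply: eq_integrable => // x _; rewrite patchE; case: ifPn => [_ /=|xM /=].
  by rewrite mulrC.
have [-> _] : phi x = 0 /\ derive1 phi x = 0.
  apply: HM; rewrite ltNge; apply: contra xM.
  by rewrite ler_norml inE /= in_itv.
by rewrite mulr0.
Qed.

Lemma weak_derivative_unique f g g' : weak_derivative f g -> weak_derivative f g' ->
  {ae mu, forall x, g x = g' x}.
Proof.
move=> H H'; have W := weak_derivative_real H; have W' := weak_derivative_real H'.
have [_ lg _] := H; have [_ lg' _] := H'.
have ld : L1loc (fun x => g x - g' x).
  apply: L1loc_of_cintegrable.
    by apply: cmeasB; [case: lg|case: lg'].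
  by move=> x y; apply: cintegrableB => //; exact: L1loc_cintegrable.
have [g1 g2] := L1loc_components lg; have [g1' g2'] := L1loc_components lg'.
have [d1 d2] := L1loc_components ld.
apply: (aeS _ (aeI (lebesgue_differentiation d1) (lebesgue_differentiation d2))).
move=> x [h1 h2]; apply/eqP; rewrite -subr_eq0; apply/eqP; apply: complexP.
  apply: (weak_zero d1 _ h1) => phi tphi.
  have [E1 _] := W phi tphi; have [E2 _] := W' phi tphi.
  have /eqP := etrans (esym E1) E2; rewrite eqr_opp => /eqP E.
  transitivity (\int[mu]_x (Re (g x) * phi x) - \int[mu]_x (Re (g' x) * phi x)); last by rewrite E subrr.
  rewrite -RintegralB//; try exact: smooth_bounded_integrable.
  by apply: eq_Rintegral => z _; rewrite cReD cReN mulrBl.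
apply: (weak_zero d2 _ h2) => phi tphi.
have [_ E1] := W phi tphi; have [_ E2] := W' phi tphi.
have /eqP := etrans (esym E1) E2; rewrite eqr_opp => /eqP E.
transitivity (\int[mu]_x (Im (g x) * phi x) - \int[mu]_x (Im (g' x) * phi x)); last by rewrite E subrr.
rewrite -RintegralB//; try exact: smooth_bounded_integrable.
by apply: eq_Rintegral => z _; rewrite cImD cImN mulrBl.
Qed.

Lemma wderivP f g : weak_derivative f g -> weak_derivative f (wderiv f).
Proof. by move=> H; rewrite /wderiv; apply: (@xgetPex _ _ (weak_derivative f)); exists g. Qed.

Lemma wderiv_ae f g : weak_derivative f g -> {ae mu, forall x, wderiv f x = g x}.
Proof. by move=> H; exact: weak_derivative_unique (wderivP H) H. Qed.

Lemma prim_ae D F f g : is_interval D -> cmeasurable g ->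
  {ae mu, forall x, D x -> f x = g x} -> prim D F f -> prim D F g.
Proof.
move=> iD mg fg H x y Dx Dy xy; have [fi e] := H x y Dx Dy xy.
have mg' : cmeas `[x, y] g by case: mg => m1 m2; split; exact: measurable_funTS.
have ae' : {ae mu, forall z, (`[x, y]%classic : set R) z -> f z = g z}.
  apply: (aeS _ fg) => z Hz; rewrite /= in_itv/= => zxy; apply: Hz.
  exact: iD zxy.
split; first by apply: cintegrable_ae ae' fi.
by rewrite e; apply: cint_ae ae' => //; exact: cintegrable_meas.
Qed.

End ComplexWeakDerivative.

(** * Spectrum of the zigzag generator *)

Section FullLine.
Context {R : realType}.
Local Notation mu := (@lebesgue_measure R).
Local Notation lmeasurable := (@measurable _ (measurableTypeR R)).
Local Notation halfline := (`[(0 : R), +oo[%classic).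
Implicit Types (w : R -> R) (f : R -> R[i]).

Let mH : lmeasurable halfline. Proof. exact: measurable_itv. Qed.

Lemma opp_halfline : -%R @^-1` `]-oo, 0] = halfline.
Proof. by apply/seteqP; split => x /=; rewrite !in_itv/= ?andbT oppr_le0. Qed.

Lemma opp_negline : -%R @^-1` halfline = `]-oo, 0]%classic.
Proof. by apply/seteqP; split => x /=; rewrite !in_itv/= ?andbT oppr_ge0. Qed.

Lemma line_setU : [set: R] = halfline `|` `]-oo, 0[.
Proof.
apply/seteqP; split=> // x _; rewrite /= !in_itv/= andbT.
by apply/orP; case: leP.
Qed.

Lemma line_disj : [disjoint halfline & (`]-oo, 0[ : set R)].
Proof.
apply/disj_setPS => x; rewrite /= !in_itv/= andbT => -[x0].
by rewrite ltNge x0.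
Qed.

Lemma integrable_line w : mu.-integrable setT (EFin \o w) <->
  mu.-integrable halfline (EFin \o w) /\ mu.-integrable halfline (EFin \o (w \o -%R)).
Proof.
have mN : lmeasurable `]-oo, 0[ by exact: measurable_itv.
have mN' : lmeasurable `]-oo, 0] by exact: measurable_itv.
have mT : lmeasurable setT by [].
split=> [wi|[i1 i2]].
  split; first exact: integrableS wi.
  have wi' : mu.-integrable `]-oo, 0] (EFin \o w) by exact: integrableS wi.
  by have [] := Rint_opp mN' wi'; rewrite opp_halfline.
have [i2' _] := Rint_opp mH i2; rewrite opp_negline in i2'.
have j1 := (integrable_mkcond _ mH).1 i1.
have wN : mu.-integrable `]-oo, 0[ (EFin \o w).
  have : mu.-integrable `]-oo, 0[ (EFin \o (w \o -%R \o -%R)).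
    by apply: integrableS i2' => //; apply: subset_itvl; rewrite bnd_simp.
  by apply: eq_integrable => // x _ /=; rewrite opprK.
have j2 := (integrable_mkcond _ mN).1 wN.
apply: (eq_integrable _ _ _ _ (integrableD mT j1 j2)) => // x _.
rewrite /= !patchE; have [x0|x0] := leP 0 x.
  rewrite mem_set ?memNset ?adde0// /= in_itv/= ?andbT//.
  by rewrite ltNge x0.
by rewrite memNset ?mem_set ?add0e// /= in_itv/= ?andbT//; apply/negP; rewrite -ltNge.
Qed.

Lemma Rint_line w : mu.-integrable setT (EFin \o w) ->
  \int[mu]_x w x = \int[mu]_(x in halfline) w x + \int[mu]_(x in halfline) w (- x).
Proof.
move=> wi; have mN : lmeasurable `]-oo, 0[ by exact: measurable_itv.
have mN' : lmeasurable `]-oo, 0] by exact: measurable_itv.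
have wi' : mu.-integrable `]-oo, 0] (EFin \o w) by exact: integrableS wi.
have [_] := Rint_opp mN' wi'; rewrite opp_halfline => ->.
rewrite line_setU Rintegral_setU//; last exact: line_disj.
  congr (_ + _); apply: Rintegral_itv_bndo_bndc.
  by apply: integrableS wi.
by rewrite -line_setU.
Qed.

Lemma measurable_line w : measurable_fun setT w <->
  measurable_fun halfline w /\ measurable_fun halfline (w \o -%R).
Proof.
have mN : lmeasurable `]-oo, 0] by exact: measurable_itv.
split=> [mw|[m1 m2]].
  split; apply: measurable_funTS => //.
  by apply: measurableT_comp => //; exact: oppr_measurable.
have -> : [set: R] = halfline `|` `]-oo, 0].
  apply/seteqP; split=> // x _; rewrite /= !in_itv/= andbT.
  by case: (leP 0 x) => [x0|/ltW x0]; [left|right].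
apply/measurable_funU => //; split=> //.
have -> : w = (w \o -%R) \o -%R by apply/funext => x /=; rewrite opprK.
apply: (measurable_comp mH) m2 _; last by apply: measurable_funTS; exact: oppr_measurable.
by move=> _ [x /= x0 <-]; move: x0; rewrite /= !in_itv/= andbT oppr_ge0.
Qed.

Lemma cint_line (w : R -> R[i]) : cintegrable halfline w ->
  cintegrable halfline (fun x => w (- x)) ->
  cint setT w = cint halfline w + cint halfline (fun x => w (- x)).
Proof.
move=> [a1 a2] [b1 b2].
have i1 := (integrable_line (fun x => Re (w x))).2 (conj a1 b1).
have i2 := (integrable_line (fun x => Im (w x))).2 (conj a2 b2).
by apply: complexP; rewrite ?cReD ?cImD ?Re_cint ?Im_cint Rint_line.
Qed.

End FullLine.

(** * From the two half-line systems to the resolvent and the eigenfunctions *)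

Section ZigZagSpectrum.
Context {R : realType} (U lrefr : R -> R).
Local Notation mu := (@lebesgue_measure R).
Local Notation lmeasurable := (@measurable _ (measurableTypeR R)).
Local Notation halfline := (`[(0 : R), +oo[%classic).
Local Notation V := (derive1 U).
Local Notation Um := (fun x : R => U (- x)).
Local Notation Vm := (fun x : R => - derive1 U (- x)).
Local Notation zero := (fun=> 0 : R[i]).
Local Notation resolvent := (is_resolvent U lrefr).
Implicit Types (f g h F : phase R -> R[i]) (gamma kp km c : R[i]).
Context (uv : potential U V) (uvm : potential Um Vm) (lrefr0 : forall x, lrefr x = 0).
Context (U_ge0 : forall x, 0 <= x -> 0 <= V x) (U_le0 : forall x, x <= 0 -> V x <= 0).

Let mH : lmeasurable halfline. Proof. exact: measurable_itv. Qed.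
Let cV : continuous V. Proof. by case: uv. Qed.
Let cU : continuous U.
Proof. by case: uv => dU cV' _ _ _; exact: (@rprim_continuous _ U V (rprim_derive dU cV')). Qed.
Let U0 : U 0 = 0. Proof. by case: uv. Qed.

Definition emeas f : Prop := forall th, cmeasurable (fun x => f (x, th)).

(** No sign is attached to f or h: the sign produced by differentiating f(-x) is compensated by the
    reversal of the velocity. *)
Definition mirror f : phase R -> R[i] := fun p => f (- p.1, ~~ p.2).

Lemma inL2_halves f : inL2 U f <->
  [/\ hL2 U (fplus f), hL2 U (fminus f), hL2 Um (fplus (mirror f)) &
      hL2 Um (fminus (mirror f))].
Proof.
have key (w : R -> R[i]) : cmeasurable w /\ mu.-integrable setT
    (fun x => (normc (w x) ^+ 2 * expR (- U x))%:E) <-> hL2 U w /\ hL2 Um (fun x => w (- x)).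
  rewrite /hL2 /cmeasurable /cmeas (integrable_line (fun x => normc (w x) ^+ 2 * expR (- U x))).
  rewrite !(measurable_line (fun x => _ (w x))) /=.
  by split=> [[[[a b] [c d]] [e g]]|[[[a b] c] [[d e] g]]].
split=> [H|[H1 H2 H3 H4] th].
  by have [h1 h2] := (key _).1 (H true); have [h3 h4] := (key _).1 (H false).
by apply/key; case: th.
Qed.

Lemma normmu_sq f : inL2 U f -> normmu U f ^+ 2 =
  hnrm U (fplus f) + hnrm U (fminus f) + hnrm Um (fplus (mirror f)) +
  hnrm Um (fminus (mirror f)).
Proof.
move=> Hf.
have key th : Re (\cint_(x in setT) (f (x, th) * conjc (f (x, th)) * (expR (- U x))%:C)) =
    hnrm U (fun x => f (x, th)) + hnrm Um (fun x => f (- x, th)).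
  rewrite Re_cint.
  have -> : (fun x => Re (f (x, th) * conjc (f (x, th)) * (expR (- U x))%:C)) =
      (fun x => normc (f (x, th)) ^+ 2 * expR (- U x)).
    apply/funext => x; rewrite cReMr normc_sq; congr (_ * _).
    by case: (f (x, th)) => a b /=; ring.
  by have [_ /Rint_line ->] := Hf th.
rewrite /normmu sqr_sqrtr /dotmu big_bool cReD !key; last first.
  by rewrite !addr_ge0// rnrm_ge0.
rewrite /fplus /fminus /mirror /=.
by move: (hnrm _ _) (hnrm _ _) (hnrm _ _) (hnrm _ _) => a b c d; ring.
Qed.

Definition rsys v gamma h f : Prop :=
  hsys v gamma (fplus h) (fminus h) (fminus f) (fplus f).

(** The x-derivative of f as prescribed by (gamma - L) f = h; dividing by the velocity is
    multiplying by it. *)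
Definition drift gamma h f (th : bool) (x : R) : R[i] :=
  (velocity th)%:C * (gamma * f (x, th) - h (x, th) -
     (rate U lrefr (x, th))%:C * (f (x, ~~ th) - f (x, th))).

(* The absolutely continuous representative of f solves (gamma - L) f = h. *)
Definition strong gamma h f : Prop :=
  forall th, prim setT (fun x => f (x, th)) (drift gamma h f th).

Lemma rate_true x : rate U lrefr (x, true) = Num.max (V x) 0.
Proof. by rewrite /rate /velocity /= lrefr0 addr0 mul1r. Qed.

Lemma rate_false x : rate U lrefr (x, false) = Num.max (- V x) 0.
Proof. by rewrite /rate /velocity /= lrefr0 addr0 mulN1r. Qed.

Let rate_pos x : 0 <= x -> rate U lrefr (x, true) = V x /\ rate U lrefr (x, false) = 0.
Proof.
move=> x0; rewrite rate_true rate_false; split; first by apply/max_idPl; exact: U_ge0.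
by apply/max_idPr; rewrite oppr_le0; exact: U_ge0.
Qed.

Let rate_neg x : x <= 0 -> rate U lrefr (x, true) = 0 /\ rate U lrefr (x, false) = - V x.
Proof.
move=> x0; rewrite rate_true rate_false; split; first by apply/max_idPr; exact: U_le0.
by apply/max_idPl; rewrite oppr_ge0; exact: U_le0.
Qed.

Let iN : is_interval (`]-oo, (0 : R)] : set R).
Proof. exact: interval_is_interval. Qed.

(** On x >= 0 the switching rate is U' for velocity +1 and 0 for velocity -1; on x <= 0 it is 0 and
    -U'. Reflecting the second half-line gives the same system with v(x) = -U'(-x). *)
Lemma strongP gamma h f : strong gamma h f <->
  rsys V gamma h f /\ rsys Vm gamma (mirror h) (mirror f).
Proof.
split=> [H|[[H1 H2] [H3 H4]]].
  have P th := primS (subsetT halfline) (H th).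
  have N th := prim_opp (primS (subsetT (`]-oo, (0 : R)] : set R)) (H th)).
  rewrite opp_halfline in N.
  split; split.
  - apply: (eq_prim (@halfline_interval R) _ _ (P false)) => // x /halflineP /rate_pos[_ e].
    by rewrite /drift /fminus /= e; ring.
  - apply: (eq_prim (@halfline_interval R) _ _ (P true)) => // x /halflineP /rate_pos[e _].
    by rewrite /drift /fminus /fplus /= e; ring.
  - apply: (eq_prim (@halfline_interval R) _ _ (N true)) => // x /halflineP.
    rewrite -oppr_le0 => /rate_neg[e _].
    by rewrite /drift /fminus /mirror /= e; ring.
  - apply: (eq_prim (@halfline_interval R) _ _ (N false)) => // x /halflineP.
    rewrite -oppr_le0 => /rate_neg[_ e].
    by rewrite /drift /fminus /fplus /mirror /= e; ring.
have N3 := prim_opp H3; have N4 := prim_opp H4; rewrite opp_negline in N3 N4.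
case; apply: prim_glue.
- apply: (eq_prim (@halfline_interval R) _ _ H2) => // x /halflineP /rate_pos[e _].
  by rewrite /drift /fminus /fplus /= e; ring.
- apply: (eq_prim iN _ _ N3) => x; rewrite /drift /fminus /fplus /mirror /= ?opprK//.
  rewrite in_itv/= => /rate_neg[e _]; rewrite e; ring.
- apply: (eq_prim (@halfline_interval R) _ _ H1) => // x /halflineP /rate_pos[_ e].
  by rewrite /drift /fminus /fplus /= e; ring.
- apply: (eq_prim iN _ _ N4) => x; rewrite /drift /fminus /fplus /mirror /= ?opprK//.
  rewrite in_itv/= => /rate_neg[_ e]; rewrite e; ring.
Qed.

(** The general solution, with f^+(0) = kp and f^-(0) = km. It solves the equation for all kp and
    km; square integrability selects among them. *)
Definition sol gamma kp km h : phase R -> R[i] := fun p =>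
  if p.2 then
    if p.1 <= 0 then hp gamma kp (fminus (mirror h)) (- p.1)
    else hq U V gamma kp km (fplus h) (fminus h) p.1
  else
    if p.1 <= 0 then hq Um Vm gamma km kp (fplus (mirror h)) (fminus (mirror h)) (- p.1)
    else hp gamma km (fminus h) p.1.

Lemma hq0 (u v : R -> R) gamma (k1 k2 : R[i]) (h1 h2 : R -> R[i]) :
  u 0 = 0 -> hq u v gamma k1 k2 h1 h2 0 = k1.
Proof. by move=> u0; rewrite /hq mulr0 u0 addr0 cexp0 mul1r cint_set1 subr0. Qed.

Let Um0 : Um 0 = 0. Proof. by rewrite /= oppr0. Qed.

Lemma sol_plus0 gamma kp km h : sol gamma kp km h (0, true) = kp.
Proof. by rewrite /sol /= lexx oppr0 hp0. Qed.

Lemma sol_minus0 gamma kp km h : sol gamma kp km h (0, false) = km.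
Proof. by rewrite /sol /= lexx oppr0 hq0. Qed.

Lemma strong_sol gamma h f : inL2 U h ->
  strong gamma h f <-> f = sol gamma (f (0, true)) (f (0, false)) h.
Proof.
move=> /inL2_halves[L1 L2 L3 L4].
rewrite strongP// /rsys (hsysP uv)// (hsysP uvm)//.
split=> [[[H1 H2] [H3 H4]]|H].
  apply/funext => -[x []]; rewrite /sol /=; have [x0|/ltW x0] := leP x 0.
  - have := H3 (- x); rewrite oppr_ge0 => /(_ x0).
    by rewrite /fminus /mirror /= opprK oppr0.
  - by have := H2 x x0; rewrite /fplus /fminus.
  - have := H4 (- x); rewrite oppr_ge0 => /(_ x0).
    by rewrite /fminus /fplus /mirror /= opprK oppr0.
  - by have := H1 x x0.
split; split=> x x0.
- rewrite {1}H /fminus /sol /=; case: ifPn => // x0'.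
  (* Only x = 0 lies in both half-lines. There [sol] takes the formula of the left one, and [hp] and
     [hq] both return the initial value. *)
  have -> : x = 0 by apply/eqP; rewrite eq_le x0 x0'.
  by rewrite oppr0 hq0// hp0.
- rewrite {1}H /fplus /sol /=; case: ifPn => // x0'.
  have -> : x = 0 by apply/eqP; rewrite eq_le x0 x0'.
  by rewrite oppr0 hq0// hp0.
- rewrite /fminus /mirror /= oppr0 {1}H /sol /= oppr_le0 x0 opprK.
  by rewrite /fminus /mirror /=.
- rewrite /fplus /fminus /mirror /= oppr0 {1}H /sol /= oppr_le0 x0 opprK.
  by rewrite /fplus /fminus /mirror.
Qed.

Lemma sol_strong gamma kp km h : inL2 U h ->
  strong gamma h (sol gamma kp km h).
Proof. by move=> Lh; rewrite strong_sol// sol_plus0 sol_minus0. Qed.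

Definition Kp gamma h := hK U V gamma (fplus h) (fminus h).
Definition Km gamma h := hK Um Vm gamma (fplus (mirror h)) (fminus (mirror h)).

Lemma cint_opp_ray (x : R) (w : R -> R[i]) : cintegrable `[x, +oo[ w ->
  cint `]-oo, (- x)] (fun t => w (- t)) = cint `[x, +oo[ w.
Proof.
move=> wi; have mx : lmeasurable `[x, +oo[ by exact: measurable_itv.
have [_ <-] := cint_opp mx wi; congr cint.
by apply/seteqP; split => t /=; rewrite !in_itv/= ?andbT lerNr.
Qed.

Lemma cint_opp_rayN (x : R) (w : R -> R[i]) : cintegrable `[x, +oo[ w ->
  cint `]-oo, (- x)] (fun t => - w (- t)) = - cint `[x, +oo[ w.
Proof.
move=> wi; have mx : lmeasurable `[x, +oo[ by exact: measurable_itv.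
by rewrite -cintN// -(cint_opp_ray (cintegrableN mx wi)).
Qed.

Let weightN gamma (t : R) : (V t)%:C * cexp (2 * gamma * t%:C - (U t)%:C) =
  - ((Vm (- t))%:C * cexp (- (2 * gamma * (- t)%:C) - (Um (- t))%:C)).
Proof. by rewrite /= opprK !raddfN /= mulNr opprK mulrN opprK. Qed.

Lemma psim_hpsi gamma : psim U gamma = hpsi Um Vm gamma.
Proof.
apply: oppr_inj; rewrite /psim opprK -(cint_opp_rayN (vexp_cintegrable uvm gamma)) oppr0.
by apply: eq_cint => t _; exact: weightN.
Qed.

Lemma cint_mirror gamma h (x : R) : inL2 U h -> x <= 0 ->
  \cint_(xi in `[x, 0]) (cexp (- (gamma * xi%:C)) * fplus h xi) =
  \cint_(t in `[0, - x]) (cexp (gamma * t%:C) * fminus (mirror h) t).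
Proof.
move=> /inL2_halves[_ _ _ L4] x0.
have ci : cintegrable `[0, - x] (fun t => cexp (gamma * t%:C) * fminus (mirror h) t).
  apply: cintegrableM_cont; last exact: (hL2_loc uvm).
  by apply: ccont_cexp; exact: ccont_lin.
have [_ <-] := cint_opp_itv ci; rewrite opprK oppr0.
by apply: eq_cint => t _; rewrite /fminus /fplus /mirror /= opprK raddfN /= mulrN.
Qed.

Lemma Kmap_hK gamma h : inL2 U h -> Kmap U gamma h = col2 (Kp gamma h) (Km gamma h).
Proof.
move=> Lh; have /inL2_halves[L1 L2 L3 L4] := Lh; congr col2.
have [C [_ HC]] := vexp_cint_cintegrable uvm gamma; have [j2 _] := HC _ L4.
have j1 := eweight_hL2 uvm gamma L3.
have e1 := cint_opp_ray j1; have e2 := cint_opp_rayN j2.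
rewrite oppr0 in e1 e2; rewrite /Km /hK; congr (_ + _).
  apply: etrans e1; apply: eq_cint => x _.
  by rewrite /eweight /fplus /mirror /= !opprK raddfN /= mulrN opprK.
apply: oppr_inj; rewrite [LHS]opprK; apply: etrans e2; apply: eq_cint => x; rewrite inE/= in_itv/= => x0.
by rewrite weightN cint_mirror// mulNr.
Qed.

Let norms_le (C D a1 a2 a3 a4 b1 b2 b3 b4 c1 c2 : R) : 0 <= C -> 0 <= D ->
  0 <= a1 -> 0 <= a2 -> 0 <= a3 -> 0 <= a4 -> 0 <= c1 -> 0 <= c2 ->
  b2 <= C * (c1 + a2) -> b4 <= D * (c2 + a4) ->
  b1 <= C * (c1 + a1 + a2) -> b3 <= D * (c2 + a3 + a4) ->
  b1 + b2 + b3 + b4 <= 2 * (C + D) * (c2 + c1 + (a1 + a2 + a3 + a4)).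
Proof.
move=> C0 D0 a10 a20 a30 a40 c10 c20 r2 r4 r1 r3.
have bd (c d z S : R) : 0 <= c -> d <= S -> z <= c * d -> z <= c * S.
  by move=> c0 dS; move/le_trans; apply; exact: ler_wpM2l.
set S := c2 + c1 + (a1 + a2 + a3 + a4).
have {}r1 : b1 <= C * S by apply: bd r1 => //; rewrite /S; lra.
have {}r2 : b2 <= C * S by apply: bd r2 => //; rewrite /S; lra.
have {}r3 : b3 <= D * S by apply: bd r3 => //; rewrite /S; lra.
have {}r4 : b4 <= D * S by apply: bd r4 => //; rewrite /S; lra.
rewrite -mulrA (mulrDl C D); move: (C * S) (D * S) r1 r2 r3 r4 => x y; lra.
Qed.

(** One condition of [hsys_hL2] from each half-line. Reflection exchanges the two values at 0, so
    the second condition expresses f^-(0) through f^+(0). *)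
Lemma strong_inL2 gamma : exists2 C, 0 <= C & forall h f,
  inL2 U h -> strong gamma h f ->
  (inL2 U f <-> f (0, true) = Kp gamma h + psip U gamma * f (0, false) /\
     f (0, false) = Km gamma h + psim U gamma * f (0, true)) /\
  (inL2 U f -> normmu U f ^+ 2 <=
     C * (normc (f (0, true)) ^+ 2 + normc (f (0, false)) ^+ 2 + normmu U h ^+ 2)).
Proof.
have [C [C0 HC]] := hsys_hL2 uv gamma; have [D [D0 HD]] := hsys_hL2 uvm gamma.
exists (2 * (C + D)); first by rewrite mulr_ge0 ?addr_ge0.
move=> h f Lh; have /inL2_halves[L1 L2 L3 L4] := Lh.
move=> /strongP[S1 S2].
have [p1 p2 p3 p4] := HC _ _ _ _ L1 L2 S1.
have [q1 q2 q3 q4] := HD _ _ _ _ L3 L4 S2.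
have e1 : fminus (mirror f) 0 = f (0, true) by rewrite /fminus /mirror /= oppr0.
have e2 : fplus (mirror f) 0 = f (0, false) by rewrite /fplus /mirror /= oppr0.
rewrite e1 e2 in q2 q3 q4.
split.
  rewrite psim_hpsi inL2_halves.
  split=> [[A1 A2 A3 A4]|[A1 A2]]; first by split; [exact/p3|exact/q3].
  by split; [exact (p3.2 A1)|exact p1|exact (q3.2 A2)|exact q1].
move=> Lf; rewrite !normmu_sq//; have /inL2_halves[F1 F2 F3 F4] := Lf.
move: p2 q2 (p4 F1) (q4 F3).
apply: norms_le => //; try exact: rnrm_ge0; exact: sqr_ge0.
Qed.

Lemma inL2_ae f g : emeas g -> aeeq f g -> inL2 U f -> inL2 U g.
Proof.
move=> mg fg Lf th; split=> //; have [mf /integrableP[mf2 fi]] := Lf th.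
have m2 : measurable_fun setT (fun x => normc (g (x, th)) ^+ 2 * expR (- U x)).
  apply: measurable_funM.
    by apply: measurable_funX; apply: cmeas_normc; exact: mg.
  apply: continuous_measurable_fun => x; apply: continuous_comp; last exact: continuous_expR.
  by apply: continuousN; exact: cU.
apply/integrableP; split; first exact/measurable_EFinP.
apply: le_lt_trans fi; rewrite le_eqVlt; apply/orP; left; apply/eqP.
apply: ae_eq_integral => //.
- by apply: measurableT_comp => //; exact/measurable_EFinP.
- exact: measurableT_comp.
- by apply: (aeS _ (fg th)) => x -> _.
Qed.

(** A continuous function plus a multiple of a function of the weighted space: this is the form of f
    and of its derivative [drift]. On segments e^u is bounded, which removes the weight. *)
Lemma L2loc_weighted (u : R -> R) (G w : R -> R[i]) (c : R[i]) : continuous u -> ccont G ->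
  cmeasurable w -> mu.-integrable setT (fun x => (normc (w x) ^+ 2 * expR (- u x))%:E) ->
  L2loc (fun x => G x + c * w x).
Proof.
move=> cu cG mw wi.
have mG : cmeas setT G by exact: ccont_meas.
have mf : cmeasurable (fun x => G x + c * w x) by apply: cmeasD => //; exact: cmeasZ.
split=> //; apply: locally_integrable_of_itv.
  by apply: measurable_funX; exact: cmeas_normc.
move=> M; have mI : lmeasurable `[- M, M] by exact: measurable_itv.
have ceu : continuous (fun x => expR (u x)).
  by move=> x; apply: continuous_comp; [exact: cu|exact: continuous_expR].
have [K HK] := @ccont_bounded _ G (- M) M cG; have [B HB] := @cont_bounded _ _ (- M) M ceu.
have wi' : mu.-integrable `[- M, M] (EFin \o (fun x => normc (w x) ^+ 2 * expR (- u x))).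
  exact: integrableS wi.
have i1 : mu.-integrable `[- M, M] (EFin \o (fun x => expR (u x) * (normc (w x) ^+ 2 * expR (- u x)))).
  apply: (integrableM_bounded (M := B)) => //.
  by apply: measurable_funTS; exact: continuous_measurable_fun.
have i2 : mu.-integrable `[- M, M] (EFin \o (fun=> 2 * K ^+ 2)).
  apply: continuous_compact_integrable; first exact: segment_compact.
  by apply: continuous_subspaceT => x; exact: cvg_cst.
have i3 := integrableD mI i2 (integrable_EFinZ (2 * normc c ^+ 2) mI i1).
apply: (le_integrable _ _ _ i3) => //.
  apply/measurable_EFinP; apply: measurable_funTS.
  by apply: measurable_funX; exact: cmeas_normc.
move=> x; rewrite /= in_itv/= => xM; rewrite lee_fin (ger0_norm (sqr_ge0 _)).
apply: le_trans (ler_norm _).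
have -> : expR (u x) * (normc (w x) ^+ 2 * expR (- u x)) = normc (w x) ^+ 2.
  by rewrite mulrCA -expRD subrr expR0 mulr1.
apply: (@le_trans _ _ ((K + normc c * normc (w x)) ^+ 2)).
  have K0 : 0 <= K by exact: le_trans (normc_ge0 _) (HK x xM).
  rewrite ler_sqr ?nnegrE ?normc_ge0 ?addr_ge0 ?mulr_ge0 ?normc_ge0//.
  by apply: (le_trans (normc_leD _ _)); rewrite normcM lerD2r; exact: HK.
rewrite -[_ * normc c ^+ 2 * _]mulrA -exprMn.
by move: (normc c * normc (w x)) => z; have := sqr_ge0 (K - z); nra.
Qed.

Lemma inL2_0 : inL2 U (fun=> 0).
Proof.
move=> th; split; first by split; exact: measurable_cst.
rewrite (_ : (fun=> _) = cst 0%E); first exact: integrable0.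
by apply/funext => x; rewrite normc0 expr0n mul0r.
Qed.

Lemma inL2_lin (c : R[i]) f g : inL2 U f -> inL2 U g -> inL2 U (fun p => c * f p + g p).
Proof.
move=> /inL2_halves[f1 f2 f3 f4] /inL2_halves[g1 g2 g3 g4].
have key u v (w w' : R -> R[i]) : potential u v -> hL2 u w -> hL2 u w' ->
    hL2 u (fun x => c * w x + w' x).
  by move=> p Lw Lw'; have [] := hL2D p (hL2Z p c Lw).1 Lw'.
by apply/inL2_halves; split; [exact: key uv _ _|exact: key uv _ _|exact: key uvm _ _|exact: key uvm _ _].
Qed.

Lemma rate_continuous th : continuous (fun x => rate U lrefr (x, th)).
Proof.
case: th.
  have -> : (fun x => rate U lrefr (x, true)) = (fun x => Num.max (V x) 0).
    by apply/funext => x; rewrite rate_true.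
  by move=> x; apply: (@continuous_max _ _ V (fun=> 0)); [exact: cV|exact: cvg_cst].
have -> : (fun x => rate U lrefr (x, false)) = (fun x => Num.max (- V x) 0).
  by apply/funext => x; rewrite rate_false.
move=> x; apply: (@continuous_max _ _ (fun y => - V y) (fun=> 0)); last exact: cvg_cst.
by apply: continuousN; exact: cV.
Qed.

Lemma velocity_sq (th : bool) (z : R[i]) : (velocity th)%:C * ((velocity th)%:C * z) = z :> R[i].
Proof. by case: th; rewrite /velocity /= ?mul1r// raddfN /= !mulN1r opprK. Qed.

Lemma drift_split gamma h f th (x : R) : drift gamma h f th x =
  (velocity th)%:C * (gamma * f (x, th) -
     (rate U lrefr (x, th))%:C * (f (x, ~~ th) - f (x, th))) +
  (- (velocity th)%:C) * h (x, th).
Proof. by rewrite /drift; ring. Qed.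

(** From left to right, each component gets an absolutely continuous representative; the equation,
    valid almost everywhere, allows its density to be replaced by [drift]. From right to left,
    [drift] is a weak derivative of f, hence equal almost everywhere to the chosen [wderiv]. *)
Lemma resolventP gamma h f : inL2 U h -> is_resolvent U lrefr gamma h f <->
  emeas f /\ exists F, [/\ strong gamma h F, inL2 U F & aeeq f F].
Proof.
move=> Lh.
have cr th := ccont_real (@rate_continuous th).
have cG F th : (forall th, ccont (fun x => F (x, th))) ->
    ccont (fun x => (velocity th)%:C * (gamma * F (x, th) -
     (rate U lrefr (x, th))%:C * (F (x, ~~ th) - F (x, th)))).
  move=> cF; apply: ccontM; first exact: ccont_cst.
  apply: ccontD; first by apply: ccontM => //; exact: ccont_cst.
  apply: ccontN; apply: ccontM => //; apply: ccontD => //; exact: ccontN.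
have mD F th : (forall th, ccont (fun x => F (x, th))) -> cmeasurable (drift gamma h F th).
  move=> cF; rewrite (funext (drift_split gamma h F th)).
  apply: cmeasD; first exact: ccont_meas (cG F th cF).
  by apply: cmeasZ; have [] := Lh th.
split=> [[[Lf Wf Lz] E]|[mf [F [SF LF fF]]]].
  split=> [th|]; first by have [] := Lf th.
  have key th : exists2 G, prim setT G (wderiv (fun x => f (x, th))) &
      {ae mu, forall x, f (x, th) = G x}.
    by apply: weak_derivative_prim; have [_ [g _ H]] := Wf th; exact: wderivP H.
  have [G1 P1 E1] := key true; have [G2 P2 E2] := key false.
  pose F : phase R -> R[i] := fun p => if p.2 then G1 p.1 else G2 p.1.
  have EF : aeeq f F by case; [exact: E1|exact: E2].
  have PF th : prim setT (fun x => F (x, th)) (wderiv (fun x => f (x, th))).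
    by case: th; [exact: P1|exact: P2].
  have cF th : ccont (fun x => F (x, th)) := prim_ccont (PF th).
  exists F; split=> //; last first.
    by apply: inL2_ae EF Lf => // th; exact: ccont_meas (cF th).
  move=> th; apply: (prim_ae _ (mD F th cF) _ (PF th)) => //.
  apply: (aeS _ (aeI (aeI (EF th) (EF (~~ th))) (E th))) => x [[e1 e2]].
  rewrite /shiftL /zzL /= => e3 _; rewrite /drift -e1 -e2 -e3.
  set D := wderiv _ _; rewrite -[LHS](velocity_sq th); congr (_ * _); ring.
have cF th : ccont (fun x => F (x, th)) := prim_ccont (SF th).
have W th : weak_derivative (fun x => f (x, th)) (drift gamma h F th).
  exact: prim_weak_derivative (SF th) (mD F th cF) (mf th) (fF th).
have Lf : inL2 U f by apply: inL2_ae LF => // th; apply: (aeS _ (fF th)) => x.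
have D th := wderiv_ae (W th).
(* L f is not estimated directly: it coincides almost everywhere with gamma f - h, which is in
   L^2(mu). *)
have Ez : aeeq (fun p => gamma * f p - h p) (zzL U lrefr f).
  move=> th; apply: (aeS _ (aeI (aeI (fF th) (fF (~~ th))) (D th))) => x [[e1 e2] e3].
  rewrite /zzL /= e3 /drift velocity_sq e1 e2; ring.
split; last first.
  by move=> th; apply: (aeS _ (Ez th)) => x; rewrite /shiftL => <-; ring.
split=> //.
  move=> th; split.
    have [m1 i1] := Lf th.
    have := @L2loc_weighted U (fun=> 0) _ 1 cU (ccont_cst 0) m1 i1.
    by congr L2loc; apply/funext => x; rewrite add0r mul1r.
  exists (drift gamma h F th) => //.
  have [m1 i1] := Lh th.
  have := @L2loc_weighted U _ _ (- (velocity th)%:C) cU (cG F th cF) m1 i1.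
  by congr L2loc; apply/funext => x; rewrite drift_split.
apply: inL2_ae Ez _ => //.
  move=> th; rewrite /zzL /=.
  have [_ [m1 _] _] := wderivP (W th).
  apply: cmeasD; first exact: cmeasZ.
  apply: cmeasM; first exact: ccont_meas (cr th).
  by apply: cmeasB; exact: mf.
have := inL2_lin (-1) Lh (inL2_lin gamma Lf inL2_0).
by congr inL2; apply/funext => p; rewrite addr0 mulN1r addrC.
Qed.

Lemma aeeq_refl f : aeeq f f.
Proof.
by move=> th; exact: (@filterE _ _ (ae_filter_ringOfSetsType mu) (fun x => f (x, th) = f (x, th))).
Qed.

Lemma dotmu_ae f f' g g' : emeas f -> emeas f' -> emeas g -> emeas g' ->
  aeeq f f' -> aeeq g g' -> dotmu U f g = dotmu U f' g'.
Proof.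
move=> mf mf' mg mg' ff gg; apply: eq_bigr => th _.
have me : cmeas setT (fun x => (expR (- U x))%:C).
  apply: ccont_meas => //; apply: ccont_real => x.
  by apply: continuous_comp; [apply: continuousN; exact: cU|exact: continuous_expR].
apply: cint_ae => //.
- by do 2 (apply: cmeasM => //); [exact: mf|apply: cmeas_conj; exact: mg].
- by do 2 (apply: cmeasM => //); [exact: mf'|apply: cmeas_conj; exact: mg'].
- by apply: (aeS _ (aeI (ff th) (gg th))) => x [-> ->].
Qed.

Lemma strong_emeas gamma h F : strong gamma h F -> emeas F.
Proof. by move=> S th; exact: ccont_meas (prim_ccont (S th)). Qed.

Lemma strong_lin gamma c F : strong gamma zero F ->
  strong gamma zero (fun p => c * F p).
Proof.
move=> S th; have iT : is_interval [set: R] by [].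
apply: (eq_prim iT _ _ (primZ c (S th))) => // x _.
by rewrite /drift; move: (F _) (F _) => a b; ring.
Qed.

Lemma strong_zero gamma : strong gamma zero zero.
Proof.
move=> th; rewrite [X in prim _ _ X](_ : _ = fun=> 0); first exact: prim_cst.
by apply/funext => x; rewrite /drift !mulr0 !subr0 mulr0 subr0 mulr0.
Qed.

Lemma hK0 u v gamma : hK u v gamma zero zero = 0 :> R[i].
Proof.
rewrite /hK (eq_cint (g := zero)); last by move=> x _; rewrite mulr0.
rewrite [X in _ + X](eq_cint (g := zero)) ?cint0 ?addr0// => x _.
rewrite (eq_cint (g := zero)) ?cint0 ?mulr0// => t _.
by rewrite mulr0.
Qed.

Lemma sol_zero gamma : sol gamma 0 0 zero = zero.
Proof.
have := strong_zero gamma.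
by rewrite strong_sol//; exact: inL2_0.
Qed.

Let add_le (C D a b c d x y : R) : 0 <= C -> 0 <= D -> 0 <= a -> 0 <= b ->
  0 <= c -> 0 <= d -> x <= C * (a + b) -> y <= D * (c + d) ->
  x <= (C + D) * (a + b + c + d) /\ y <= (C + D) * (a + b + c + d).
Proof.
move=> C0 D0 a0 b0 c0 d0 hx hy.
by split; [apply: (le_trans hx)|apply: (le_trans hy)]; apply: ler_pM; rewrite ?addr_ge0//; lra.
Qed.

Lemma K_bound gamma : exists2 C, 0 <= C & forall h, inL2 U h ->
  normc (Kp gamma h) ^+ 2 <= C * normmu U h ^+ 2 /\
  normc (Km gamma h) ^+ 2 <= C * normmu U h ^+ 2.
Proof.
have [C [C0 HC]] := hK_bound uv gamma; have [D [D0 HD]] := hK_bound uvm gamma.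
exists (C + D); first exact: addr_ge0.
move=> h Lh; rewrite normmu_sq//; have /inL2_halves[L1 L2 L3 L4] := Lh.
apply: (add_le C0 D0 _ _ _ _ (HC _ _ L1 L2) (HD _ _ L3 L4)); exact: rnrm_ge0.
Qed.

(** Cramer's rule for the matrix with rows (1, -P) and (-M, 1), whose determinant 1 - P M is Z when
    P and M are the two psi. *)
Lemma solve2 (a b K0 K1 P M : R[i]) : 1 - P * M != 0 ->
  (a = K0 + P * b /\ b = K1 + M * a) <->
  (a = (1 - P * M)^-1 * (K0 + P * K1) /\ b = (1 - P * M)^-1 * (M * K0 + K1)).
Proof.
move=> Z0; split=> [[ea eb]|[-> ->]]; [|by split; field].
have eM : M * a = b - K1 by rewrite eb; ring.
have eP : P * b = a - K0 by rewrite ea; ring.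
split.
- apply: (mulfI Z0); rewrite [RHS]mulrA divff// [RHS]mul1r.
  transitivity (a - P * (M * a)); first by ring.
  by rewrite eM mulrBr eP; ring.
- apply: (mulfI Z0); rewrite [RHS]mulrA divff// [RHS]mul1r.
  transitivity (b - M * (P * b)); first by ring.
  by rewrite eP mulrBr eM; ring.
Qed.

Lemma kplusE gamma h : inL2 U h ->
  kplus U gamma h = (Zf U gamma)^-1 * (Kp gamma h + psip U gamma * Km gamma h).
Proof.
by move=> Lh; rewrite /kplus /kvec Kmap_hK// !mxE !big_ord_recl big_ord0 !mxE /= mul1r addr0.
Qed.

Lemma kminusE gamma h : inL2 U h ->
  kminus U gamma h = (Zf U gamma)^-1 * (psim U gamma * Kp gamma h + Km gamma h).
Proof.
by move=> Lh; rewrite /kminus /kvec Kmap_hK// !mxE !big_ord_recl big_ord0 !mxE /= mul1r addr0.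
Qed.

Lemma inL2_iff_k gamma h F : Zf U gamma != 0 -> inL2 U h -> strong gamma h F ->
  inL2 U F <-> F (0, true) = kplus U gamma h /\ F (0, false) = kminus U gamma h.
Proof.
move=> Z0 Lh S; have [C _ /(_ _ _ Lh S)[-> _]] := strong_inL2 gamma.
by rewrite kplusE// kminusE//; exact: solve2.
Qed.

Lemma resolvent_iff gamma h f : Zf U gamma != 0 -> inL2 U h ->
  is_resolvent U lrefr gamma h f <->
  emeas f /\ aeeq f (sol gamma (kplus U gamma h) (kminus U gamma h) h).
Proof.
move=> Z0 Lh; rewrite resolventP//.
split=> [[mf [F [SF LF fF]]]|[mf fF]]; split=> //.
  have [e1 e2] := (inL2_iff_k Z0 Lh SF).1 LF.
  by rewrite -e1 -e2; rewrite strong_sol// in SF; rewrite -SF.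
have S := sol_strong gamma (kplus U gamma h) (kminus U gamma h) Lh.
exists (sol gamma (kplus U gamma h) (kminus U gamma h) h); split=> //.
by apply/(inL2_iff_k Z0 Lh S); rewrite sol_plus0 sol_minus0.
Qed.

Lemma resolvent0P gamma f : resolvent gamma zero f <->
  domL U lrefr f /\ aeeq (zzL U lrefr f) (fun p => gamma * f p).
Proof.
split=> -[Df E]; split=> // th; apply: (aeS _ (E th)) => x; rewrite /shiftL.
  by move=> /eqP; rewrite subr_eq0 => /eqP ->.
by move=> ->; rewrite subrr.
Qed.

Lemma injective_shift_of_Z gamma : Zf U gamma != 0 -> injective_shift U lrefr gamma.
Proof.
have L0 := inL2_0; move=> Z0 f Df E; have : resolvent gamma zero f by [].
move=> /(resolvent_iff _ Z0 L0)[_].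
rewrite kplusE// kminusE// /Kp /Km !hK0 !mulr0 !addr0 !mulr0.
by rewrite sol_zero.
Qed.

Lemma normmu_ae f F : emeas f -> emeas F -> aeeq f F -> normmu U f = normmu U F.
Proof. by move=> mf mF fF; rewrite /normmu (dotmu_ae mf mF mf mF fF fF). Qed.

Lemma normmu_ge0 f : 0 <= normmu U f.
Proof. by rewrite /normmu sqrtr_ge0. Qed.

Lemma normmu_le_of_sq f h (C : R) : 0 <= C -> normmu U f ^+ 2 <= C * normmu U h ^+ 2 ->
  normmu U f <= Num.sqrt C * normmu U h.
Proof.
move=> C0 H; rewrite -ler_sqr ?nnegrE ?normmu_ge0 ?mulr_ge0 ?sqrtr_ge0 ?normmu_ge0//.
by rewrite exprMn (sqr_sqrtr C0).
Qed.

Lemma normc_sq_lin (z p x y : R[i]) :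
  normc (z * (x + p * y)) ^+ 2 <=
  2 * normc z ^+ 2 * (normc x ^+ 2 + normc p ^+ 2 * normc y ^+ 2).
Proof.
rewrite normcM exprMn.
have -> : 2 * normc z ^+ 2 * (normc x ^+ 2 + normc p ^+ 2 * normc y ^+ 2) =
  normc z ^+ 2 * (2 * (normc x ^+ 2 + normc p ^+ 2 * normc y ^+ 2)) by ring.
apply: ler_wpM2l; first exact: sqr_ge0.
apply: (@le_trans _ _ ((normc x + normc p * normc y) ^+ 2)).
  rewrite ler_sqr ?nnegrE ?addr_ge0 ?mulr_ge0 ?normc_ge0//.
  by apply: (le_trans (normc_leD _ _)); rewrite normcM.
rewrite -exprMn; move: (normc x) (normc p * normc y) => a b.
by have := sqr_ge0 (a - b); nra.
Qed.

Let lin_le (E a n z q x y : R) : 0 <= z -> 0 <= q -> x <= E * n -> y <= E * n ->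
  a <= 2 * z * (x + q * y) -> a <= (2 * z * (E + q * E)) * n.
Proof.
move=> z0 q0 hx hy /le_trans; apply; rewrite -[leRHS]mulrA ler_wpM2l ?mulr_ge0//.
by rewrite mulrDl -mulrA lerD// ler_wpM2l.
Qed.

Lemma rhoL_of_Z gamma : Zf U gamma != 0 -> rhoL U lrefr gamma.
Proof.
move=> Z0; split; first exact: injective_shift_of_Z.
  move=> h Lh; exists (sol gamma (kplus U gamma h) (kminus U gamma h) h).
  apply/(resolvent_iff _ Z0 Lh); split; last exact: aeeq_refl.
  exact: strong_emeas (sol_strong gamma _ _ Lh).
have [C C0 HC] := strong_inL2 gamma.
have [E E0 HE] := K_bound gamma.
set z := normc (Zf U gamma)^-1 ^+ 2; set q := normc (psip U gamma) ^+ 2.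
set q' := normc (psim U gamma) ^+ 2.
(* Each squared constant |k|^2 is at most 2 |1/Z|^2 (E + |psi|^2 E) times the squared norm of h; the
   final 1 stands for the norm of h itself in the estimate of [strong_inL2]. *)
pose D := C * (2 * z * (E + q * E) + 2 * z * (E + q' * E) + 1).
exists (Num.sqrt D) => h f Lh.
move=> /(resolventP _ _ Lh)[mf [F [SF LF fF]]].
rewrite (normmu_ae mf (strong_emeas SF) fF).
have [_ /(_ LF) HF] := HC _ _ Lh SF.
have [e1 e2] := (inL2_iff_k Z0 Lh SF).1 LF.
have [b1 b2] := HE _ Lh.
rewrite e1 e2 kplusE// kminusE// in HF.
rewrite [psim U gamma * _ + _]addrC in HF.
have z0 : 0 <= z by exact: sqr_ge0.
have q0 : 0 <= q by exact: sqr_ge0.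
have q'0 : 0 <= q' by exact: sqr_ge0.
have H1 := lin_le z0 q0 b1 b2 (normc_sq_lin _ _ _ _).
have H2 := lin_le z0 q'0 b2 b1 (normc_sq_lin _ _ _ _).
apply: normmu_le_of_sq.
  apply: mulr_ge0 => //; apply: addr_ge0 => //.
  have key t : 0 <= t -> 0 <= 2 * z * (E + t * E).
    by move=> t0; apply: mulr_ge0; [exact: mulr_ge0|apply: addr_ge0 => //; exact: mulr_ge0].
  by apply: addr_ge0; exact: key.
apply: (le_trans HF); rewrite /D -[leRHS]mulrA; apply: ler_wpM2l => //.
by rewrite [leRHS]mulrDl mul1r lerD2r [leRHS]mulrDl lerD.
Qed.

Lemma hr_zero u v gamma k (x : R) : hr u v gamma k zero zero x =
  k * ((v x)%:C * cexp (- (2 * gamma * x%:C) - (u x)%:C)).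
Proof.
rewrite eq_fun_hr mulr0 add0r (eq_cint (g := zero)) ?cint0 ?mulr0 ?addr0// => t _.
by rewrite mulr0.
Qed.

(** The relation c = k psi is the condition for square integrability when h = 0; it turns the
    integral over [0, x] into one over [x, +oo[, as in the formula for the eigenfunction. *)
Lemma hq_tail u v gamma c k (x : R) : potential u v -> 0 <= x -> c = k * hpsi u v gamma ->
  hq u v gamma c k zero zero x = cexp (gamma * x%:C + (u x)%:C) *
    (k * \cint_(t in `[x, +oo[) ((v t)%:C * cexp (- (2 * gamma * t%:C) - (u t)%:C))).
Proof.
move=> p x0 ->; have vi := vexp_cintegrable p gamma.
rewrite /hq /hpsi (cint_splity x0 vi); congr (_ * _).
have -> : cint `[0, x] (hr u v gamma k zero zero) =
    k * cint `[0, x] (fun t => (v t)%:C * cexp (- (2 * gamma * t%:C) - (u t)%:C)).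
  rewrite -cintZ//; last exact: cintegrable_halflineS vi.
  by apply: eq_cint => t _; exact: hr_zero.
by rewrite mulrDr addrAC subrr add0r.
Qed.

Lemma hp_zero gamma k (x : R) : hp gamma k zero x = cexp (- (gamma * x%:C)) * k.
Proof.
rewrite /hp (eq_cint (g := zero)) ?cint0 ?addr0// => t _.
by rewrite mulr0.
Qed.

(** With h = 0 the conditions at 0 are f^+(0) = psi^+ f^-(0) and f^-(0) = psi^- f^+(0). When psi^+
    psi^- = 1 they are solved by (psi^+, 1), the values chosen in f_gamma. *)
Lemma eigenfun_sol gamma : Zf U gamma = 0 ->
  eigenfun U gamma = sol gamma (psip U gamma) 1 zero.
Proof.
move=> /eqP; rewrite /Zf subr_eq0 eq_sym => /eqP PM.
apply/funext => -[x []]; rewrite /eigenfun /sol /=.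
  rewrite /eigen_plus; case: ifPn => [x0|]; last rewrite -ltNge => x0.
    rewrite -[fminus _]/zero hp_zero mulrC; congr (cexp _ * _).
    by rewrite raddfN /= mulrN opprK.
  rewrite -[fminus _]/zero -[fplus _]/zero hq_tail ?ltW//; first by rewrite mul1r.
  by rewrite mul1r.
rewrite /eigen_minus; have [x0|x0|->] := ltgtP x 0.
- rewrite -[fminus _]/zero -[fplus _]/zero hq_tail//; last 2 first.
  + by rewrite oppr_ge0 ltW.
  + by rewrite -psim_hpsi PM.
  have x0' : 0 <= - x by rewrite oppr_ge0 ltW.
  have e := cint_opp_rayN (cintegrable_halflineSy x0' (vexp_cintegrable uvm gamma)).
  have -> : \cint_(xi in `]-oo, x]) ((V xi)%:C * cexp (2 * gamma * xi%:C - (U xi)%:C)) =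
      - \cint_(t in `[- x, +oo[) ((Vm t)%:C * cexp (- (2 * gamma * t%:C) - (Um t)%:C)).
    by rewrite opprK in e; apply: etrans e; apply: eq_cint => t _; exact: weightN.
  rewrite mulrN !mulNr opprK mulrA; congr (_ * _); rewrite mulrC; congr (cexp _ * _).
  by rewrite opprK raddfN /= mulrN.
- by rewrite -[fminus _]/zero hp_zero mulr1.
(* At 0 [eigen_minus] uses its right-hand formula and [sol] its left-hand one; both give 1. *)
- rewrite oppr0 hq0 ?oppr0//.
  by rewrite mulr0 oppr0 cexp0.
Qed.

Lemma resolvent_formula_sol gamma h : inL2 U h ->
  resolvent_formula U gamma h = sol gamma (kplus U gamma h) (kminus U gamma h) h.
Proof.
move=> Lh; have /inL2_halves[L1 L2 L3 L4] := Lh.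
set kp := kplus _ _ _; set km := kminus _ _ _.
apply/funext => -[x []]; rewrite /resolvent_formula /sol /=.
  rewrite /resolvent_plus -/kp -/km; case: ifPn => // x0.
  by rewrite /hp cint_mirror// raddfN /= mulrN opprK.
rewrite /resolvent_minus -/kp -/km; case: ifPn => // x0.
rewrite /hq opprK raddfN /= mulrN; congr (_ * (_ - _)).
have ci : cintegrable `[0, - x] (hr Um Vm gamma kp (fplus (mirror h)) (fminus (mirror h))).
  by apply: cintegrable_halflineS (hr_cintegrable uvm gamma kp L3 L4).
have [_ <-] := cint_opp_itv ci; rewrite opprK oppr0.
apply: eq_cint => t; rewrite inE/= in_itv/= => /andP[_ t0].
rewrite /hr /eweight -cint_mirror// /fplus /mirror /= !opprK !raddfN /= !mulrN !opprK.
by rewrite !mulNr.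
Qed.

(** A square integrable solution is determined by its values at 0, and f^+(0) = psi^+ f^-(0) leaves
    a single free constant; conversely Z = 0 makes the second condition follow from the first. *)
Lemma eigen_iff gamma f : Zf U gamma = 0 -> resolvent gamma zero f <->
  emeas f /\ exists c, aeeq f (fun p => c * eigenfun U gamma p).
Proof.
move=> Z0; have L0 := inL2_0; have [C _ HC] := strong_inL2 gamma.
have K0 : Kp gamma zero = 0 by exact: hK0.
have K1 : Km gamma zero = 0 by exact: hK0.
have Se : strong gamma zero (eigenfun U gamma).
  by rewrite (eigenfun_sol Z0); exact: sol_strong.
have Sc c := strong_lin c Se.
have e1 c : c * eigenfun U gamma (0, true) = c * psip U gamma.
  by rewrite (eigenfun_sol Z0) sol_plus0.
have e2 c : c * eigenfun U gamma (0, false) = c.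
  by rewrite (eigenfun_sol Z0) sol_minus0 mulr1.
rewrite resolventP//; split=> -[mf H]; split=> //.
  (* The coefficient is F^-(0), because f_gamma^-(0) = 1. *)
  have [F [SF LF fF]] := H; exists (F (0, false)).
  have [/(_ LF)[+ _] _] := (HC _ _ inL2_0 SF).1; rewrite K0 add0r => eF.
  move: (Sc (F (0, false))) SF.
  rewrite !strong_sol// e1 e2 => -> eF'.
  by rewrite mulrC -eF -eF'.
have [c fF] := H; exists (fun p => c * eigenfun U gamma p); split=> //.
have [[_ E] _] := HC _ _ inL2_0 (Sc c); apply: E; rewrite e1 e2 K0 K1 !add0r; split.
  by rewrite mulrC.
move/eqP: Z0; rewrite /Zf subr_eq0 => /eqP PM.
by rewrite mulrCA [psim _ _ * _]mulrC -PM mulr1.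
Qed.

(** On x >= 0 the component f_gamma^- is an exponential, which vanishes nowhere. *)
Lemma eigenfun_neq0 gamma : ~ aeeq (eigenfun U gamma) zero.
Proof.
move=> /(_ false)/ae_exists[x /andP[x0 _]]; rewrite /eigenfun /= /eigen_minus x0.
by move=> /(congr1 (@normc R))/eqP; rewrite normc_cexp normc0 gt_eqF// expR_gt0.
Qed.

Lemma eigenfun_resolvent gamma : Zf U gamma = 0 -> resolvent gamma zero (eigenfun U gamma).
Proof.
move=> Z0; apply/(eigen_iff _ Z0); split.
  rewrite (eigenfun_sol Z0).
  exact: strong_emeas (sol_strong gamma _ _ inL2_0).
by exists 1 => th; apply: (aeS _ (aeeq_refl (eigenfun U gamma) th)) => x _; rewrite mul1r.
Qed.

Lemma sigmapLE : sigmapL U lrefr = SigmaZ U.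
Proof.
apply/seteqP; split=> gamma.
  move=> H; apply: contrapT => /eqP Z0; apply: H.
  exact: (injective_shift_of_Z Z0).
move=> Z0 H; have [D E] := eigenfun_resolvent Z0.
exact: (@eigenfun_neq0 gamma) (H _ D E).
Qed.

Lemma rhoLE gamma : rhoL U lrefr gamma <-> Zf U gamma != 0.
Proof.
split=> [[H _ _]|]; last exact: rhoL_of_Z.
apply/negP => /eqP Z0; have : sigmapL U lrefr gamma by rewrite sigmapLE.
by apply.
Qed.

Let ac4 (a b c d : R[i]) : a + b + (c + d) = a + c + (d + b).
Proof. by ring. Qed.

Lemma cint_hdot u v (p1 q1 p2 q2 : R -> R[i]) : potential u v ->
  hL2 u p1 -> hL2 u q1 -> hL2 u p2 -> hL2 u q2 ->
  cint halfline (hdot u p1 q1 p2 q2) =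
  cint halfline (fun x => p1 x * conjc (q2 x) * (expR (- u x))%:C) +
  cint halfline (fun x => q1 x * conjc (p2 x) * (expR (- u x))%:C).
Proof.
move=> p P1 Q1 P2 Q2; rewrite -cintD//; last 2 first.
- exact: (hL2_dot p P1 Q2).
- exact: (hL2_dot p Q1 P2).
by apply: eq_cint => x _; rewrite /hdot mulrDl.
Qed.

(** Adding the Wronskian identities of the two half-lines, the boundary terms at 0 are opposite,
    since reflection exchanges f^+ and f^-. What remains is (conj gamma2 - gamma1) times the inner
    product of F f1 with f2. *)
Lemma eigen_orthogonal gamma1 gamma2 f1 f2 : resolvent gamma1 zero f1 -> resolvent gamma2 zero f2 ->
  gamma1 = conjc gamma2 \/ dotmu U (flip f1) f2 = 0.
Proof.
move=> /(resolventP _ _ inL2_0)[m1 [F1 [S1 LF1 E1]]].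
move=> /(resolventP _ _ inL2_0)[m2 [F2 [S2 LF2 E2]]].
have [->|/eqP g12] := eqVneq gamma1 (conjc gamma2); [by left|right].
rewrite (dotmu_ae (f' := flip F1) (g' := F2)); first last.
- exact: E2.
- by move=> th; exact: E1 (~~ th).
- exact: strong_emeas S2.
- by [].
- by move=> th; exact: strong_emeas S1 (~~ th).
- by move=> th; exact: m1 (~~ th).
have /inL2_halves[P1 Q1 P1' Q1'] := LF1; have /inL2_halves[P2 Q2 P2' Q2'] := LF2.
move: S1 S2 => /strongP[A1 B1] /strongP[A2 B2].
have W1 := hwronskian uv A1 A2 Q1 P1 Q2 P2.
have W2 := hwronskian uvm B1 B2 Q1' P1' Q2' P2'.
have {W1 W2} W : (conjc gamma2 - gamma1) *
    (cint halfline (hdot U (fminus F1) (fplus F1) (fminus F2) (fplus F2)) +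
     cint halfline (hdot Um (fminus (mirror F1)) (fplus (mirror F1)) (fminus (mirror F2)) (fplus (mirror F2)))) = 0.
  rewrite mulrDr W1 W2 /fminus /fplus /mirror /= oppr0.
  by move: (F1 _) (F1 _) (conjc (F2 _)) (conjc (F2 _)) => a b c d; ring.
move/eqP: W; rewrite mulf_eq0 subr_eq0 eq_sym => /orP[/eqP //|/eqP <-].
rewrite /dotmu big_bool /= /flip /=.
rewrite !cint_line; first last.
- exact: (hL2_dot uvm P1' Q2').
- exact: (hL2_dot uv Q1 P2).
- exact: (hL2_dot uvm Q1' P2').
- exact: (hL2_dot uv P1 Q2).
rewrite (cint_hdot uv Q1 P1 Q2 P2) (cint_hdot uvm Q1' P1' Q2' P2').
rewrite /fminus /fplus /mirror /=.
exact: ac4.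
Qed.

End ZigZagSpectrum.

(** * The hypotheses on U read on each half-line, and the theorem *)

Lemma C2_potential (R : realType) (U : R -> R) : C2 U ->
  derive1 U x @[x --> +oo%R] --> +oo%R -> U 0 = 0 ->
  (forall x, 0 <= x -> 0 <= derive1 U x) -> potential U (derive1 U).
Proof.
move=> [d1 d2 _] Uy U0 U_ge0; split=> [x|x|x x0||].
- exact: derivable_is_derive.
- exact/differentiable_continuous/derivable1_diffP.
- exact: U_ge0.
- exact: Uy.
- exact: U0.
Qed.

Lemma C2_potential_opp (R : realType) (U : R -> R) : C2 U ->
  derive1 U x @[x --> -oo%R] --> -oo%R -> U 0 = 0 ->
  (forall x, x <= 0 -> derive1 U x <= 0) ->
  potential (fun x => U (- x)) (fun x => - derive1 U (- x)).
Proof.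
move=> [d1 d2 _] Uy U0 U_le0; split=> [x|x|x x0||]; last by rewrite oppr0.
- have dU := derivable_is_derive (d1 (- x)).
  have dN : is_derive x 1 (-%R : R -> R) (- 1) by exact: is_deriveNid.
  by rewrite -mulrN1; exact: (@is_derive1_comp _ U (-%R) x _ _ dU dN).
- have c2 : continuous (derive1 U).
    by move=> y; exact/differentiable_continuous/derivable1_diffP.
  have cc : continuous (derive1 U \o -%R).
    by move=> y; apply: continuous_comp; [exact: oppr_continuous|exact: c2].
  exact: (cvgN (cc x)).
- by rewrite oppr_ge0 U_le0// oppr_le0.
- apply/cvgNrNy; have := (@cvgNy_compNP _ R (derive1 U) _).1 Uy.
  by congr cvg_to; apply/funext => x /=; rewrite opprK.
Qed.

Lemma col2_lin (R : realType) (c x y x' y' : R[i]) :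
  col2 (c * x + x') (c * y + y') = c *: col2 x y + col2 x' y'.
Proof. by apply/matrixP => i j; rewrite !mxE; case: ifP. Qed.

Theorem theorem4p4 (R : realType) (U lrefr : R -> R) (delta a A : R)
  (lrefr_cont : continuous lrefr)
  (lrefr_ge0 : forall x, 0 <= lrefr x)
  (U_C2 : C2 U)
  (expU_L1 : lebesgue_measure.-integrable setT (fun x => (expR (- U x))%:E))
  (delta01 : 0 < delta < 1)
  (A_gt0 : 0 < A)
  (U_bounds : forall x,
     a <= derive1 (derive1 U) x <= delta * `|derive1 U x| ^+ 2 + A)
  (U_pinfty : derive1 U x @[x --> +oo%R] --> +oo%R)
  (U_ninfty : derive1 U x @[x --> -oo%R] --> -oo%R)
  (U0 : U 0 = 0)
  (U_le0 : forall x, x <= 0 -> derive1 U x <= 0)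
  (U_ge0 : forall x, 0 <= x -> 0 <= derive1 U x)
  (lrefr0 : forall x, lrefr x = 0) :
  (sigmaL U lrefr = sigmapL U lrefr /\ sigmapL U lrefr = SigmaZ U) /\
  (forall gamma, rhoL U lrefr gamma ->
     (forall h, inL2 U h ->
        forall f, is_resolvent U lrefr gamma h f ->
          aeeq f (resolvent_formula U gamma h)) /\
     (forall (c : R[i]) g h, inL2 U g -> inL2 U h ->
        Kmap U gamma (fun p => c * g p + h p) =
        c *: Kmap U gamma g + Kmap U gamma h) /\
     (exists M : R, forall h, inL2 U h ->
        forall i : 'I_2, normc (Kmap U gamma h i 0) <= M * normmu U h)) /\
  (forall gamma, sigmapL U lrefr gamma ->
     is_eigenfunction U lrefr gamma (eigenfun U gamma) /\
     forall f, inL2 U f ->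
       (domL U lrefr f /\ aeeq (zzL U lrefr f) (fun p => gamma * f p)) <->
       exists c : R[i], aeeq f (fun p => c * eigenfun U gamma p)) /\
  (forall gamma1 gamma2 f1 f2,
     sigmapL U lrefr gamma1 -> sigmapL U lrefr gamma2 -> gamma1 != gamma2 ->
     is_eigenfunction U lrefr gamma1 f1 ->
     is_eigenfunction U lrefr gamma2 f2 ->
     gamma1 = conjc gamma2 \/ dotmu U (flip f1) f2 = 0).
Proof.
have uv := C2_potential U_C2 U_pinfty U0 U_ge0.
have uvm := C2_potential_opp U_C2 U_ninfty U0 U_le0.
have sE := sigmapLE uv uvm lrefr0 U_ge0 U_le0.
have rE := rhoLE uv uvm lrefr0 U_ge0 U_le0.
split; first split=> //.
  rewrite sE; apply/seteqP; split=> gamma.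
    by move=> H; apply: contrapT => /eqP /rE.
  by move=> Z0 /rE /eqP; apply.
split; [|split].
- move=> gamma /rE Z0; split; [|split].
  + move=> h Lh f /(resolvent_iff uv uvm lrefr0 U_ge0 U_le0 _ Z0 Lh)[_].
    by rewrite (resolvent_formula_sol uvm).
  + move=> c g h Lg Lh; have Lgh := inL2_lin uv uvm c Lg Lh.
    rewrite !(Kmap_hK uvm)//.
    have /(inL2_halves U)[g1 g2 g3 g4] := Lg; have /(inL2_halves U)[h1 h2 h3 h4] := Lh.
    rewrite /Kp /Km (hK_linear uv gamma c g1 g2 h1 h2) (hK_linear uvm gamma c g3 g4 h3 h4).
    exact: col2_lin.
  + have [C C0 HC] := K_bound uv uvm gamma; exists (Num.sqrt C) => h Lh i.
    have [k1 k2] := HC h Lh; rewrite (Kmap_hK uvm)// mxE.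
    rewrite -ler_sqr ?nnegrE ?normc_ge0 ?mulr_ge0 ?sqrtr_ge0 ?normmu_ge0//.
    by rewrite exprMn (sqr_sqrtr C0); case: (i == 0); [exact: k1|exact: k2].
- move=> gamma; rewrite sE => Z0; split.
    have /resolvent0P[D E] := eigenfun_resolvent uv uvm lrefr0 U_ge0 U_le0 Z0.
    by split=> //; exact: eigenfun_neq0.
  move=> f Lf; rewrite -resolvent0P (eigen_iff uv uvm lrefr0 U_ge0 U_le0 f Z0).
  by split=> [[]|] // H; split=> // th; have [] := Lf th.
move=> gamma1 gamma2 f1 f2 _ _ _ [D1 _ E1] [D2 _ E2].
have R1 : is_resolvent U lrefr gamma1 (fun=> 0) f1 by apply/resolvent0P.
have R2 : is_resolvent U lrefr gamma2 (fun=> 0) f2 by apply/resolvent0P.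
exact (eigen_orthogonal uv uvm lrefr0 U_ge0 U_le0 R1 R2).
Qed.
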